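(* Let $k_n\ge2$ be integers with $k_n\to\infty$ and let $\boldsymbol Z_n=(Z_{n,1},\dots,Z_{n,k_n})$, $Z_{n,i}=(X_{n,i},Y_{n,i})$ with $0<Y_{n,i}\le X_{n,i}$, be a triangular array of random vectors with $\lim_{n\to\infty}\Pr(Z_{n,1}=\cdots=Z_{n,k_n})=0$. Suppose there exist $\rho\in\mathcal C$, $\alpha_0>0$, $(\sigma_n)_n\subset(0,\infty)$ and constants $0<\alpha_-<\alpha_1<\alpha_+<\infty$, where $\alpha_1=\varpi_{\rho_0}\alpha_0$ and $\rho_0=\rho(0)$, such that $$\frac1{k_n}\sum_{i=1}^{k_n} f\Big(\frac{X_{n,i}}{\sigma_n},\frac{Y_{n,i}}{\sigma_n}\Big)\rightsquigarrow\int_{(0,\infty)^2}f\,\mathrm dH_{\rho,\alpha_0,1}\qquad\text{for all } f\in\mathcal F_2(\alpha_-,\alpha_+).$$ Suppose moreover that there exist a sequence $0<v_n\to\infty$ and a random vector $\boldsymbol W=(W_1,W_2,W_3,W_4)^\top$ such that $$\boldsymbol W_n:=(\mathbb G_nf_1,\mathbb G_nf_2,\mathbb G_nf_3,\mathbb G_nf_4)^\top\rightsquigarrow\boldsymbol W,$$ where $f_1(x,y)=y^{-\alpha_1}\log y$, $f_2(x,y)=y^{-\alpha_1}$, $f_3(x,y)=\log y$, $f_4(x,y)=\log x$ and $$\mathbb G_nf=v_n\Big\{\frac1{k_n}\sum_{i=1}^{k_n}f\Big(\frac{X_{n,i}}{\sigma_n},\frac{Y_{n,i}}{\sigma_n}\Big)-\int_{(0,\infty)^2}f\,\mathrm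 dH_{\rho,\alpha_0,1}\Big\}.$$ Then, with $s_1=(2/\Upsilon_{\rho_0}(\varpi_{\rho_0}))^{1/\alpha_1}$, the maximum likelihood estimator $(\hat\alpha_n,\hat\sigma_n)=\hat\theta(\boldsymbol Z_n)$ satisfies, as $n\to\infty$, $$v_n\begin{pmatrix}\hat\alpha_n-\alpha_1\\ \hat\sigma_n/\sigma_n-s_1\end{pmatrix}=M_{\rho_0}(\alpha_0)\boldsymbol W_n+o_{\mathbb P}(1)\rightsquigarrow M_{\rho_0}(\alpha_0)\boldsymbol W,$$ where $M_{\rho_0}(\alpha_0)\in\mathbb R^{2\times4}$ is the explicit matrix given in the context. If $\rho_0=1$ (that is, $\rho=\rho_{\mathrm{ind}}$ and $\alpha_1=\alpha_0$), then $$M_1(\alpha_0)=\frac{6}{2\pi^2-3}\begin{pmatrix}\alpha_0^2&\frac{3-2\gamma}2\alpha_0&-\alpha_0^2&-\alpha_0^2\\ \frac{2\gamma-3}2&\frac{3-2\pi^2-3(3-2\gamma)^2}{12\alpha_0}&\frac{3-2\gamma}2&\frac{3-2\gamma}2\end{pmatrix}.$$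
   Context: $\rightsquigarrow$ denotes weak convergence. Fréchet–Welsch distribution: $\mathcal C$ is the set of concave, nonincreasing $\rho:[0,1]\to[0,1]$ with $0\le\rho(\eta)\le1-\eta$ for all $\eta$. Write $\rho_0:=\rho(0)$, $\rho_{\mathrm{ind}}(\eta):=1-\eta$. For $\rho\in\mathcal C$, $\alpha,\sigma>0$, $\mathcal W(\rho,\alpha,\sigma)$ is the distribution on $(0,\infty)^2$ with cdf $H_{\rho,\alpha,\sigma}(x,y)=\exp(-(x/\sigma)^{-\alpha})$ if $y\ge x>0$ and $\exp(-(y/\sigma)^{-\alpha})\{1+\rho((y/x)^\alpha)(y/\sigma)^{-\alpha}\}$ if $x>y>0$. Maximum likelihood estimator: for $\boldsymbol z=((x_1,y_1),\dots,(x_k,y_k))$, $k\ge2$, $0<y_i\le x_i$, let $\ell(\alpha,\sigma|\boldsymbol z)=2k\log\alpha+2k\alpha\log\sigma-\sum_{i=1}^k\{(\alpha+1)\log(x_iy_i)+\sigma^\alpha y_i^{-\alpha}\}$. If the pairs are not all equal, it has a unique maximizer $\hat\theta(\boldsymbol z)=(\hat\alpha(\boldsymbol z),\hat\sigma(\boldsymbol z))$ over $(0,\infty)^2$. On $\{Z_{n,1}=\cdots=Z_{n,k_n}\}$ set $\hat\alpha_n=\infty$, $\hat\sigma_n=Y_{n,1}$. Constants: $\Gamma$ is the gamma function, $\gamma$ the Euler–Mascheroni constant, $\Upsilon_{\rho_0}(x)=\rho_0\Gamma(x+2)+(1-\rho_0)\Gamma(x+1)$, $\Pi_{\rho_0}(y)=\frac1y-\frac{\Upsilon_{\rho_0}'(y)}{\Upsilon_{\rho_0}(y)}+\frac{\rho_0}2-\gamma$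 ($y>0$), which is a continuous decreasing bijection from $(0,\infty)$ to $\mathbb R$; $\varpi_{\rho_0}\in(0,1]$ is its unique zero. Function class: $\mathcal F_2(\alpha_-,\alpha_+)$ consists of $(x,y)\mapsto\log x$, $(x,y)\mapsto\log y$, $(x,y)\mapsto(\log y)^2$, and $(x,y)\mapsto y^{-\alpha}(\log y)^m$ for all $m\in\{0,1,2\}$, $\alpha_-<\alpha<\alpha_+$. The matrix $M_{\rho_0}(\alpha_0)=(\beta_{jk})$: write $\Upsilon=\Upsilon_{\rho_0}(\varpi_{\rho_0})$, $\Upsilon'=\Upsilon_{\rho_0}'(\varpi_{\rho_0})$, $\Upsilon''=\Upsilon_{\rho_0}''(\varpi_{\rho_0})$, $z_0=\Upsilon/2$ and $$\dot\Psi=-\frac2{\alpha_1^2}-2\,\frac{\Upsilon''\Upsilon-(\Upsilon')^2}{\alpha_0^2\Upsilon^2}.$$ Then $$(\beta_{11},\beta_{12},\beta_{13},\beta_{14})=\frac1{\dot\Psi}\Big(-\frac2\Upsilon,\,-\frac{2\Upsilon'}{\alpha_0\Upsilon^2},\,1,\,1\Big),$$ $$\beta_{21}=\frac{z_0^{-1/\alpha_1}}{\alpha_1\dot\Psi}\Big\{\frac{\Upsilon'}{2\alpha_0z_0^2}-\frac{\log z_0}{\alpha_1z_0}\Big\},\qquad \beta_{22}=\frac{z_0^{-1/\alpha_1}}{\alpha_1\dot\Psi}\Big\{\frac{(\Upsilon')^2}{4\alpha_0^2z_0^3}-\frac{\Upsilon'\log z_0}{2\alpha_0\alpha_1z_0^2}\Big\}-\frac{z_0^{-1/\alpha_1-1}}{2\alpha_1},$$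 $$\beta_{23}=\beta_{24}=\frac{z_0^{-1/\alpha_1}}{\alpha_1\dot\Psi}\Big\{\frac{\log z_0}{\alpha_1}-\frac{\Upsilon'}{2\alpha_0z_0}\Big\}.$$ *)

(* Defs.v *)
From HB Require Import structures.
From mathcomp Require Import all_boot all_order all_algebra.
From mathcomp Require Import all_classical all_reals all_analysis.

Set Implicit Arguments.
Unset Strict Implicit.
Unset Printing Implicit Defensive.

Import Order.TTheory GRing.Theory Num.Theory.
Import numFieldNormedType.Exports.

Local Open Scope classical_set_scope.
Local Open Scope ring_scope.

Section convergence.
Context {R : realType} {d : nat -> measure_display}
  {T : forall n, measurableType (d n)} (P : forall n, probability (T n) R).

(* The n-th variable lives on its own probability space (T n, P n). *)
Definition weak_cvg (S : topologicalType) (V : forall n, T n -> S)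
    d' (T' : measurableType d') (Q : probability T' R) (V' : T' -> S) : Prop :=
  forall g : S -> R, continuous g -> bounded_fun g ->
    ('E_(P n)[g \o V n] @[n --> \oo] --> 'E_Q[g \o V'])%E.

Definition o_prob1 (V : forall n, T n -> \bar R * R) : Prop :=
  forall eps : R, 0 < eps ->
    P n [set w | (eps%:E < maxe `|(V n w).1| `|((V n w).2)%:E|)%E]
      @[n --> \oo] --> 0%E.

End convergence.

Section frechet_welsch.
Context {R : realType}.

(* Only the restriction of rho to [0, 1] matters. *)
Definition class_C (rho : R -> R) : Prop :=
  [/\ {in `[0, 1]%R, forall eta, 0 <= rho eta <= 1 - eta},
      {in `[0, 1]%R &, nonincreasing_fun rho} &
      convex_function (`[0, 1]%classic : set R) (\- rho)].

Definition FW_cdf (rho : R -> R) (alpha sigma x y : R) : R :=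
  if x <= y then expR (- ((x / sigma) `^ (- alpha)))
  else expR (- ((y / sigma) `^ (- alpha))) *
       (1 + rho ((y / x) `^ alpha) * (y / sigma) `^ (- alpha)).

Definition quadrant : set (R * R) := `]0, +oo[ `*` `]0, +oo[.

Definition is_FW (H : probability (R * R)%type R) (rho : R -> R)
    (alpha sigma : R) : Prop :=
  H quadrant = 1%E /\
  forall x y, 0 < x -> 0 < y ->
    H (`]-oo, x] `*` `]-oo, y]) = (FW_cdf rho alpha sigma x y)%:E.

Definition F2 (alpham alphap : R) : set (R * R -> R) :=
  [set f | [\/ f = (fun z => ln z.1), f = (fun z => ln z.2),
               f = (fun z => ln z.2 ^+ 2) |
               exists (m : nat) (alpha : R),
                 [/\ (m <= 2)%N, alpham < alpha < alphap &
                     f = (fun z => z.2 `^ (- alpha) * ln z.2 ^+ m)]]].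

End frechet_welsch.

Section maximum_likelihood.
Context {R : realType}.

Definition loglik (z : seq (R * R)) (alpha sigma : R) : R :=
  2 * (size z)%:R * ln alpha + 2 * (size z)%:R * alpha * ln sigma
  - \sum_(p <- z) ((alpha + 1) * ln (p.1 * p.2)
                   + sigma `^ alpha * p.2 `^ (- alpha)).

Definition loglik_argmax (z : seq (R * R)) : set (R * R) :=
  [set t | [/\ 0 < t.1, 0 < t.2 & forall alpha sigma,
     0 < alpha -> 0 < sigma -> loglik z alpha sigma <= loglik z t.1 t.2]].

(* [get] picks an arbitrary element of the set; the maximizer is unique as soon
   as the pairs are not all equal. *)
Definition alpha_hat (z : seq (R * R)) : \bar R :=
  if constant z then +oo%E else ((get (loglik_argmax z)).1)%:E.

Definition sigma_hat (z : seq (R * R)) : R :=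
  if constant z then (head (0, 0) z).2 else (get (loglik_argmax z)).2.

End maximum_likelihood.

Section constants.
Context {R : realType}.

Definition Gamma (x : R) : R :=
  \int[lebesgue_measure]_(t in `]0, +oo[) (t `^ (x - 1) * expR (- t)).

Definition euler_gamma : R :=
  limn (fun n => \sum_(1 <= i < n.+1) (i%:R^-1 : R) - ln (n%:R : R)).

Definition Upsilon (rho0 x : R) : R :=
  rho0 * Gamma (x + 2) + (1 - rho0) * Gamma (x + 1).

Definition Pi (rho0 y : R) : R :=
  y^-1 - (Upsilon rho0)^`()%classic y / Upsilon rho0 y + rho0 / 2 - euler_gamma.

(* The zero of [Pi rho0] on ]0, +oo[, which is unique for rho0 in [0, 1]. *)
Definition varpi (rho0 : R) : R := get [set y : R | 0 < y /\ Pi rho0 y = 0].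

Definition mx_of_rows m n (rows : seq (seq R)) : 'M[R]_(m, n) :=
  \matrix_(i < m, j < n) (nth [::] rows i)`_j.

Definition M (rho0 alpha0 : R) : 'M[R]_(2, 4) :=
  let alpha1 := varpi rho0 * alpha0 in
  let U := Upsilon rho0 (varpi rho0) in
  let U' := (Upsilon rho0)^`()%classic (varpi rho0) in
  let U'' := (Upsilon rho0)^`(2)%classic (varpi rho0) in
  let z0 := U / 2 in
  let dPsi := - (2 / alpha1 ^+ 2)
              - 2 * ((U'' * U - U' ^+ 2) / (alpha0 ^+ 2 * U ^+ 2)) in
  let c := z0 `^ (- alpha1^-1) / (alpha1 * dPsi) in
  let b11 := - (2 / U) / dPsi in
  let b12 := - (2 * U' / (alpha0 * U ^+ 2)) / dPsi in
  let b13 := dPsi^-1 in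
  let b21 := c * (U' / (2 * alpha0 * z0 ^+ 2) - ln z0 / (alpha1 * z0)) in
  let b22 := c * (U' ^+ 2 / (4 * alpha0 ^+ 2 * z0 ^+ 3)
                  - U' * ln z0 / (2 * alpha0 * alpha1 * z0 ^+ 2))
             - z0 `^ (- alpha1^-1 - 1) / (2 * alpha1) in
  let b23 := c * (ln z0 / alpha1 - U' / (2 * alpha0 * z0)) in
  mx_of_rows 2 4 [:: [:: b11; b12; b13; b13]; [:: b21; b22; b23; b23]].

Definition M1 (alpha0 : R) : 'M[R]_(2, 4) :=
  let g := euler_gamma in
  (6 / (2 * pi ^+ 2 - 3)) *: mx_of_rows 2 4
    [:: [:: alpha0 ^+ 2; (3 - 2 * g) / 2 * alpha0;
            - alpha0 ^+ 2; - alpha0 ^+ 2];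
        [:: (2 * g - 3) / 2;
            (3 - 2 * pi ^+ 2 - 3 * (3 - 2 * g) ^+ 2) / (12 * alpha0);
            (3 - 2 * g) / 2; (3 - 2 * g) / 2]].

Definition fvec (alpha1 : R) (i : 'I_4) : R * R -> R :=
  nth (fun=> 0) [:: (fun z => z.2 `^ (- alpha1) * ln z.2);
                    (fun z => z.2 `^ (- alpha1));
                    (fun z => ln z.2);
                    (fun z => ln z.1)] i.

End constants.

Section empirical.
Context {R : realType}.

Definition emp_mean k (z : k.-tuple (R * R)) (sigma : R) (f : R * R -> R) : R :=
  k%:R^-1 * \sum_(p <- z) f (p.1 / sigma, p.2 / sigma).

Definition emp_process k (z : k.-tuple (R * R)) (sigma v : R)
    (H : probability (R * R)%type R) (f : R * R -> R) : R :=
  v * (emp_mean z sigma f - \int[H]_(p in quadrant) f p).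

(* [MW + o_prob1] is stated through the difference: the first coordinate of an
   estimation error is extended because alpha_hat may be +oo. *)
Definition est_error k (z : k.-tuple (R * R)) (sigma v alpha1 s1 : R) :
    \bar R * R :=
  ((v%:E * (alpha_hat z - alpha1%:E))%E, v * (sigma_hat z / sigma - s1)).

Definition ext_pair (u : 'cV[R]_2) : \bar R * R := ((u 0 0)%:E, u 1 0).

Definition sub_pair (a b : \bar R * R) : \bar R * R :=
  ((a.1 - b.1)%E, a.2 - b.2).

End empirical.

(* Main.v *)
From HB Require Import structures.
Require Import Defs.
From mathcomp Require Import all_boot all_order all_algebra.
From mathcomp Require Import all_classical all_reals all_analysis.
From mathcomp Require Import measurable_realfun ring lra.

Set Implicit Arguments.
Unset Strict Implicit.
Unset Printing Implicit Defensive.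

Import Order.TTheory GRing.Theory Num.Theory.
Import numFieldNormedType.Exports.

Local Open Scope classical_set_scope.
Local Open Scope ring_scope.

(** Once the likelihood is maximized over the scale, one equation remains: the
    estimator of the shape is the zero of the score
    [2 / a + 2 * S 1 a / S 0 a - L], where [S m a] is the empirical mean of
    [y `^ (- a) * ln y ^+ m] and [L] that of [ln x + ln y], and the estimator of the
    scale is an explicit function of that zero ([loglik_argmaxP]). By the
    Cauchy-Schwarz inequality the ratio [S 1 / S 0] is nonincreasing, so the score
    decreases at least as fast as [2 / a] ([score_drop]). This makes the zero unique
    and forces it to lie close to any point where the score is small
    ([score_root_near]).

    Under the limit law the powers of order [- alpha0] of [x] and of [y] have the
    densities [expR (- s)] and [expR (- s) * (1 - r + r * s)] with [r = rho 0].
    Hence the limits of the [S m] are derivatives of [Upsilon] up to powers of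
    [- alpha0^-1] ([FW_moment_snd]), and the limit of the score vanishes at [alpha1]
    because [varpi r] is a zero of [Pi r] ([score_limit_root]).

    The mean value theorem between [alpha1] and the estimator, for the score and for
    the scale, expresses the estimation error as a linear form in the deviations of
    [S 1], [S 0] and [L] from their limits. Its coefficients are random and converge
    in probability ([mle_linearization]); their limits are the entries of [M]
    ([M_entries]). The intermediate points are harmless because [S m] converges
    locally uniformly, [S m.+1] being bounded in probability near [alpha1]
    ([power_mean_bound]). After multiplication by [v n] the deviations are the
    components of the empirical process, which are tight, so replacing the
    coefficients by their limits costs a term that vanishes in probability
    ([cvg0_tight]). Slutsky's lemma ([weak_cvg_slutsky]) then transfers the weak
    convergence of the empirical process to the estimation error; it allows for the
    infinite value of the estimator on the samples with equal pairs, whose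
    probability vanishes. All convergences in probability are taken along the filter
    [prob_filter].

    When [r = 1], [Upsilon] is the shifted Gamma function and [varpi r = 1], so [M]
    is computed from the logarithmic derivatives of Gamma at 3. They follow from
    those at 1, which are the Euler constant ([digamma1]) and the Basel sum
    ([trigamma1]). *)

(** * Pointwise rules for derivatives *)

(** On explicit lambda terms, so that the derivative of a formula is obtained by
    nesting the rules in the order of its operations; [dE] then puts the value in
    the desired form. *)

Section derivative_rules.
Context {R : realType}.
Implicit Types (f g : R -> R) (x a b : R).

Lemma dN f x a : is_derive x 1 f a -> is_derive x 1 (fun t => - f t) (- a).
Proof. exact: is_deriveN. Qed.

Lemma dD f g x a b : is_derive x 1 f a -> is_derive x 1 g b ->
  is_derive x 1 (fun t => f t + g t) (a + b).
Proof. exact: is_deriveD. Qed.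

Lemma dB f g x a b : is_derive x 1 f a -> is_derive x 1 g b ->
  is_derive x 1 (fun t => f t - g t) (a - b).
Proof. exact: is_deriveB. Qed.

Lemma dM f g x a b : is_derive x 1 f a -> is_derive x 1 g b ->
  is_derive x 1 (fun t => f t * g t) (a * g x + f x * b).
Proof.
move=> df dg; apply: (@is_derive_eq _ _ _ (f * g) _ _ _ _ (is_deriveM df dg)).
by rewrite addrC; congr (_ + _); rewrite /GRing.scale/= mulrC.
Qed.

Lemma dV f x a : is_derive x 1 f a -> f x != 0 ->
  is_derive x 1 (fun t => (f t)^-1) (- (a / f x ^+ 2)).
Proof.
move=> df f0; apply: (is_derive_eq (is_deriveV f0 df)).
by rewrite scaleNr /GRing.scale/= mulrC.
Qed.

Lemma dcst x a : is_derive x 1 (fun _ : R => a) 0.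
Proof. exact: is_derive_cst. Qed.

Lemma did x : is_derive x 1 (fun t : R => t) 1.
Proof. exact: is_derive_id. Qed.

Lemma dcomp f g x a b : is_derive (g x) 1 f a -> is_derive x 1 g b ->
  is_derive x 1 (fun t => f (g t)) (a * b).
Proof. exact: is_derive1_comp. Qed.

Lemma dE f x a b : is_derive x 1 f a -> a = b -> is_derive x 1 f b.
Proof. by move=> + <-. Qed.

Lemma dext f g x a : (forall t, f t = g t) -> is_derive x 1 f a -> is_derive x 1 g a.
Proof. by move=> /funext ->. Qed.

Lemma dcont f x a : is_derive x 1 f a -> {for x, continuous f}.
Proof. by move=> [df _]; apply/differentiable_continuous/derivable1_diffP. Qed.

Lemma dpowR_exponent (t x : R) : 0 < t ->
  is_derive x 1 (fun u => t `^ u) (ln t * t `^ x).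
Proof.
move=> t0; apply: (@dext (fun u => expR (u * ln t))) => [u|].
  by rewrite /powR gt_eqF.
apply: (dE (@dcomp expR (fun u => u * ln t) _ _ _ (is_derive_expR _) (dM (did x) (dcst x (ln t))))).
by rewrite mul1r mulr0 addr0 /powR gt_eqF// mulrC.
Qed.

End derivative_rules.

(** * Integrals over the half-line *)

Section integrable_real.
Context d (T : measurableType d) (R : realType) (mu : {measure set T -> \bar R}).
Variables (D : set T) (mD : measurable D).
Implicit Types (f g : T -> R) (k : R).

Lemma integrable_scale f k : mu.-integrable D (EFin \o f) ->
  mu.-integrable D (EFin \o (fun t => k * f t)).
Proof.
by move=> fi; rewrite /comp; under eq_fun do rewrite EFinM; exact: integrableZl.
Qed.

Lemma integrable_add f g : mu.-integrable D (EFin \o f) -> mu.-integrable D (EFin \o g) ->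
  mu.-integrable D (EFin \o (fun t => f t + g t)).
Proof.
by move=> fi gi; rewrite /comp; under eq_fun do rewrite EFinD; exact: integrableD.
Qed.

Lemma integrable_sub f g : mu.-integrable D (EFin \o f) -> mu.-integrable D (EFin \o g) ->
  mu.-integrable D (EFin \o (fun t => f t - g t)).
Proof.
by move=> fi gi; rewrite /comp; under eq_fun do rewrite EFinB; exact: integrableB.
Qed.

Lemma integrable_dominated f g : measurable_fun D f -> (forall t, D t -> `|f t| <= g t) ->
  mu.-integrable D (EFin \o g) -> mu.-integrable D (EFin \o f).
Proof.
move=> mf fg; apply: le_integrable => //; first exact/measurable_EFinP.
by move=> t Dt; rewrite lee_fin (le_trans (fg _ Dt))// ler_norm.
Qed.

End integrable_real.

Section half_line.
Context {R : realType}.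
Notation mu := (@lebesgue_measure R).
Notation halfline := (`]0, +oo[%classic : set R).

Definition core_itv (n : nat) : set R := `[n.+1%:R^-1, n.+2%:R]%classic.

Lemma core_itv_gt0 n t : core_itv n t -> 0 < t.
Proof.
rewrite /core_itv/= in_itv/= => /andP[+ _]; apply: lt_le_trans.
by rewrite invr_gt0.
Qed.

Lemma core_itv_lt n : n.+1%:R^-1 < n.+2%:R :> R.
Proof.
apply: (@le_lt_trans _ _ 1); last by rewrite ltr1n.
by rewrite invf_le1// ler1n.
Qed.

Lemma bigcup_core_itv : \bigcup_n core_itv n = halfline.
Proof.
apply/seteqP; split => [t [n _ /core_itv_gt0 t0]|t].
  by rewrite /= in_itv/= t0.
rewrite /= in_itv/= andbT => t0.
have [n tn] : exists n, t + t^-1 < n.+1%:R.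
  by exists (Num.trunc (t + t^-1)); rewrite truncnS_gt.
have tV : 0 < t^-1 by rewrite invr_gt0.
exists n => //; rewrite /core_itv/= in_itv/=; apply/andP; split.
  by rewrite invf_ple ?posrE// ltW// (le_lt_trans _ tn)// lerDr ltW.
rewrite ltW// (lt_trans _ (_ : n.+1%:R < _)) ?ltr_nat//.
by rewrite (le_lt_trans _ tn)// lerDl ltW.
Qed.

Lemma nondecreasing_core_itv : {homo core_itv : n m / (n <= m)%N >-> (n <= m)%O}.
Proof.
move=> n m nm; apply/subsetPset => t; rewrite /core_itv/= !in_itv/= => /andP[h1 h2].
rewrite (le_trans h2) ?ler_nat// andbT (le_trans _ h1)//.
by rewrite lef_pV2 ?posrE// ler_nat.
Qed.

Lemma integral_core_itv (f F : R -> R) n :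
  (forall t : R, 0 < t -> is_derive t 1 F (f t)) ->
  (forall t, 0 < t -> {for t, continuous f}) ->
  (\int[mu]_(t in core_itv n) (f t)%:E = (F n.+2%:R)%:E - (F n.+1%:R^-1)%:E)%E.
Proof.
move=> dF cf.
have cF (t : R) : 0 < t -> {for t, continuous F}.
  by move=> t0; apply/differentiable_continuous/derivable1_diffP; case: (dF _ t0).
have n0 : 0 < n.+1%:R^-1 :> R by rewrite invr_gt0.
apply: continuous_FTC2.
- exact: core_itv_lt.
- by apply: continuous_in_subspaceT => t /set_mem/core_itv_gt0/cf.
- split.
  + by move=> u; rewrite in_itv/= => /andP[nu _]; case: (dF u (lt_trans n0 nu)).
  + by apply: cvg_at_right_filter; apply: cF; rewrite invr_gt0.
  + by apply: cvg_at_left_filter; apply: cF.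
- move=> u; rewrite in_itv/= => /andP[nu _].
  by rewrite derive1E (@derive_val _ _ _ _ _ _ _ (dF _ (lt_trans n0 nu))).
Qed.

(** Monotone convergence along an exhaustion by compact intervals turns a bounded
    primitive of a nonnegative function into integrability, whatever its
    singularity at the origin. *)
Lemma integrable_halfline_primitive (f F : R -> R) (C : R) :
  (forall t : R, 0 < t -> is_derive t 1 F (f t)) ->
  (forall t, 0 < t -> {for t, continuous f}) ->
  (forall t, 0 < t -> 0 <= f t) ->
  (forall t, 0 < t -> `|F t| <= C) ->
  mu.-integrable halfline (EFin \o f).
Proof.
move=> dF cf f0 FC.
have mf : measurable_fun halfline f.
  apply: open_continuous_measurable_fun; first exact: interval_open.
  by move=> t /set_mem; rewrite /= in_itv/= andbT => /cf.
apply/integrableP; split; first exact/measurable_EFinP.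
apply: (@le_lt_trans _ _ (2 * C)%:E); last by rewrite ltry.
have -> : (\int[mu]_(t in halfline) `|(EFin \o f) t| =
           \int[mu]_(t in halfline) (EFin \o f) t)%E.
  apply: eq_integral => t /set_mem; rewrite /= in_itv/= andbT => /f0 ?.
  by rewrite ger0_norm.
have := @ge0_nondecreasing_set_cvg_integral _ (measurableTypeR R) R core_itv (EFin \o f) mu nondecreasing_core_itv.
rewrite bigcup_core_itv => core_cvg.
have {}core_cvg := core_cvg (fun n => measurable_itv _).
have mfn : forall n, measurable_fun (core_itv n) (EFin \o f).
  move=> n; apply/measurable_EFinP; apply: measurable_funS mf => //.
  by move=> t /core_itv_gt0; rewrite /= in_itv/= andbT.
have /cvg_lim <- // := core_cvg mfn (fun n t h => f0 _ (core_itv_gt0 h)).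
apply: lime_le.
  apply: ereal_nondecreasing_is_cvgn => n m nm.
  apply: ge0_subset_integral => //=; [exact: measurable_itv|exact: measurable_itv| | |].
  - apply/measurable_EFinP; apply: measurable_funS mf => //.
    by move=> t /core_itv_gt0; rewrite /= in_itv/= andbT.
  - by move=> t /core_itv_gt0/f0; rewrite lee_fin.
  - exact/subsetPset/nondecreasing_core_itv.
apply: nearW => n; rewrite (integral_core_itv _ dF cf) -EFinB lee_fin.
have n1 : 0 < n.+1%:R^-1 :> R by rewrite invr_gt0.
have := FC _ n1; have := FC _ (ltr0Sn R n.+1); rewrite !ler_norml => /andP[? ?] /andP[? ?].
lra.
Qed.

(** The fundamental theorem of calculus on the open half-line, with the boundary
    values taken as limits along the same exhaustion. *)
Lemma Rintegral_halfline_FTC (f F : R -> R) (A B : R) :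
  mu.-integrable halfline (EFin \o f) ->
  (forall t : R, 0 < t -> is_derive t 1 F (f t)) ->
  (forall t, 0 < t -> {for t, continuous f}) ->
  F n.+1%:R^-1 @[n --> \oo] --> A -> F n.+2%:R @[n --> \oo] --> B ->
  \int[mu]_(t in halfline) f t = B - A.
Proof.
move=> intf dF cf FA FB.
have mf : measurable_fun halfline (EFin \o f) by case/integrableP: intf.
have sub n : core_itv n `<=` halfline.
  by move=> t /core_itv_gt0; rewrite /= in_itv/= andbT.
pose fn n := (EFin \o f) \_ (core_itv n).
have [|||||_ _] := @dominated_convergence _ _ _ mu halfline (measurable_itv _) fn
  (EFin \o f) (fun t => `|f t|%:E).
- move=> n; apply/(measurable_restrict _ _ _).1 => //; first exact: measurable_itv.
  exact: measurable_funS mf.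
- exact: mf.
- apply: aeW => t t0; apply: cvg_near_cst.
  have : (\bigcup_n core_itv n) t by rewrite bigcup_core_itv.
  move=> [N _ Nt]; exists N => // n /= Nn; rewrite /fn patchE mem_set//.
  by have /subsetPset := nondecreasing_core_itv Nn; apply.
- exact: (integrable_abse intf).
- apply: aeW => t n _; rewrite /fn patchE; case: ifPn => //= _.
  by rewrite normr0 lee_fin.
have -> : [sequence (\int[mu]_(t in halfline) fn n t)%E]_n =
    (fun n => ((F n.+2%:R)%:E - (F n.+1%:R^-1)%:E)%E).
  apply/funext => n; rewrite -(integral_core_itv _ dF cf) /=.
  by rewrite -integral_mkcondr setIidr.
have fin : (\int[mu]_(t in halfline) (EFin \o f) t)%E \is a fin_num.
  exact: integrable_fin_num.
rewrite -(fineK fin) => /fine_cvg lim1.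
have lim2 : F n.+2%:R - F n.+1%:R^-1 @[n --> \oo] --> B - A by exact: cvgB.
exact: cvg_unique lim1 lim2.
Qed.
End half_line.

(** * The Gamma function and its derivatives *)

Section gamma_integrals.
Context {R : realType}.
Notation mu := (@lebesgue_measure R).
Notation halfline := (`]0, +oo[%classic : set R).

Definition gamma_integrand (m : nat) (x t : R) : R :=
  t `^ (x - 1) * ln t ^+ m * expR (- t).

Definition gamma_int (m : nat) (x : R) : R :=
  \int[mu]_(t in halfline) gamma_integrand m x t.

Lemma Gamma_gamma_int x : Gamma x = gamma_int 0 x.
Proof. by apply: eq_Rintegral => t _; rewrite /gamma_integrand expr0 mulr1. Qed.

Lemma powR_le_expR (c t : R) : 0 <= c -> 0 < t -> t `^ c <= c `^ c * expR t.
Proof.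
rewrite le_eqVlt => /predU1P[<-|c0] t0.
  by rewrite !powRr0 mul1r (le_trans _ (expR_ge1Dx _))// lerDl ltW.
have tc : t / c <= expR (t / c) by rewrite (le_trans _ (expR_ge1Dx _))// lerDr.
have tc0 : 0 <= t / c by rewrite divr_ge0// ltW.
have := ge0_ler_powR (ltW c0) _ _ tc; rewrite !nnegrE => /(_ tc0 (expR_ge0 _)).
rewrite -expRM divfK ?gt_eqF// => h.
rewrite -[leLHS](_ : c `^ c * (t / c) `^ c = _); first by rewrite ler_pM2l ?powR_gt0.
by rewrite -powRM ?(ltW c0)// mulrCA divff ?gt_eqF// mulr1.
Qed.

(** Apply [ln w <= w] to a small power of [t] when [t >= 1], and use the symmetry
    [t -> t^-1] otherwise. *)
Lemma normr_ln_powR_le (m : nat) (c : R) : 0 < c ->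
  exists2 C : R, 0 < C & forall t, 0 < t -> `|ln t| ^+ m <= C * (t `^ c + t `^ (- c)).
Proof.
move=> c0; pose b := c / m.+1%:R; have b0 : 0 < b by rewrite divr_gt0.
exists (b^-1 ^+ m) => [|t t0]; first by rewrite exprn_gt0// invr_gt0.
have main u : 1 <= u -> `|ln u| ^+ m <= b^-1 ^+ m * u `^ c.
  move=> u1; have u0 : 0 < u by apply: lt_le_trans u1.
  rewrite ger0_norm ?ln_ge0//.
  have lu : ln u <= b^-1 * u `^ b.
    rewrite -(ler_pM2l b0) mulrA divff ?gt_eqF// mul1r -ln_powR.
    by rewrite ltW// ln_sublinear// powR_gt0.
  rewrite (le_trans (lerXn2r _ _ _ lu)) ?nnegrE ?ln_ge0 ?mulr_ge0 ?powR_ge0 ?invr_ge0 ?(ltW b0)//.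
  rewrite exprMn ler_pM2l ?exprn_gt0 ?invr_gt0//.
  rewrite -powR_mulrn ?powR_ge0// -powRrM ler_powR// /b.
  by rewrite mulrAC ler_pdivrMr// ler_pM2l// ler_nat.
have [t1|/ltW t1] := leP 1 t.
  by apply: (le_trans (main _ t1)); rewrite ler_pM2l ?exprn_gt0 ?invr_gt0// lerDl powR_ge0.
have : 1 <= t^-1 by rewrite invf_ge1.
move=> /main; rewrite lnV ?posrE// normrN => /le_trans; apply.
rewrite ler_pM2l ?exprn_gt0 ?invr_gt0//.
by rewrite -powR_inv1 ?(ltW t0)// -powRrM mulN1r lerDr powR_ge0.
Qed.

Lemma continuous_powR_pos (a t : R) : 0 < t -> {for t, continuous (fun u : R => u `^ a)}.
Proof.
move=> t0; apply/differentiable_continuous/derivable1_diffP.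
by have [] := is_derive1_powR a t0.
Qed.

Lemma continuous_gamma_integrand m (x t : R) : 0 < t -> {for t, continuous (gamma_integrand m x)}.
Proof.
move=> t0; rewrite /gamma_integrand; apply: cvgM.
  apply: cvgM; first exact: continuous_powR_pos.
  apply: (@continuous_comp _ _ _ (@ln R) (fun y : R => y ^+ m)).
    exact: continuous_ln.
  exact: exprn_continuous.
apply: (@continuous_comp _ _ _ (-%R : R -> R) expR).
  exact: opp_continuous.
exact: continuous_expR.
Qed.

Lemma measurable_gamma_integrand m (x : R) : measurable_fun halfline (gamma_integrand m x).
Proof.
apply: open_continuous_measurable_fun; first exact: interval_open.
move=> t /set_mem; rewrite /= in_itv/= andbT => t0.
exact: continuous_gamma_integrand.
Qed.

(** Up to a constant the integrand is dominated by the derivative of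
    [- (1 + t `^ x)^-1], a function that stays bounded whatever the sign of [x - 1]. *)
Lemma integrable_gamma_integrand0 (x : R) : 0 < x ->
  mu.-integrable halfline (EFin \o gamma_integrand 0 x).
Proof.
move=> x0.
pose f (t : R) := x * t `^ (x - 1) * ((1 + t `^ x) ^+ 2)^-1.
have p0 (t : R) : 0 < 1 + t `^ x by rewrite ltr_pwDl// powR_ge0.
have intf : mu.-integrable halfline (EFin \o f).
  apply: (@integrable_halfline_primitive _ _ (fun t => - (1 + t `^ x)^-1) 1) => t t0.
  - have d1 := dD (dcst t 1) (is_derive1_powR x t0).
    have d2 := dN (dV d1 (lt0r_neq0 (p0 t))).
    by apply: (dE d2); rewrite opprK add0r.
  - have d1 := dD (dcst t 1) (is_derive1_powR x t0).
    have p1 : (1 + t `^ x) * (1 + t `^ x) != 0 by rewrite gt_eqF ?mulr_gt0.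
    have d2 := dM (dM (dcst t x) (is_derive1_powR (x - 1) t0)) (dV (dM d1 d1) p1).
    by apply: dcont; apply: dext d2 => u; rewrite /f expr2.
  - by rewrite /f !mulr_ge0 ?powR_ge0 ?invr_ge0 ?exprn_ge0 ?(ltW x0) ?(ltW (p0 _)).
  - by rewrite normrN normfV ger0_norm ?(ltW (p0 _))// invf_le1// lerDl powR_ge0.
(* [K] absorbs the square [(1 + t `^ x) ^ 2] into [expR t]. *)
pose K := x^-1 * (1 + 2 * x `^ x + (2 * x) `^ (2 * x)).
apply: (@integrable_dominated _ _ _ mu _ _ _ (fun t => K * f t)) => //.
- exact: measurable_gamma_integrand.
- move=> t; rewrite /= in_itv/= andbT => t0.
  rewrite ger0_norm; last by rewrite /gamma_integrand expr0 mulr1 mulr_ge0 ?powR_ge0 ?expR_ge0.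
  rewrite /gamma_integrand expr0 mulr1 /f /K.
  have -> : x^-1 * (1 + 2 * x `^ x + (2 * x) `^ (2 * x)) * (x * t `^ (x - 1) / (1 + t `^ x) ^+ 2)
     = t `^ (x - 1) * ((1 + 2 * x `^ x + (2 * x) `^ (2 * x)) / (1 + t `^ x) ^+ 2).
    by field; rewrite !gt_eqF.
  rewrite ler_pM2l ?powR_gt0// ler_pdivlMr ?exprn_gt0//.
  rewrite expRN mulrC ler_pdivrMr ?expR_gt0//.
  rewrite [1 + _]addrC sqrrD1 -powR_mulrn ?powR_ge0// -powRrM (mulrC x).
  have h0 : 1 <= expR t by rewrite (le_trans _ (expR_ge1Dx _))// lerDl ltW.
  have h1 := powR_le_expR (ltW x0) t0.
  have h2 : t `^ (2 * x) <= _ := powR_le_expR (mulr_ge0 (ler0n _ 2) (ltW x0)) t0.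
  rewrite mulr2n; lra.
- exact: integrable_scale.
Qed.

Lemma gamma_integrand0_ge0 x t : 0 <= gamma_integrand 0 x t.
Proof. by rewrite /gamma_integrand expr0 mulr1 mulr_ge0 ?powR_ge0 ?expR_ge0. Qed.

(** A power of the logarithm costs an arbitrarily small change of the exponent in
    either direction, so every bound on the integrands with a logarithm reduces to
    integrands without one. *)
Lemma gamma_integrand_le m (c : R) : 0 < c -> exists2 C : R, 0 < C &
  forall x t, 0 < t -> `|gamma_integrand m x t| <=
    C * (gamma_integrand 0 (x + c) t + gamma_integrand 0 (x - c) t).
Proof.
move=> c0; have [C C0 hC] := normr_ln_powR_le m c0; exists C => // x t t0.
rewrite /gamma_integrand expr0 !mulr1 !normrM normrX.
rewrite (ger0_norm (powR_ge0 _ _)) (ger0_norm (expR_ge0 _)) -mulrDl mulrA.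
rewrite ler_pM2r ?expR_gt0//.
have t_neq0 : t != 0 by rewrite gt_eqF.
have -> : x + c - 1 = (x - 1) + c by ring.
have -> : x - c - 1 = (x - 1) + (- c) by ring.
have powRDt r s : t `^ (r + s) = t `^ r * t `^ s by rewrite powRD// t_neq0 implybT.
by rewrite !(powRDt (x - 1)) -mulrDr mulrCA ler_pM2l ?powR_gt0// hC.
Qed.

Lemma gamma_integrand0_between (lo hi x t : R) : 0 < t -> lo <= x <= hi ->
  gamma_integrand 0 x t <= gamma_integrand 0 lo t + gamma_integrand 0 hi t.
Proof.
move=> t0 /andP[lox xhi]; rewrite /gamma_integrand expr0 !mulr1 -mulrDl.
rewrite ler_pM2r ?expR_gt0//.
have [t1|/ltW t1] := leP 1 t.
  by rewrite (le_trans (ler_powR t1 (_ : x - 1 <= hi - 1))) ?lerD2r// lerDr powR_ge0.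
have ht : 0 < t <= 1 by rewrite t0.
by rewrite (le_trans (ger_powR ht (_ : lo - 1 <= x - 1))) ?lerD2r// lerDl powR_ge0.
Qed.

Lemma integrable_gamma_integrand m (x : R) : 0 < x ->
  mu.-integrable halfline (EFin \o gamma_integrand m x).
Proof.
move=> x0; have c0 : 0 < x / 2 by rewrite divr_gt0.
have [C C0 hC] := gamma_integrand_le m c0.
apply: (@integrable_dominated _ _ _ mu _ _ _
  (fun t => C * (gamma_integrand 0 (x + x / 2) t + gamma_integrand 0 (x - x / 2) t))) => //.
- exact: measurable_gamma_integrand.
- by move=> t; rewrite /= in_itv/= andbT; exact: hC.
- apply: integrable_scale => //; apply: integrable_add => //; apply: integrable_gamma_integrand0; lra.
Qed.

Lemma is_derive_gamma_integrand m (x t : R) : 0 < t ->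
  is_derive x 1 (fun y => gamma_integrand m y t) (gamma_integrand m.+1 x t).
Proof.
move=> t0.
have d1 := @dcomp _ (fun y => t `^ y) (fun y => y - 1) x _ _ (dpowR_exponent _ t0) (dB (did x) (dcst x 1)).
have d2 := dM d1 (dcst x (ln t ^+ m * expR (- t))).
have /dext d3 : forall y, t `^ (y - 1) * (ln t ^+ m * expR (- t)) = gamma_integrand m y t.
  by move=> y; rewrite mulrA.
apply: (dE (d3 _ _ d2)); rewrite /gamma_integrand exprS; ring.
Qed.

(** Differentiation under the integral sign, with exponents kept in
    [`]x - c, x + c[] and a dominating function that uses the exponents
    [x - 2 * c] and [x + 2 * c]. *)
Lemma is_derive_gamma_int m (x : R) : 0 < x ->
  is_derive x 1 (gamma_int m) (gamma_int m.+1 x).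
Proof.
move=> x0; pose c := x / 3; have c0 : 0 < c by rewrite divr_gt0.
have [C C0 hC] := gamma_integrand_le m.+1 c0.
pose G t := 2 * C * (gamma_integrand 0 (x - 2 * c) t + gamma_integrand 0 (x + 2 * c) t).
have partialE y t : 0 < t -> partial1of2 (gamma_integrand m) y t = gamma_integrand m.+1 y t.
  by move=> t0; rewrite partial1of2E (@derive_val _ _ _ _ _ _ _ (is_derive_gamma_integrand m y t0)).
have xc : 3 * c = x by rewrite /c; field.
have Ix : `]x - c, x + c[%classic x by rewrite /= in_itv/=; apply/andP; split; lra.
have intf y : `]x - c, x + c[%classic y -> mu.-integrable halfline (EFin \o gamma_integrand m y).
  rewrite /= in_itv/= => /andP[yc _]; apply: integrable_gamma_integrand; lra.
have derf y t : `]x - c, x + c[%classic y -> halfline t -> derivable (gamma_integrand m ^~ t) y 1.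
  by rewrite /= !in_itv/= andbT => _ t0; have [] := is_derive_gamma_integrand m y t0.
have G0 t : 0 <= G t by rewrite /G mulr_ge0 ?addr_ge0 ?gamma_integrand0_ge0 ?mulr_ge0 ?(ltW C0).
have intG : mu.-integrable halfline (EFin \o G).
  apply: integrable_scale => //; apply: integrable_add => //; apply: integrable_gamma_integrand0; lra.
have ubG y t : `]x - c, x + c[%classic y -> halfline t -> `|partial1of2 (gamma_integrand m) y t| <= G t.
  rewrite /= !in_itv/= andbT => /andP[y1 y2] t0; rewrite partialE//.
  apply: (le_trans (hC y t t0)); rewrite /G [2 * C]mulrC -mulrA ler_pM2l//.
  have -> : 2 * (gamma_integrand 0 (x - 2 * c) t + gamma_integrand 0 (x + 2 * c) t) =
    (gamma_integrand 0 (x - 2 * c) t + gamma_integrand 0 (x + 2 * c) t) +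
    (gamma_integrand 0 (x - 2 * c) t + gamma_integrand 0 (x + 2 * c) t) by ring.
  by apply: lerD; apply: gamma_integrand0_between => //; apply/andP; split; lra.
apply: DeriveDef.
  exact: (derivable_under_integral _ Ix intf derf G0 intG ubG).
rewrite -derive1E (differentiation_under_integral _ Ix intf derf G0 intG ubG)//.
by apply: eq_Rintegral => t /set_mem; rewrite /= in_itv/= andbT => /partialE.
Qed.

(** Integration by parts against the primitive [- t `^ x * expR (- t)]. *)
Lemma gamma_intS (x : R) : 0 < x -> gamma_int 0 (x + 1) = x * gamma_int 0 x.
Proof.
move=> x0.
pose F (t : R) := - (t `^ x * expR (- t)).
pose f (t : R) := gamma_integrand 0 (x + 1) t - x * gamma_integrand 0 x t.
have intf1 := integrable_gamma_integrand 0 (addr_gt0 x0 ltr01).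
have intf2 : mu.-integrable halfline (EFin \o (fun t => x * gamma_integrand 0 x t)).
  by apply: integrable_scale => //; exact: integrable_gamma_integrand.
have intf : mu.-integrable halfline (EFin \o f) by exact: integrable_sub.
have := @Rintegral_halfline_FTC _ f F 0 0 intf.
rewrite RintegralB// RintegralZl//; last exact: integrable_gamma_integrand.
move=> /(_ _ _ _ _)/eqP; rewrite subr_eq subr0 add0r => h; apply/eqP/h.
- move=> t t0.
  have d1 := @dcomp _ expR -%R t _ _ (is_derive_expR _) (dN (did t)).
  have d2 := dN (dM (is_derive1_powR x t0) d1).
  apply: (dE d2); rewrite /f /gamma_integrand expr0 !mulr1 addrK; ring.
- move=> t t0; apply: cvgB; first exact: continuous_gamma_integrand.
  by apply: cvgM; [exact: cvg_cst|exact: continuous_gamma_integrand].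
- rewrite -oppr0; apply: cvgN.
  apply: (@squeeze_cvgr _ _ _ _ (cst 0) (fun n => n.+1%:R^-1 `^ x)).
  + apply: nearW => n; rewrite mulr_ge0 ?powR_ge0 ?expR_ge0//=.
    by rewrite ler_piMr ?powR_ge0// expR_le1 oppr_le0 invr_ge0.
  + exact: cvg_cst.
  + have /cvg_at_rightP := powR_cvg0 x0; apply; split; last exact: cvg_harmonic.
    by move=> n; rewrite invr_gt0.
- rewrite -oppr0; apply: cvgN.
  have x1 : 0 <= x + 1 by lra.
  apply: (@squeeze_cvgr _ _ _ _ (cst 0) (fun n => (x + 1) `^ (x + 1) * n.+2%:R^-1)).
  + apply: nearW => n; rewrite mulr_ge0 ?powR_ge0 ?expR_ge0//=.
    rewrite expRN ler_pdivrMr ?expR_gt0// mulrAC ler_pdivlMr//.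
    have := powR_le_expR x1 (ltr0Sn R n.+1); rewrite powRD ?powRr1//.
    by rewrite pnatr_eq0 implybT.
  + exact: cvg_cst.
  + rewrite -(mulr0 ((x + 1) `^ (x + 1))); apply: cvgM; first exact: cvg_cst.
    by have := @cvg_harmonic R; rewrite -(cvg_shiftS (@harmonic R)).
Qed.

End gamma_integrals.

(** * Digamma, trigamma and the Euler constant *)

Section calculus.
Context {R : realType}.

Lemma MVT_gt0 (f df : R -> R) (a b : R) :
  (forall x : R, 0 < x -> is_derive x 1 f (df x)) -> 0 < a -> a < b ->
  exists2 c, a < c < b & f b - f a = df c * (b - a).
Proof.
move=> dF a0 ab.
have [||c + ->] := @MVT _ f df a b ab.
- by move=> x; rewrite in_itv/= => /andP[/(lt_trans a0) /dF].
- apply: continuous_in_subspaceT => x /set_mem; rewrite /= in_itv/= => /andP[ax _].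
  exact: dcont (dF _ (lt_le_trans a0 ax)).
- by rewrite in_itv/= => cab; exists c.
Qed.

(** The substitution [u = exp (2 s)] makes this [s ^ 2 <= sinh s ^ 2]. *)
Lemma ln_sqr_le (u : R) : 0 < u -> ln u ^+ 2 <= u - 2 + u^-1.
Proof.
have key (w : R) : 1 <= w -> 0 <= ln w <= (w - w^-1) / 2.
  move=> w1; rewrite ln_ge0//= ler_pdivlMr// mulrC.
  move: w1; rewrite le_eqVlt => /predU1P[<-|w1].
    by rewrite ln1 mulr0 invr1 subrr.
  pose f (x : R) := x - x^-1 - 2 * ln x.
  have df (x : R) : 0 < x -> is_derive x 1 f ((1 - x^-1) ^+ 2).
    move=> x0; have x1 : x != 0 by rewrite gt_eqF.
    have d1 := dB (dB (did x) (dV (did x) x1)) (dM (dcst x 2) (is_derive1_ln x0)).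
    by apply: (dE d1); field.
  have [c _ ] := MVT_gt0 df ltr01 w1.
  rewrite {2}/f invr1 ln1 subrr mulr0 subr0 subr0 => h.
  rewrite -subr_ge0 -/(f w) h mulr_ge0 ?sqr_ge0// subr_ge0; exact: ltW.
have main (u1 : R) : 1 <= u1 -> ln u1 ^+ 2 <= u1 - 2 + u1^-1.
  move=> u1_ge1; have u0 : 0 < u1 by apply: lt_le_trans u1_ge1.
  pose w := Num.sqrt u1.
  have w1 : 1 <= w by have := ler_sqrt 1 (ltW u0); rewrite sqrtr1 => ->.
  have w0 : w != 0 by rewrite gt_eqF// (lt_le_trans ltr01 w1).
  have uw : u1 = w ^+ 2 by rewrite sqr_sqrtr// ltW.
  have /andP[l0 lw] := key w w1.
  have -> : ln u1 = 2 * ln w by rewrite uw lnXn ?mulr_natl// (lt_le_trans ltr01 w1).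
  have -> : u1 - 2 + u1^-1 = (w - w^-1) ^+ 2 by rewrite uw; field.
  by rewrite lerXn2r ?nnegrE//; lra.
move=> u0; have [u1|/ltW u1] := leP 1 u; first exact: main.
have /main : 1 <= u^-1 by rewrite invf_ge1.
by rewrite lnV ?posrE// sqrrN invrK addrAC (addrC u^-1) addrAC.
Qed.

End calculus.

Section digamma.
Context {R : realType}.
Notation mu := (@lebesgue_measure R).
Notation halfline := (`]0, +oo[%classic : set R).
Notation G := (@gamma_int R).

Lemma Rintegral_lin3 (f g h : R -> R) (a b c : R) :
  mu.-integrable halfline (EFin \o f) -> mu.-integrable halfline (EFin \o g) ->
  mu.-integrable halfline (EFin \o h) ->
  \int[mu]_(t in halfline) (a * f t + b * g t + c * h t) =
  a * \int[mu]_(t in halfline) f t + b * \int[mu]_(t in halfline) g t +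
  c * \int[mu]_(t in halfline) h t.
Proof.
move=> fi gi hi; rewrite RintegralD ?RintegralD ?RintegralZl//.
all: try exact: integrable_scale.
by apply: integrable_add => //; exact: integrable_scale.
Qed.

Lemma gamma_int0_1 : G 0 1 = 1.
Proof.
transitivity (0 - (-1) : R); last by rewrite opprK add0r.
apply: (@Rintegral_halfline_FTC R (gamma_integrand 0 1) (fun t => - expR (- t))).
- exact: integrable_gamma_integrand.
- move=> t t0; apply: (dE (dN (@dcomp _ expR -%R t _ _ (is_derive_expR _) (dN (did t))))).
  by rewrite /gamma_integrand subrr powRr0 expr0 !mul1r mulrN1 opprK.
- by move=> t t0; exact: continuous_gamma_integrand.
- have h : - harmonic n @[n --> \oo] --> (- 0 : R) by apply: cvgN; exact: cvg_harmonic.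
  rewrite oppr0 in h; apply: cvgN; rewrite -[X in _ --> X](@expR0 R).
  exact: (continuous_cvg _ (@continuous_expR R 0) h).
- rewrite -oppr0; apply: cvgN.
  by have := @cvgn_expR R; rewrite -(cvg_shiftn 2); under eq_fun do rewrite addn2.
Qed.

(** Tangent line of the exponential at the mean of [(x - 1) * ln t] under the
    density [expR (- t)]: the linear part integrates to zero. *)
Lemma gamma_int0_gt0 x : 0 < x -> 0 < G 0 x.
Proof.
move=> x0; set c := (x - 1) * G 1 1.
apply: (@lt_le_trans _ _ (expR c)); first exact: expR_gt0.
have := @le_Rintegral _ _ _ mu halfline
  (fun t => expR c * (1 - c) * gamma_integrand 0 1 t + expR c * (x - 1) * gamma_integrand 1 1 t
            + 0 * gamma_integrand 0 1 t) (gamma_integrand 0 x).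
rewrite Rintegral_lin3 ?(integrable_gamma_integrand _ ltr01)// -!/(gamma_int _ _) gamma_int0_1.
have -> : expR c * (1 - c) * 1 + expR c * (x - 1) * G 1 1 + 0 * 1 = expR c.
  by rewrite -(mulrA (expR c) (x - 1)) -/c; ring.
apply => //.
- apply: integrable_add => //; last by apply: integrable_scale => //; exact: integrable_gamma_integrand.
  by apply: integrable_add => //; apply: integrable_scale => //; exact: integrable_gamma_integrand.
- exact: integrable_gamma_integrand.
move=> t; rewrite /= in_itv/= andbT => t0.
rewrite /gamma_integrand subrr powRr0 expr0 expr1 mul0r addr0 !mulr1 !mul1r mulrA -mulrDl.
rewrite ler_pM2r ?expR_gt0// /powR gt_eqF//.
have := expR_ge1Dx ((x - 1) * ln t - c); rewrite expRB ler_pdivlMr ?expR_gt0//.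
by apply: le_trans; rewrite le_eqVlt; apply/orP; left; apply/eqP; ring.
Qed.

(** Nonnegativity of the second moment of [ln t - l] under the Gamma density. *)
Lemma gamma_int_cauchy_schwarz x l : 0 < x -> 0 <= G 2 x - 2 * l * G 1 x + l ^+ 2 * G 0 x.
Proof.
move=> x0; have -> : G 2 x - 2 * l * G 1 x + l ^+ 2 * G 0 x =
    \int[mu]_(t in halfline) (1 * gamma_integrand 2 x t + (- (2 * l)) * gamma_integrand 1 x t
        + l ^+ 2 * gamma_integrand 0 x t).
  by rewrite Rintegral_lin3 ?integrable_gamma_integrand// -!/(gamma_int _ _); ring.
apply: Rintegral_ge0 => t _; rewrite /gamma_integrand.
have -> : 1 * (t `^ (x - 1) * ln t ^+ 2 * expR (- t)) + - (2 * l) * (t `^ (x - 1) * ln t ^+ 1 * expR (- t))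
   + l ^+ 2 * (t `^ (x - 1) * ln t ^+ 0 * expR (- t)) =
   (ln t - l) ^+ 2 * (t `^ (x - 1) * expR (- t)) by ring.
by rewrite mulr_ge0 ?sqr_ge0// mulr_ge0 ?powR_ge0 ?expR_ge0.
Qed.

Definition digamma (x : R) : R := G 1 x / G 0 x.
Definition trigamma (x : R) : R := (G 2 x * G 0 x - G 1 x ^+ 2) / G 0 x ^+ 2.

Lemma is_derive_digamma (x : R) : 0 < x -> is_derive x 1 digamma (trigamma x).
Proof.
move=> x0; have G0 : G 0 x != 0 by rewrite gt_eqF// gamma_int0_gt0.
apply: (dE (dM (is_derive_gamma_int 1 x0) (dV (is_derive_gamma_int 0 x0) G0))).
by rewrite /trigamma; field.
Qed.

Lemma trigamma_ge0 x : 0 < x -> 0 <= trigamma x.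
Proof.
move=> x0; have G0 := gamma_int0_gt0 x0.
rewrite divr_ge0 ?sqr_ge0//.
have := gamma_int_cauchy_schwarz (G 1 x / G 0 x) x0.
move=> /mulr_ge0/(_ (ltW G0)); congr (0 <= _).
by field; rewrite gt_eqF.
Qed.

Lemma le_digamma x y : 0 < x -> x <= y -> digamma x <= digamma y.
Proof.
move=> x0; rewrite le_eqVlt => /predU1P[->//|xy].
have [c /andP[xc _]] := MVT_gt0 is_derive_digamma x0 xy.
move/eqP; rewrite subr_eq => /eqP ->.
by rewrite lerDr mulr_ge0 ?trigamma_ge0 ?subr_ge0 ?ltW// (lt_trans x0).
Qed.

(** Trigamma is the variance of [ln t] under the normalized Gamma density, hence
    at most the mean of [(ln t - ln x) ^ 2], which [ln_sqr_le] bounds by a mean of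
    powers of [t]. *)
Lemma trigamma_le x : 1 < x -> trigamma x <= (x - 1)^-1.
Proof.
move=> x1; have x0 : 0 < x by apply: lt_trans x1.
have xm1 : 0 < x - 1 by rewrite subr_gt0.
have xp1 : 0 < x + 1 by rewrite addr_gt0.
have G0 := gamma_int0_gt0 x0.
set l := ln x.
have bound : G 2 x - 2 * l * G 1 x + l ^+ 2 * G 0 x <= G 0 x / (x - 1).
  have -> : G 0 x / (x - 1) = \int[mu]_(t in halfline) (x^-1 * gamma_integrand 0 (x + 1) t
      + (- 2) * gamma_integrand 0 x t + x * gamma_integrand 0 (x - 1) t).
    rewrite Rintegral_lin3 ?integrable_gamma_integrand// -!/(gamma_int _ _).
    rewrite gamma_intS//.
    have := gamma_intS xm1; rewrite subrK => ->.
    by field; rewrite !gt_eqF.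
  rewrite [leLHS](_ : _ =
    \int[mu]_(t in halfline) (1 * gamma_integrand 2 x t + (- (2 * l)) * gamma_integrand 1 x t
        + l ^+ 2 * gamma_integrand 0 x t)); last first.
    by rewrite Rintegral_lin3 ?integrable_gamma_integrand// -!/(gamma_int _ _); ring.
  have int3 (a b c u v w : R) i j k : 0 < u -> 0 < v -> 0 < w -> mu.-integrable halfline
     (EFin \o (fun t => a * gamma_integrand i u t + b * gamma_integrand j v t
        + c * gamma_integrand k w t)).
    move=> u0 v0 w0; apply: integrable_add => //; last by apply: integrable_scale => //; exact: integrable_gamma_integrand.
    by apply: integrable_add => //; apply: integrable_scale => //; exact: integrable_gamma_integrand.
  apply: le_Rintegral => //; [exact: int3|exact: int3|].
  move=> t; rewrite /= in_itv/= andbT => t0; rewrite /gamma_integrand.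
  set y := x - 1 - 1.
  have -> : x + 1 - 1 = y + 2%:R by rewrite /y; ring.
  have -> : x - 1 = y + 1%:R by rewrite /y; ring.
  have tn0 : t != 0 by rewrite gt_eqF.
  have powRDt r : t `^ (y + r) = t `^ y * t `^ r by rewrite powRD// tn0 implybT.
  rewrite (powRDt 2%:R) (powRDt 1%:R) !powR_mulrn ?(ltW t0)//.
  set p := t `^ _; set e := expR _.
  have pe : 0 <= p * e by rewrite mulr_ge0 ?powR_ge0 ?expR_ge0.
  have h := ln_sqr_le (divr_gt0 t0 x0).
  move: h; rewrite ln_div ?posrE// -/l invf_div => h.
  have h2 : (ln t - l) ^+ 2 * (p * t * e) <= (t / x - 2 + x / t) * (p * t * e).
    by rewrite ler_wpM2r// mulrAC mulr_ge0// ltW.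
  rewrite [leLHS](_ : _ = (ln t - l) ^+ 2 * (p * t * e)); last by ring.
  apply: (le_trans h2); rewrite le_eqVlt; apply/orP; left; apply/eqP.
  by field; rewrite !gt_eqF.
rewrite /trigamma ler_pdivrMr ?exprn_gt0//.
apply: (@le_trans _ _ (G 0 x * (G 2 x - 2 * l * G 1 x + l ^+ 2 * G 0 x))).
  rewrite -subr_ge0.
  have -> : G 0 x * (G 2 x - 2 * l * G 1 x + l ^+ 2 * G 0 x) - (G 2 x * G 0 x - G 1 x ^+ 2)
    = (G 1 x - l * G 0 x) ^+ 2 by ring.
  exact: sqr_ge0.
have -> : (x - 1)^-1 * G 0 x ^+ 2 = G 0 x * (G 0 x / (x - 1)) by rewrite expr2; ring.
by rewrite ler_pM2l.
Qed.

(** Differentiating the functional equation of the Gamma function. *)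
Lemma gamma_int1S (x : R) : 0 < x -> G 1 (x + 1) = x * G 1 x + G 0 x.
Proof.
move=> x0.
have d1 := @dcomp _ (G 0) (fun x => x + 1) x _ _ (is_derive_gamma_int 0 (addr_gt0 x0 ltr01)) (dD (did x) (dcst x 1)).
have d2 := dM (did x) (is_derive_gamma_int 0 x0).
have eqn : \forall y \near x, G 0 (y + 1) = y * G 0 y.
  by near=> y; rewrite gamma_intS//; near: y; exact: lt_nbhsr.
have d3 := near_eq_is_derive eqn d1.
have := @derive_val _ _ _ _ _ _ _ d2; rewrite (@derive_val _ _ _ _ _ _ _ d3).
by rewrite addr0 mulr1 => ->; ring.
Unshelve. all: by end_near. Qed.

Lemma gamma_int2S (x : R) : 0 < x -> G 2 (x + 1) = x * G 2 x + 2 * G 1 x.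
Proof.
move=> x0.
have d1 := @dcomp _ (G 1) (fun x => x + 1) x _ _ (is_derive_gamma_int 1 (addr_gt0 x0 ltr01)) (dD (did x) (dcst x 1)).
have d2 := dD (dM (did x) (is_derive_gamma_int 1 x0)) (is_derive_gamma_int 0 x0).
have eqn : \forall y \near x, G 1 (y + 1) = y * G 1 y + G 0 y.
  by near=> y; rewrite gamma_int1S//; near: y; exact: lt_nbhsr.
have d3 := near_eq_is_derive eqn d1.
have := @derive_val _ _ _ _ _ _ _ d2; rewrite (@derive_val _ _ _ _ _ _ _ d3).
by rewrite addr0 mulr1 => ->; ring.
Unshelve. all: by end_near. Qed.

Lemma digammaS x : 0 < x -> digamma (x + 1) = digamma x + x^-1.
Proof.
move=> x0; have G0 := gamma_int0_gt0 x0.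
by rewrite /digamma gamma_int1S// gamma_intS//; field; rewrite !gt_eqF.
Qed.

Lemma trigammaS x : 0 < x -> trigamma (x + 1) = trigamma x - (x ^+ 2)^-1.
Proof.
move=> x0; have G0 := gamma_int0_gt0 x0.
by rewrite /trigamma gamma_int2S// gamma_int1S// gamma_intS//; field; rewrite !gt_eqF.
Qed.

Lemma digamma_natS n : digamma n.+1%:R = digamma 1 + \sum_(1 <= i < n.+1) i%:R^-1.
Proof.
elim: n => [|n IHn]; first by rewrite big_geq// addr0.
have := digammaS (ltr0Sn R n); rewrite natr1 => ->.
by rewrite IHn -addrA; congr (_ + _); rewrite [RHS]big_nat_recr.
Qed.

Lemma trigamma_natS n :
  trigamma 1 = \sum_(1 <= i < n.+1) (i%:R ^+ 2)^-1 + trigamma n.+1%:R.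
Proof.
elim: n => [|n IHn]; first by rewrite big_geq// add0r.
have := trigammaS (ltr0Sn R n); rewrite natr1 => ->.
by rewrite big_nat_recr//= IHn; ring.
Qed.

(** The mean value theorem for [ln Gamma] between [n] and [n + 1], where it grows
    by [ln n], sandwiches [ln n] between consecutive values of digamma. *)
Lemma digamma_ln n : (0 < n)%N -> digamma n%:R <= ln n%:R <= digamma n.+1%:R.
Proof.
move=> n0; have n0' : 0 < n%:R :> R by rewrite ltr0n.
pose f := fun x => ln (G 0 x).
have df (x : R) : 0 < x -> is_derive x 1 f (digamma x).
  move=> x0; apply: (dE (@dcomp _ (@ln R) (G 0) x _ _ (is_derive1_ln (gamma_int0_gt0 x0)) (is_derive_gamma_int 0 x0))).
  by rewrite mulrC.
have n1 : n%:R < n%:R + 1 :> R by rewrite ltrDl.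
have [c /andP[c1 c2]] := MVT_gt0 df n0' n1.
rewrite /f gamma_intS// lnM ?posrE ?gamma_int0_gt0// addrK addrAC subrr add0r mulr1 => ->.
rewrite natr1 in c2.
by rewrite (le_digamma n0' (ltW c1)) (le_digamma (lt_trans n0' c1) (ltW c2)).
Qed.

(** By [digamma_ln] the difference of [digamma n] and [ln n] tends to zero, while
    [digamma n - digamma 1] is a harmonic sum. *)
Lemma digamma1 : digamma 1 = - euler_gamma.
Proof.
have lim : (\sum_(1 <= i < n.+1) (i%:R^-1 : R) - ln (n%:R : R)) @[n --> \oo] --> - digamma 1.
  rewrite -(cvg_shiftS (fun n => \sum_(1 <= i < n.+1) (i%:R^-1 : R) - ln (n%:R : R))).
  apply: (@squeeze_cvgr _ _ _ _ (cst (- digamma 1)) (fun n => - digamma 1 + n.+1%:R^-1)).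
  - apply: nearW => n; have /andP[] := digamma_ln (ltn0Sn n).
    rewrite (digamma_natS n) (digamma_natS n.+1) [\sum_(1 <= i < n.+2) _]big_nat_recr//= => h1 h2.
    rewrite /cst; set s := \sum_(_ <= _ < _) _ in h1 h2 *.
    rewrite [\sum_(1 <= i < n.+2) _]big_nat_recr//= -/s.
  move: s (n.+1%:R^-1) (ln n.+1%:R) h1 h2 => s q lg h1 h2.
  apply/andP; split; lra.
  - exact: cvg_cst.
  - rewrite -[X in _ --> X]addr0; apply: cvgD; first exact: cvg_cst.
    exact: cvg_harmonic.
by rewrite /euler_gamma (cvg_lim _ lim)// opprK.
Qed.

Lemma gamma_int1_1 : G 1 1 = - euler_gamma.
Proof. by rewrite -digamma1 /digamma gamma_int0_1 divr1. Qed.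

End digamma.

(** * The Basel sum and the value of trigamma at 1 *)

Section basel.
Context {R : realType}.

Lemma le_increment (f df : R -> R) (a b : R) :
  (forall x : R, is_derive x 1 f (df x)) -> (forall x, a < x < b -> 0 <= df x) ->
  a < b -> f a <= f b.
Proof.
move=> dF df0 ab.
have [|c + e] := @MVT _ f df a b ab.
  by apply: continuous_in_subspaceT => x _; exact: dcont (dF x).
rewrite in_itv/= => cab; rewrite -subr_ge0 e mulr_ge0 ?df0// subr_ge0; exact: ltW.
Qed.

(** The squared inverse of [sin x <= x <= tan x]. *)
Lemma invr_sin_sqr_bounds (x : R) : 0 < x < pi / 2 ->
  (sin x ^+ 2)^-1 - 1 <= (x ^+ 2)^-1 <= (sin x ^+ 2)^-1.
Proof.
move=> xpi; have /andP[x0 xpi2] := xpi.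
have s0 : 0 < sin x by exact: sin_gt0_pihalf.
have c0 : 0 < cos x by apply: cos_gt0_pihalf; rewrite xpi2 andbT (lt_trans _ x0)// oppr_lt0 divr_gt0 ?pi_gt0.
have h1 : sin x <= x.
  have df (t : R) : is_derive t 1 (fun t => t - sin t) (1 - cos t).
    exact: dB (did t) (is_derive_sin t).
  have c1 (t : R) : 0 < t < x -> 0 <= 1 - cos t by rewrite subr_ge0 cos_le1.
  by have := le_increment df c1 x0; rewrite sin0 subr0 subr_ge0.
have h2 : x * cos x <= sin x.
  have df (t : R) : is_derive t 1 (fun t => sin t - t * cos t) (t * sin t).
    apply: (dE (dB (is_derive_sin t) (dM (did t) (is_derive_cos t)))); ring.
  have s1 (t : R) : 0 < t < x -> 0 <= t * sin t.
    move=> /andP[t0 tx]; rewrite mulr_ge0 ?(ltW t0)// ltW// sin_gt0_pihalf//.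
    by rewrite t0 (lt_trans tx).
  by have := le_increment df s1 x0; rewrite sin0 mul0r subr0 subr_ge0.
apply/andP; split; last by rewrite lef_pV2 ?posrE ?exprn_gt0// lerXn2r ?nnegrE ?(ltW s0) ?(ltW x0).
have -> : (sin x ^+ 2)^-1 - 1 = cos x ^+ 2 / sin x ^+ 2.
  by rewrite cos2sin2; field; rewrite gt_eqF.
rewrite ler_pdivrMr ?exprn_gt0// -[leLHS]mul1r ler_pdivlMl ?exprn_gt0// mul1r -exprMn.
by rewrite lerXn2r ?nnegrE ?(ltW s0)// mulr_ge0 ?ltW.
Qed.

Let angle n k : R := k%:R * pi / (2 ^ n)%:R.
Let csum n := \sum_(1 <= k < 2 ^ n) (sin (angle n k) ^+ 2)^-1.

Let angle_bounds n k : (0 < k < 2 ^ n)%N -> 0 < angle n.+1 k < pi / 2.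
Proof.
move=> /andP[k0 kn]; have pi0 := @pi_gt0 R.
rewrite /angle divr_gt0 ?mulr_gt0 ?ltr0n ?expn_gt0//=.
rewrite ltr_pdivrMr ?ltr0n ?expn_gt0// expnS natrM mulrA divfK// mulrC ltr_pM2l//.
by rewrite ltr_nat.
Qed.

Let sin_cos_sum n : \sum_(1 <= k < 2 ^ n) (sin (angle n.+1 k) ^+ 2)^-1 +
  \sum_(1 <= k < 2 ^ n) (cos (angle n.+1 k) ^+ 2)^-1 = 4 * csum n.
Proof.
rewrite -big_split mulr_sumr/=; apply: eq_big_nat => k kn.
have hb := angle_bounds kn; have /andP[a0 api] := hb.
have s0 := sin_gt0_pihalf hb.
have c0 : 0 < cos (angle n.+1 k).
  by apply: cos_gt0_pihalf; rewrite api andbT (lt_trans _ a0)// oppr_lt0 divr_gt0 ?pi_gt0.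
have -> : angle n k = angle n.+1 k *+ 2.
  by rewrite /angle expnS natrM -mulr_natr; field; rewrite pnatr_eq0 -lt0n expn_gt0.
rewrite sin_mulr2n -mulr_natr.
have := cos2Dsin2 (angle n.+1 k).
move: (sin _) (cos _) s0 c0 => s c s0 c0 cs.
transitivity ((c ^+ 2 + s ^+ 2) / (c ^+ 2 * s ^+ 2)); last rewrite cs.
  by field; rewrite !gt_eqF.
by field; rewrite !gt_eqF.
Qed.

(** Reflecting [k] to [2 ^ n - k] exchanges sines and cosines. *)
Let half_sum n : \sum_(1 <= k < 2 ^ n) (sin (angle n.+1 k) ^+ 2)^-1 = 2 * csum n.
Proof.
have sc : \sum_(1 <= k < 2 ^ n) (sin (angle n.+1 k) ^+ 2)^-1 =
          \sum_(1 <= k < 2 ^ n) (cos (angle n.+1 k) ^+ 2)^-1.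
  rewrite big_nat_rev/=; apply: eq_big_nat => k /andP[k1 kn].
  rewrite add1n subSS; congr ((_ ^+ 2)^-1).
  rewrite -cosBpihalf -cosN; congr cos; rewrite /angle natrB ?(ltnW kn)// expnS natrM.
  by field; rewrite pnatr_eq0 -lt0n expn_gt0.
have := sin_cos_sum n; rewrite -sc; lra.
Qed.

(** Closed form by angle doubling: [1 / sin ^ 2 + 1 / cos ^ 2] at an angle is four
    times [1 / sin ^ 2] at the double angle. *)
Let csumE n : csum n = ((4 ^ n)%:R - 1) / 3.
Proof.
elim: n => [|n IHn]; first by rewrite /csum big_geq// expn0 subrr mul0r.
have n1 : (1 <= 2 ^ n)%N by rewrite expn_gt0.
have n2 : (2 ^ n <= 2 ^ n.+1)%N by rewrite leq_exp2l.
have mid : angle n.+1 (2 ^ n) = pi / 2.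
  by rewrite /angle expnS natrM; field; rewrite pnatr_eq0 -lt0n expn_gt0.
have -> : csum n.+1 = 4 * csum n + 1.
  rewrite -sin_cos_sum /csum (big_cat_nat n1 n2)/= -addrA; congr (_ + _).
  have n3 : (2 ^ n < 2 ^ n.+1)%N by rewrite ltn_exp2l.
  rewrite (big_ltn n3) mid.
  rewrite sin_pihalf expr1n invr1 addrC; congr (_ + _).
  rewrite -[(2 ^ n).+1]add1n big_addn expnS mul2n -addnn addnK.
  apply: eq_big_nat => k _; congr ((_ ^+ 2)^-1).
  by rewrite -sinDpihalf -mid; congr sin; rewrite /angle natrD !mulrDl.
by rewrite IHn expnS natrM; field.
Qed.

Lemma basel_bounds n (S : R) : S = \sum_(1 <= k < 2 ^ n) (k%:R ^+ 2)^-1 ->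
  pi ^+ 2 / 6 * (1 - (4 ^ n)%:R^-1) - pi ^+ 2 / 4 * (2 ^ n)%:R^-1 <= S <= pi ^+ 2 / 6.
Proof.
move=> SE0; have pi0 := @pi_gt0 R.
have [q qE] : {q : R | q = (2 ^ n)%:R} by exists (2 ^ n)%:R.
have q0 : 0 < q by rewrite qE ltr0n expn_gt0.
have q4 : (4 ^ n)%:R = q ^+ 2 :> R by rewrite qE -natrX -expnM mulnC expnM.
have SE : \sum_(1 <= k < 2 ^ n) (angle n.+1 k ^+ 2)^-1 = 4 * q ^+ 2 / pi ^+ 2 * S.
  rewrite SE0 mulr_sumr; apply: eq_big_nat => k /andP[k0 _].
  have k1 : k%:R != 0 :> R by rewrite pnatr_eq0 -lt0n.
  rewrite /angle expnS natrM -qE; move: (@pi R) pi0 => p p0.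
  by field; rewrite k1 (gt_eqF q0) (gt_eqF p0).
have up : 4 * q ^+ 2 / pi ^+ 2 * S <= 2 * ((q ^+ 2 - 1) / 3).
  rewrite -SE -q4 -csumE -half_sum; apply: ler_sum_nat => k kn.
  by have /andP[] := invr_sin_sqr_bounds (angle_bounds kn).
have lo : 2 * ((q ^+ 2 - 1) / 3) - q <= 4 * q ^+ 2 / pi ^+ 2 * S.
  rewrite -SE -q4 -csumE -half_sum.
  apply: (@le_trans _ _ (\sum_(1 <= k < 2 ^ n) ((sin (angle n.+1 k) ^+ 2)^-1 - 1))).
    by rewrite sumrB lerB// sumr_const_nat subn1 qE ler_nat leq_pred.
  apply: ler_sum_nat => k kn.
  by have /andP[] := invr_sin_sqr_bounds (angle_bounds kn).
have c0 : 0 < 4 * q ^+ 2 / pi ^+ 2 by rewrite divr_gt0 ?mulr_gt0 ?exprn_gt0.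
rewrite q4 -qE; move: (@pi R) pi0 up lo c0 => p p0 up lo c0.
rewrite -(ler_pM2l c0) -[X in _ && X](ler_pM2l c0); apply/andP; split.
  apply: le_trans lo; rewrite le_eqVlt; apply/orP; left; apply/eqP.
  by field; rewrite !gt_eqF.
apply: (le_trans up).
have -> : 4 * q ^+ 2 / p ^+ 2 * (p ^+ 2 / 6) = 2 * (q ^+ 2 / 3) by field; rewrite gt_eqF.
lra.
Qed.

(** [trigamma 1] exceeds the partial sums of the squared inverses by values of
    trigamma that vanish at infinity; partial sums up to powers of two suffice. *)
Lemma trigamma1 : trigamma 1 = pi ^+ 2 / 6 :> R.
Proof.
have pi0 := @pi_gt0 R.
have P0 : 0 <= pi ^+ 2 / 6 :> R by rewrite divr_ge0 ?exprn_ge0 ?(ltW pi0).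
have bound n : pi ^+ 2 / 6 - (5 / 2 * (pi ^+ 2 / 6)) * harmonic n <= (trigamma 1 : R) <= pi ^+ 2 / 6 + harmonic n.
  have n2 : (n.+2 <= 2 ^ n.+1)%N by exact: ltn_expl.
  have e : (2 ^ n.+1 = (2 ^ n.+1).-1.+1)%N by rewrite prednK// expn_gt0.
  have := @trigamma_natS R (2 ^ n.+1).-1; rewrite -e => ->.
  set S := bigop _ _ _; have /andP[lo up] := @basel_bounds n.+1 S erefl.
  have n2R : n.+2%:R <= (2 ^ n.+1)%:R :> R by rewrite ler_nat.
  have g1 : 1 < (2 ^ n.+1)%:R :> R by rewrite (lt_le_trans _ n2R)// ltr1n.
  have t0 := trigamma_ge0 (lt_trans ltr01 g1).
  have t1 := trigamma_le g1.
  have t2 : ((2 ^ n.+1)%:R - 1)^-1 <= harmonic n :> R.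
    rewrite /harmonic /= lef_pV2 ?posrE ?subr_gt0//.
    by rewrite -natr1 in n2R; rewrite lerBrDr.
  have h2 : (2 ^ n.+1)%:R^-1 <= harmonic n :> R.
    have q0 := lt_trans ltr01 g1.
    by rewrite /harmonic /= lef_pV2 ?posrE// ler_nat (leq_trans _ n2).
  have h4 : (4 ^ n.+1)%:R^-1 <= (2 ^ n.+1)%:R^-1 :> R.
    by rewrite lef_pV2 ?posrE ?ltr0n ?expn_gt0// ler_nat leq_exp2r.
  apply/andP; split; last by lra.
  apply: (@le_trans _ _ (pi ^+ 2 / 6 * (1 - harmonic n) - pi ^+ 2 / 4 * harmonic n)); first by lra.
  have h5 := ler_wpM2l P0 (le_trans h4 h2).
  have h6 := ler_wpM2l P0 h2.
  lra.
have lim1 : pi ^+ 2 / 6 - (5 / 2 * (pi ^+ 2 / 6)) * harmonic n @[n --> \oo] --> (pi ^+ 2 / 6 : R).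
  rewrite -[X in _ --> X]subr0 -[X in _ - X](mulr0 (5 / 2 * (pi ^+ 2 / 6))).
  by apply: cvgB; [exact: cvg_cst|apply: cvgM; [exact: cvg_cst|exact: cvg_harmonic]].
have lim2 : pi ^+ 2 / 6 + harmonic n @[n --> \oo] --> (pi ^+ 2 / 6 : R).
  by rewrite -[X in _ --> X]addr0; apply: cvgD; [exact: cvg_cst|exact: cvg_harmonic].
have lim : (cst (trigamma 1) : nat -> R) n @[n --> \oo] --> (pi ^+ 2 / 6 : R).
  by apply: squeeze_cvgr lim1 lim2; exact: nearW.
exact: (cvg_unique _ (cvg_cst _) lim).
Qed.

End basel.

(** * The limiting constants *)

Section limit_constants.
Context {R : realType}.
Notation G := (@gamma_int R).

(** The [m]-th derivative of [Upsilon r], as an integral. *)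
Definition Upsilon_der (m : nat) (r x : R) : R := r * G m (x + 2) + (1 - r) * G m (x + 1).

Lemma UpsilonE r x : Upsilon r x = Upsilon_der 0 r x.
Proof. by rewrite /Upsilon !Gamma_gamma_int. Qed.

Lemma is_derive_Upsilon_der m r (x : R) : 0 <= x ->
  is_derive x 1 (Upsilon_der m r) (Upsilon_der m.+1 r x).
Proof.
move=> x0; have x1 : 0 < x + 1 by lra.
have x2 : 0 < x + 2 by lra.
have d1 := @dcomp _ (G m) (fun x => x + 1) x _ _ (is_derive_gamma_int m x1) (dD (did x) (dcst x 1)).
have d2 := @dcomp _ (G m) (fun x => x + 2) x _ _ (is_derive_gamma_int m x2) (dD (did x) (dcst x 2)).
apply: (dE (dD (dM (dcst x r) d2) (dM (dcst x (1 - r)) d1))).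
rewrite /Upsilon_der; move: (G _ _) (G _ _) (G _ _) (G _ _) => a b c e.
by rewrite !mul0r !add0r !addr0 !mulr1.
Qed.

Lemma is_derive_Upsilon r (x : R) : 0 <= x -> is_derive x 1 (Upsilon r) (Upsilon_der 1 r x).
Proof. by move=> x0; apply: dext (is_derive_Upsilon_der 0 r x0) => t; rewrite UpsilonE. Qed.

Lemma derive1_Upsilon r (x : R) : 0 <= x -> (Upsilon r)^`()%classic x = Upsilon_der 1 r x.
Proof. by move=> x0; rewrite derive1E (@derive_val _ _ _ _ _ _ _ (is_derive_Upsilon r x0)). Qed.

Lemma derive2_Upsilon r (x : R) : 0 < x -> (Upsilon r)^`(2)%classic x = Upsilon_der 2 r x.
Proof.
move=> x0; rewrite derive1nS derive1n1.
have eqn : \forall y \near x, Upsilon_der 1 r y = (Upsilon r)^`()%classic y.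
  by near=> y; rewrite derive1_Upsilon// ltW//; near: y; exact: lt_nbhsr.
have d := near_eq_is_derive eqn (is_derive_Upsilon_der 1 r (ltW x0)).
by rewrite derive1E (@derive_val _ _ _ _ _ _ _ d).
Unshelve. all: by end_near. Qed.

Lemma Upsilon_gt0 r (x : R) : 0 <= r <= 1 -> 0 <= x -> 0 < Upsilon_der 0 r x.
Proof.
move=> /andP[r0 r1] x0; rewrite /Upsilon_der.
have g1 : 0 < G 0 (x + 1) by apply: gamma_int0_gt0; lra.
have g2 : 0 < G 0 (x + 2) by apply: gamma_int0_gt0; lra.
move: r0; rewrite le_eqVlt => /predU1P[<-|r0]; first by rewrite mul0r add0r subr0 mul1r.
apply: ltr_pwDl; first exact: mulr_gt0.
by apply: mulr_ge0; [rewrite subr_ge0|exact: (ltW g1)].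
Qed.

Lemma PiE r (y : R) : 0 < y ->
  Pi r y = y^-1 - Upsilon_der 1 r y / Upsilon_der 0 r y + r / 2 - euler_gamma.
Proof. by move=> y0; rewrite /Pi derive1_Upsilon ?(ltW y0)// UpsilonE. Qed.

(** An empty set of zeros would give the default value 0. *)
Lemma Pi_varpi r : 0 < varpi r :> R -> Pi r (varpi r) = 0.
Proof.
move=> v0; suff [] : [set y : R | 0 < y /\ Pi r y = 0] (varpi r) by [].
apply: getPex; apply/not_existsP => h.
by move: v0; rewrite /varpi (getPN h) ltxx.
Qed.

Lemma digamma3 : digamma 3 = 3 / 2 - euler_gamma :> R.
Proof.
have -> : 3 = (1 + 1) + 1 :> R by ring.
by rewrite !digammaS ?addr_gt0// digamma1; field.
Qed.

Lemma trigamma3 : trigamma 3 = pi ^+ 2 / 6 - 5 / 4 :> R.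
Proof.
have -> : 3 = (1 + 1) + 1 :> R by ring.
by rewrite !trigammaS ?addr_gt0// trigamma1; move: (@pi R) => p; field.
Qed.

Lemma Pi1E (y : R) : 0 < y -> Pi 1 y = y^-1 - digamma (y + 2) + 1 / 2 - euler_gamma.
Proof. by move=> y0; rewrite PiE// /Upsilon_der subrr !mul0r !addr0 !mul1r. Qed.

Lemma Pi1_decreasing (x y : R) : 0 < x -> x < y -> Pi 1 y < Pi 1 x.
Proof.
move=> x0 xy; have y0 := lt_trans x0 xy; rewrite !Pi1E//.
have h1 : digamma (x + 2) <= digamma (y + 2) by apply: le_digamma; lra.
have h2 : y^-1 < x^-1 by rewrite ltf_pV2.
by rewrite ltrD2r ltrD2r ltr_leB.
Qed.

Lemma Pi1_1 : Pi 1 1 = 0 :> R.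
Proof.
rewrite Pi1E// (_ : 1 + 2 = 3 :> R); last by ring.
by rewrite digamma3; field.
Qed.

Lemma varpi1 : varpi 1 = 1 :> R.
Proof.
have [v0 P0] : [set y : R | 0 < y /\ Pi 1 y = 0] (varpi 1).
  by apply: getPex; exists 1; rewrite /= Pi1_1.
have [v1|v1|//] := ltgtP (varpi 1) (1 : R).
  by have := Pi1_decreasing v0 v1; rewrite Pi1_1 P0 ltxx.
by have := Pi1_decreasing ltr01 v1; rewrite Pi1_1 P0 ltxx.
Qed.

(** For [r = 1] the function [Upsilon] is the shifted Gamma function, so only its
    value and its first two derivatives at 3 are involved; [digamma3] and
    [trigamma3] supply them. *)
Lemma M_independence (alpha0 : R) : 0 < alpha0 -> M 1 alpha0 = M1 alpha0.
Proof.
move=> a0; have a1 : alpha0 != 0 by rewrite gt_eqF.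
have pi2 := @pi_ge2 R.
have G3 : G 0 3 = 2.
  have -> : 3 = 1 + 1 + 1 :> R by ring.
  by rewrite !gamma_intS ?addr_gt0// gamma_int0_1; ring.
have UE m : Upsilon_der m 1 1 = G m 3.
  by rewrite /Upsilon_der subrr mul0r addr0 mul1r; congr (G m _); ring.
have G3' : G 1 3 = 3 - 2 * euler_gamma.
  have := digamma3; rewrite /digamma G3 => /(congr1 (fun u => u * 2)).
  by rewrite divfK// => ->; field.
have G3'' : G 2 3 * 2 - G 1 3 ^+ 2 = 4 * (pi ^+ 2 / 6 - 5 / 4).
  by have := trigamma3; rewrite /trigamma G3 => <-; field.
rewrite /M /M1; cbv zeta; rewrite varpi1 mul1r UpsilonE derive1_Upsilon// derive2_Upsilon// !UE G3 divff ?pnatr_eq0//.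
rewrite ln1 !powR1 mulr0 !mul0r !subr0 !expr1n G3''.
move: G3'; set g1 := G 1 3 => ->.
move: (@euler_gamma R) (@pi R) pi2 => g p p2.
have p0 : 2 * p ^+ 2 - 3 != 0 by rewrite gt_eqF//; nra.
have p1 : -48 - 2 * (p ^+ 2 * 4 - 30) != 0 by rewrite lt_eqF//; nra.
apply/matrixP => i j; rewrite !mxE.
by case: i => [[|[|//]]] //= _; case: j => [[|[|[|[|//]]]]] //= _; field; rewrite a1 p0 p1.
Qed.

End limit_constants.

(** * Laws with a density on the line *)

Section density.
Context d (T : measurableType d) (R : realType) (P : probability T R).
Notation mu := (@lebesgue_measure R).
Variables (S : T -> R) (mS : measurable_fun setT S).
Variables (p : R -> R) (mp : measurable_fun setT p) (p_ge0 : forall t, 0 <= p t).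
Hypothesis tails : forall x,
  P (S @^-1` `[x, +oo[) = (\int[mu]_(t in `[x, +oo[) (p t)%:E)%E.

Let X : {RV P >-> measurableTypeR R} := HB.pack S (@isMeasurableFun.Build _ _ _ (measurableTypeR R) S mS).
Let nu : {finite_measure set (measurableTypeR R) -> \bar R} := distribution P X.

Let mpE : measurable_fun setT (EFin \o p).
Proof. exact/measurable_EFinP. Qed.

(** Closed upper rays generate the Borel sets and are stable under intersection. *)
Lemma distribution_density (A : set R) : measurable A ->
  P (S @^-1` A) = (\int[mu]_(t in A) (p t)%:E)%E.
Proof.
move=> mA.
pose m2 (B : set (measurableTypeR R)) : \bar R := (\int[mu]_(t in B) (p t)%:E)%E.
have m20 : m2 set0 = 0%E by rewrite /m2 integral_set0.
have m2_ge0 B : (0 <= m2 B)%E by apply: integral_ge0 => t _; rewrite lee_fin.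
have m2_add : semi_sigma_additive m2.
  move=> F mF tF mUF; rewrite /m2; apply: cvg_toP.
    apply: ereal_nondecreasing_is_cvgn => m n mn.
    apply: lee_sum_nneg_natr => // k _ _; apply: integral_ge0 => t _.
    by rewrite lee_fin.
  by rewrite ge0_integral_bigcup//; [exact: measurable_funTS|move=> t _; rewrite lee_fin].
pose M2 : {measure set (measurableTypeR R) -> \bar R} :=
  HB.pack m2 (isMeasure.Build _ _ _ m2 m20 m2_ge0 m2_add).
pose M1 : {measure set (measurableTypeR R) -> \bar R} := nu.
rewrite -[LHS]/(M1 A) -[RHS]/(M2 A).
apply: (@measure_unique _ R (measurableTypeR R) (@RGenCInfty.G R) (fun n => `[(- n%:R), +oo[%classic) _ _ _ _ M1 M2) => //.
- exact: RGenCInfty.measurableE.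
- move=> B C [x ->] [y ->]; exists (Num.max x y).
  apply/seteqP; split => t /=; rewrite !in_itv/= !andbT ge_max.
    by move=> [-> ->].
  by move=> /andP[].
- by move=> n; exists (- n%:R).
- rewrite -subTset => t _; exists (Num.trunc `|t|).+1 => //=.
  by rewrite in_itv/= andbT lerNl (le_trans (ler_norm _))// normrN ltW// truncnS_gt.
- by move=> B [x ->]; exact: tails.
- by move=> n; rewrite (le_lt_trans (probability_le1 _ _)) ?ltry.
Qed.

Let dom : nu `<< mu.
Proof.
apply/null_content_dominatesP => A mA A0.
rewrite -[LHS]/(P (S @^-1` A)) distribution_density//.
by apply: null_set_integral => //; exact: measurable_funTS.
Qed.

Let ge0_integral_nu (f : R -> \bar R) : (forall t, 0 <= f t)%E -> measurable_fun setT f ->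
  (\int[nu]_t f t = \int[mu]_t (f t * (p t)%:E))%E.
Proof.
move=> f0 mf; rewrite -(Radon_Nikodym_SigmaFinite.change_of_variables dom)//.
apply: ae_eq_integral => //.
- by apply: emeasurable_funM => //; exact: measurable_int (Radon_Nikodym_SigmaFinite.f_integrable dom).
- exact: emeasurable_funM.
apply: ae_eqe_mul2l; apply: integral_ae_eq => //.
- exact: (Radon_Nikodym_SigmaFinite.f_integrable dom).
- move=> E _ mE; rewrite -(Radon_Nikodym_SigmaFinite.f_integral dom)//.
  exact: distribution_density.
Qed.

Let ge0_integral_density (D : set T) (f : R -> \bar R) : measurable D -> P D = 1%E ->
  (forall t, 0 <= f t)%E -> measurable_fun setT f ->
  (\int[P]_(x in D) f (S x) = \int[mu]_t (f t * (p t)%:E))%E.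
Proof.
move=> mD D1 f0 mf; rewrite -ge0_integral_nu//.
have DC : P (~` D) = 0%E by rewrite probability_setC// D1 subee.
transitivity (\int[P]_x f (S x))%E; last first.
  by rewrite [RHS](@ge0_integral_distribution _ _ _ _ _ _ X).
rewrite [RHS](@ge0_negligible_integral _ _ _ _ setT (~` D))//.
- by rewrite setDE setCK setTI.
- exact: measurableC.
- exact: measurableT_comp.
Qed.

(** Change of variables through the Radon-Nikodym derivative of the law of [S],
    which equals [p] almost everywhere. *)
Lemma integral_density (D : set T) (f : R -> R) : measurable D -> P D = 1%E ->
  measurable_fun setT f ->
  \int[P]_(x in D) f (S x) = \int[mu]_t (f t * p t).
Proof.
move=> mD D1 mf; rewrite /Rintegral; congr fine.
rewrite integralE [RHS]integralE.
have mfE : measurable_fun setT (EFin \o f) by exact/measurable_EFinP.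
have pmax (u : \bar R) (t : R) : (maxe u 0 * (p t)%:E = maxe (u * (p t)%:E) 0)%E.
  by rewrite maxe_pMl ?lee_fin// mul0e.
congr (_ - _)%E.
- have e := ge0_integral_density mD D1 (funepos_ge0 (EFin \o f)) (measurable_funepos mfE).
  by move: e; rewrite unlock /= => ->; apply: eq_integral => t _; rewrite pmax.
- have e := ge0_integral_density mD D1 (funeneg_ge0 (EFin \o f)) (measurable_funeneg mfE).
  by move: e; rewrite unlock /= => ->; apply: eq_integral => t _; rewrite pmax -EFinM mulNr.
Qed.

End density.

(** * The margins of the limit law *)

Section margins.
Context {R : realType}.
Notation mu := (@lebesgue_measure R).
Notation halfline := (`]0, +oo[%classic : set R).

(** Density of the power [- alpha0] of a positive variable with cdf
    [expR (- u `^ (- alpha0)) * (1 + r * u `^ (- alpha0))]. *)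
Definition margin_density (r : R) : R -> R :=
  (fun s => (1 - r) * gamma_integrand 0 1 s + r * gamma_integrand 0 2 s) \_ halfline.

Lemma margin_densityE r s : 0 < s -> margin_density r s = expR (- s) * (1 - r + r * s).
Proof.
move=> s0; rewrite /margin_density patchE mem_set/= ?in_itv/= ?s0//.
rewrite /gamma_integrand subrr powRr0 expr0 !mul1r.
rewrite (_ : 2 - 1 = 1 :> R); last by ring.
by rewrite powRr1 ?(ltW s0)//; ring.
Qed.

Lemma margin_density_le0 r s : s <= 0 -> margin_density r s = 0.
Proof.
move=> s0; rewrite /margin_density patchE memNset//= in_itv/= andbT.
by apply/negP; rewrite -leNgt.
Qed.

Lemma margin_density_ge0 r s : 0 <= r <= 1 -> 0 <= margin_density r s.
Proof.
move=> /andP[r0 r1]; have [s0|s0] := leP s 0; first by rewrite margin_density_le0.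
by rewrite margin_densityE// mulr_ge0 ?expR_ge0// addr_ge0 ?subr_ge0// mulr_ge0// ltW.
Qed.

Lemma integrable_gamma_mixture (r : R) : mu.-integrable halfline
  (EFin \o (fun t => (1 - r) * gamma_integrand 0 1 t + r * gamma_integrand 0 2 t)).
Proof.
by apply: integrable_add => //; apply: integrable_scale => //; exact: integrable_gamma_integrand.
Qed.

Lemma measurable_margin_density r : measurable_fun setT (margin_density r).
Proof.
case/integrableP: (integrable_gamma_mixture r) => mg _.
move/measurable_EFinP: mg => mg.
exact: ((measurable_restrictT _ (measurable_itv `]0, +oo[%R)).1 mg).
Qed.

Lemma integral_margin_density_tail r x : 0 <= r <= 1 -> 0 < x ->
  (\int[mu]_(t in `[x, +oo[) (margin_density r t)%:E = (expR (- x) * (1 + r * x))%:E)%E.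
Proof.
move=> r01 x0.
pose F (s : R) := - (expR (- s) * (1 + r * s)).
have dF (s : R) : is_derive s 1 F (expR (- s) * (1 - r + r * s)).
  have d1 := @dcomp _ expR -%R s _ _ (is_derive_expR _) (dN (did s)).
  have d2 := dD (dcst s 1) (dM (dcst s r) (did s)).
  by apply: (dE (dN (dM d1 d2))); ring.
transitivity (\int[mu]_(t in `[x, +oo[) (expR (- t) * (1 - r + r * t))%:E)%E.
  apply: eq_integral => t /set_mem; rewrite /= in_itv/= andbT => xt.
  by rewrite margin_densityE// (lt_le_trans x0).
rewrite (@ge0_continuous_FTC2y _ _ F _ 0).
- by rewrite sub0e /F EFinN oppeK.
- move=> t xt; have t0 : 0 < t := lt_le_trans x0 xt.
  by rewrite -margin_densityE// margin_density_ge0.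
- apply: continuous_subspaceT => t.
  have d1 := @dcomp _ expR -%R t _ _ (is_derive_expR _) (dN (did t)).
  exact: (dcont (dM d1 (dD (dcst t (1 - r)) (dM (dcst t r) (did t))))).
- have half_cvg : 3 * expR (- (2^-1 * x)) @[x --> +oo] --> (0 : R).
    rewrite -[X in _ --> X](mulr0 3); apply: cvgM; first exact: cvg_cst.
    apply: (@cvg_comp _ _ _ (fun x : R => 2^-1 * x) (fun x => expR (- x)) _ (pinfty_nbhs R)).
      exact: gt0_cvgMry.
    exact: cvgr_expR.
  rewrite -oppr0; apply: cvgN.
  apply: squeeze_cvgr (cvg_cst 0) half_cvg.
  near=> s; have s0 : 0 < s by near: s; exact: nbhs_pinfty_gt.
  have /andP[r0 r1] := r01.
  rewrite mulr_ge0 ?expR_ge0 ?addr_ge0 ?mulr_ge0 ?(ltW s0)//=.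
  have -> : - s = - (2^-1 * s) + - (2^-1 * s) by field.
  rewrite expRD -mulrA mulrC ler_pM2r ?expR_gt0//.
  rewrite expRN mulrC ler_pdivrMr ?expR_gt0//.
  have := expR_ge1Dx (2^-1 * s); nra.
- by move=> t _; have [] := dF t.
- by apply: cvg_at_right_filter; exact: dcont (dF x).
- by move=> t _; rewrite derive1E (@derive_val _ _ _ _ _ _ _ (dF t)).
Unshelve. all: by end_near. Qed.

Lemma integral_margin_density (r : R) (f : R -> R) :
  \int[mu]_t (f t * margin_density r t) =
  \int[mu]_(t in halfline) (f t * ((1 - r) * gamma_integrand 0 1 t + r * gamma_integrand 0 2 t)).
Proof.
rewrite [RHS]Rintegral_mkcond; apply: eq_Rintegral => t _.
by rewrite /margin_density !patchE; case: ifP; rewrite ?mulr0.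
Qed.

Lemma integral_power_margin_density (c r x : R) m : 0 <= x ->
  \int[mu]_t ((c * (t `^ x * ln t ^+ m)) * margin_density r t) = c * Upsilon_der m r x.
Proof.
move=> x_ge0; have x1 : 0 < x + 1 by lra.
have x2 : 0 < x + 2 by lra.
rewrite integral_margin_density.
transitivity (\int[mu]_(t in halfline) ((c * r) * gamma_integrand m (x + 2) t +
    (c * (1 - r)) * gamma_integrand m (x + 1) t + 0 * gamma_integrand m (x + 1) t)).
  2: by rewrite Rintegral_lin3; [rewrite mul0r addr0 -!mulrA -mulrDr|exact: integrable_gamma_integrand..].
apply: eq_Rintegral => t /set_mem; rewrite /= in_itv/= andbT => t0.
have tn0 : t != 0 by rewrite gt_eqF.
have powRDt a b : t `^ (a + b) = t `^ a * t `^ b by rewrite powRD// tn0 implybT.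
rewrite /gamma_integrand subrr powRr0 expr0.
rewrite (_ : 2 - 1 = 1%:R :> R); last by ring.
rewrite (_ : x + 2 - 1 = x + 1%:R); last by ring.
rewrite addrK powRDt powR_mulrn ?(ltW t0)//.
ring.
Qed.

Lemma integral_margin_density_ray (r x : R) : 0 <= r <= 1 -> x <= 0 ->
  (\int[mu]_(t in `[x, +oo[) (margin_density r t)%:E = 1)%E.
Proof.
move=> r01 x0.
have -> : (\int[mu]_(t in `[x, +oo[) (margin_density r t)%:E)%E =
    (\int[mu]_(t in halfline)
       ((1 - r) * gamma_integrand 0 1 t + r * gamma_integrand 0 2 t)%:E)%E.
  rewrite integral_mkcond [RHS]integral_mkcond; apply: eq_integral => t _.
  rewrite !patchE /margin_density patchE.
  have [t0|_] := boolP (t \in halfline); last by case: ifP.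
  rewrite ifT//; move: t0; rewrite !inE/= !in_itv/= !andbT => /ltW; exact: le_trans.
have intg := integrable_gamma_mixture r.
rewrite -[LHS]fineK; last exact: integrable_fin_num.
congr EFin; rewrite -[LHS]/(\int[mu]_(t in halfline) ((1 - r) * gamma_integrand 0 1 t + r * gamma_integrand 0 2 t)).
rewrite RintegralD//; try by apply: integrable_scale => //; exact: integrable_gamma_integrand.
rewrite !RintegralZl//; try exact: integrable_gamma_integrand.
rewrite -!/(gamma_int _ _) (_ : gamma_int 0 2 = 1); last first.
  rewrite (_ : 2 = 1 + 1 :> R); last by ring.
  by rewrite gamma_intS// gamma_int0_1 mulr1.
by rewrite gamma_int0_1; ring.
Qed.

End margins.

(** * Moments of the limit law *)

Section class_C_bounds.
Context {R : realType}.
Variables (rho : R -> R) (C : class_C rho).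

Lemma class_C_rho0 : 0 <= rho 0 <= 1.
Proof. by case: C => h _ _; have := h 0; rewrite in_itv/= lexx ler01 subr0 => /(_ isT). Qed.

(** Concavity puts [rho] above its chord over the unit interval, whose right end
    [rho 1] is nonnegative. *)
Lemma class_C_chord eta : 0 <= eta <= 1 -> (1 - eta) * rho 0 <= rho eta.
Proof.
move=> e01; have /andP[e0 e1] := e01; case: C => b _ cv.
have z0 : (0 : R) \in (`[0, 1]%classic : set R) by rewrite inE/= in_itv/= lexx ler01.
have z1 : (1 : R) \in (`[0, 1]%classic : set R) by rewrite inE/= in_itv/= lexx ler01.
have := cv (Itv01 e0 e1) 1 0 z1 z0.
have /andP[r1 _] : 0 <= rho 1 <= 1 - 1 by apply: b; rewrite in_itv/= ler01 lexx.
rewrite /conv/= /conv/= scaler0 addr0 /GRing.scale/= mulr1 /unstable.onem.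
have : 0 <= eta * rho 1 by rewrite mulr_ge0.
lra.
Qed.

Lemma class_C_le_rho0 eta : 0 <= eta <= 1 -> rho eta <= rho 0.
Proof.
move=> /andP[e0 e1]; case: C => _ mono _; apply: mono => //.
- by rewrite in_itv/= lexx ler01.
- by rewrite in_itv/= e0 e1.
Qed.

(** A concave function lies above its chords, and a nonincreasing one below its
    value at the origin, so no jump is possible there. *)
Lemma class_C_cvg0 (u : nat -> R) : (forall n, 0 <= u n <= 1) ->
  u n @[n --> \oo] --> 0 -> rho (u n) @[n --> \oo] --> rho 0.
Proof.
move=> u01 u0.
apply: (@squeeze_cvgr _ _ _ _ (fun n => (1 - u n) * rho 0) (cst (rho 0))).
- by apply: nearW => n; rewrite class_C_chord// class_C_le_rho0.
- rewrite -[X in _ --> X]mul1r; apply: cvgM; last exact: cvg_cst.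
  by rewrite -[X in _ --> X]subr0; apply: cvgB => //; exact: cvg_cst.
- exact: cvg_cst.
Qed.

Lemma class_C_independence : rho 0 = 1 -> {in `[0, 1], forall eta, rho eta = 1 - eta}.
Proof.
move=> r1 eta e01; have := class_C_chord; move: (e01); rewrite in_itv/= => e01' /(_ _ e01').
case: C => b _ _; have /andP[_ ub] := b _ e01; rewrite r1 mulr1 => lb.
by apply/le_anti; rewrite ub lb.
Qed.

End class_C_bounds.

Section limit_moments.
Context {R : realType}.
Variables (H : probability (R * R)%type R).

Lemma measurable_quadrant : measurable (@quadrant R).
Proof. by apply: measurableX; exact: measurable_itv. Qed.

Lemma probability_setI1 (A D : set (R * R)) : measurable A -> measurable D ->
  H D = 1%E -> H (A `&` D) = H A.
Proof.
move=> mA mD D1.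
have DC : H (~` D) = 0%E by rewrite probability_setC// D1 subee.
have := measureDI H mA mD.
rewrite [X in (X + _)%E](_ : _ = 0%E) ?add0e => [->//|].
apply: (subset_measure0 _ _ _ DC) => //.
- exact: measurableD.
- exact: measurableC.
Qed.

(** The power [- a] turns the variable into one with density [margin_density r]. *)
Lemma margin_moment (U : R * R -> R) (a r : R) : measurable_fun setT U ->
  H quadrant = 1%E -> (forall z, quadrant z -> 0 < U z) -> 0 < a -> 0 <= r <= 1 ->
  (forall u, 0 < u -> H (U @^-1` `]-oo, u]) =
     (expR (- (u `^ (- a))) * (1 + r * u `^ (- a)))%:E) ->
  forall m x, 0 <= x -> \int[H]_(z in quadrant) (U z `^ (- (a * x)) * ln (U z) ^+ m) =
     (- a^-1) ^+ m * Upsilon_der m r x.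
Proof.
move=> mU H1 U0 a0 r01 cdfU m x x0.
pose S z := U z `^ (- a).
have mS : measurable_fun setT S.
  exact: (measurableT_comp (measurable_powR (- a)) mU).
have mp := measurable_margin_density r.
have p0 t := margin_density_ge0 t r01.
have an0 : a != 0 by rewrite gt_eqF.
have mray s : measurable (S @^-1` `[s, +oo[).
  by rewrite -[X in measurable X]setTI; apply: mS => //; exact: measurable_itv.
have tails s : H (S @^-1` `[s, +oo[) =
    (\int[lebesgue_measure]_(t in `[s, +oo[) (margin_density r t)%:E)%E.
  have [s0|s0] := leP s 0.
    rewrite integral_margin_density_ray//.
    rewrite (_ : S @^-1` _ = setT) ?probability_setT//.
    by apply/seteqP; split => // z _ /=; rewrite in_itv/= andbT (le_trans s0)// powR_ge0.
  have [u [u0 us]] : exists u, 0 < u /\ u `^ (- a) = s.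
    exists (s `^ (- a^-1)); rewrite powR_gt0//; split => //.
    by rewrite -powRrM mulrNN mulVf// powRr1 ?(ltW s0).
  rewrite integral_margin_density_tail// -{2}us -{2}us -cdfU//.
  have mU' : measurable (U @^-1` `]-oo, u]).
    by rewrite -[X in measurable X]setTI; apply: mU => //; exact: measurable_itv.
  rewrite -(probability_setI1 (mray s) measurable_quadrant H1).
  rewrite -(probability_setI1 mU' measurable_quadrant H1); congr (H _).
  apply/seteqP; split => z [/= + qz]; have Uz := U0 z qz; rewrite !in_itv/= ?andbT => h.
    split; last by [].
    rewrite leNgt; apply/negP => uU.
    move: h; rewrite -us /S !powRN lef_pV2 ?posrE ?powR_gt0// leNgt.
    by rewrite gt0_ltr_powR ?nnegrE ?ltW.
  split; last by [].
    rewrite -us /S !powRN lef_pV2 ?posrE ?powR_gt0//.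
  by apply: ge0_ler_powR; rewrite ?nnegrE// ltW.
pose f s := (- a^-1) ^+ m * (s `^ x * ln s ^+ m).
have mf : measurable_fun setT f.
  apply: measurable_funM => //; apply: measurable_funM; first exact: measurable_powR.
  by apply: measurable_funX; exact: measurable_ln.
transitivity (\int[H]_(z in quadrant) f (S z)).
  apply: eq_Rintegral => z /set_mem /U0 Uz.
  rewrite /f /S ln_powR -powRrM mulNr mulrCA -exprMn; congr (_ * _ ^+ m).
  by field.
rewrite (integral_density mS mp p0 tails measurable_quadrant H1 mf).
exact: integral_power_margin_density.
Qed.

Variables (rho : R -> R) (alpha0 : R) (C : class_C rho) (a0 : 0 < alpha0).
Hypothesis HFW : is_FW H rho alpha0 1.

Let FW1 : H quadrant = 1%E. Proof. by case: HFW. Qed.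

Let FW_cdfP (x y : R) : 0 < x -> 0 < y ->
  H (`]-oo, x] `*` `]-oo, y]) = (FW_cdf rho alpha0 1 x y)%:E.
Proof. by case: HFW => _; apply. Qed.

Lemma FW_cdf_fst x : 0 < x -> H (fst @^-1` `]-oo, x]) =
  (expR (- (x `^ (- alpha0))) * (1 + 0 * x `^ (- alpha0)))%:E.
Proof.
move=> x0; rewrite mul0r addr0 mulr1.
pose F n : set (R * R) := `]-oo, x] `*` `]-oo, (x + n%:R)].
have -> : fst @^-1` `]-oo, x] = \bigcup_n F n.
  apply/seteqP; split => [z zx|z [n _ []]//].
  exists (Num.trunc `|z.2|).+1 => //; split => //=.
  rewrite in_itv/= (le_trans (ler_norm _))// (le_trans (ltW (truncnS_gt _)))//.
  by rewrite lerDr ltW.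
have mF n : measurable (F n) by apply: measurableX; exact: measurable_itv.
have ndF : {homo F : n m / (n <= m)%N >-> (n <= m)%O}.
  move=> n m nm; apply/subsetPset => z [/= zx zy]; split => //=.
  move: zy; rewrite !in_itv/= => /le_trans; apply; by rewrite lerD2l ler_nat.
have lim := nondecreasing_cvg_mu (mu := H) mF (bigcupT_measurable _ mF) ndF.
apply: (cvg_unique _ lim) => //.
rewrite (_ : H \o F = cst (expR (- (x `^ (- alpha0))))%:E); first exact: cvg_cst.
apply/funext => n /=; rewrite /F FW_cdfP//; last by rewrite ltr_pwDl.
by rewrite /FW_cdf lerDl ler0n divr1.
Qed.

(** The first coordinate tends to infinity, so the argument of [rho] tends to zero,
    where [rho] is continuous by [class_C_cvg0]. *)
Lemma FW_cdf_snd y : 0 < y -> H (snd @^-1` `]-oo, y]) =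
  (expR (- (y `^ (- alpha0))) * (1 + rho 0 * y `^ (- alpha0)))%:E.
Proof.
move=> y0.
pose F n : set (R * R) := `]-oo, (y + n.+1%:R)] `*` `]-oo, y].
have -> : snd @^-1` `]-oo, y] = \bigcup_n F n.
  apply/seteqP; split => [z zx|z [n _ []]//].
  exists (Num.trunc `|z.1|) => //; split => //=.
  rewrite in_itv/= (le_trans (ler_norm _))// (le_trans (ltW (truncnS_gt _)))//.
  by rewrite lerDr ltW.
have mF n : measurable (F n) by apply: measurableX; exact: measurable_itv.
have ndF : {homo F : n m / (n <= m)%N >-> (n <= m)%O}.
  move=> n m nm; apply/subsetPset => z [/= zx zy]; split => //=.
  move: zx; rewrite !in_itv/= => /le_trans; apply; by rewrite lerD2l ler_nat.
have lim := nondecreasing_cvg_mu (mu := H) mF (bigcupT_measurable _ mF) ndF.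
apply: (cvg_unique _ lim) => //.
pose u n := (y / (y + n.+1%:R)) `^ alpha0.
have yn n : 0 < y + n.+1%:R by rewrite addr_gt0.
have frac01 n : 0 <= y / (y + n.+1%:R) <= 1.
  by rewrite divr_ge0 ?(ltW y0) ?(ltW (yn n))//= ler_pdivrMr// mul1r lerDl.
have u01 n : 0 <= u n <= 1.
  have /andP[f0 f1] := frac01 n; rewrite /u powR_ge0/=.
  by have := ge0_ler_powR (ltW a0) _ _ f1; rewrite powR1 !nnegrE; apply.
have u_cvg : u n @[n --> \oo] --> 0.
  have /cvg_at_rightP := powR_cvg0 a0; apply; split.
    by move=> n; rewrite divr_gt0.
  apply: (@squeeze_cvgr _ _ _ _ (cst 0) (fun n => y * harmonic n)).
  - apply: nearW => n; have /andP[-> _] /= := frac01 n.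
    by rewrite ler_pM2l// lef_pV2 ?posrE// lerDr ltW.
  - exact: cvg_cst.
  - rewrite -[X in _ --> X](mulr0 y); apply: cvgM; first exact: cvg_cst.
    exact: cvg_harmonic.
rewrite (_ : H \o F = EFin \o (fun n => expR (- (y `^ (- alpha0))) * (1 + rho (u n) * y `^ (- alpha0)))).
  apply: cvg_EFin; first exact: nearW.
  apply: cvgM; first exact: cvg_cst.
  apply: cvgD; first exact: cvg_cst.
  by apply: cvgM; [exact: class_C_cvg0|exact: cvg_cst].
apply/funext => n /=; rewrite /F FW_cdfP//.
by rewrite /FW_cdf leNgt ltrDl ltr0Sn /= divr1.
Qed.

Lemma FW_moment_snd m x : 0 <= x ->
  \int[H]_(z in quadrant) (z.2 `^ (- (alpha0 * x)) * ln z.2 ^+ m) =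
  (- alpha0^-1) ^+ m * Upsilon_der m (rho 0) x.
Proof.
move=> x0; apply: (@margin_moment snd) => //.
- by move=> z [_]; rewrite /= in_itv/= andbT.
- exact: class_C_rho0.
- exact: FW_cdf_snd.
Qed.

Lemma FW_moment_fst m x : 0 <= x ->
  \int[H]_(z in quadrant) (z.1 `^ (- (alpha0 * x)) * ln z.1 ^+ m) =
  (- alpha0^-1) ^+ m * Upsilon_der m 0 x.
Proof.
move=> x0; apply: (@margin_moment fst) => //.
- by move=> z [+ _]; rewrite /= in_itv/= andbT.
- by rewrite lexx ler01.
- exact: FW_cdf_fst.
Qed.

Lemma FW_log_snd : \int[H]_(z in quadrant) ln z.2 = (euler_gamma - rho 0) / alpha0.
Proof.
transitivity (\int[H]_(z in quadrant) (z.2 `^ (- (alpha0 * 0)) * ln z.2 ^+ 1)).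
  by apply: eq_Rintegral => z _; rewrite mulr0 oppr0 powRr0 mul1r expr1.
rewrite FW_moment_snd// /Upsilon_der !add0r.
have -> : gamma_int 1 2 = 1 - euler_gamma :> R.
  have -> : 2 = 1 + 1 :> R by ring.
  by rewrite gamma_int1S// gamma_int1_1 gamma_int0_1; ring.
by rewrite gamma_int1_1; field; rewrite gt_eqF.
Qed.

Lemma FW_log_fst : \int[H]_(z in quadrant) ln z.1 = euler_gamma / alpha0.
Proof.
transitivity (\int[H]_(z in quadrant) (z.1 `^ (- (alpha0 * 0)) * ln z.1 ^+ 1)).
  by apply: eq_Rintegral => z _; rewrite mulr0 oppr0 powRr0 mul1r expr1.
rewrite FW_moment_fst// /Upsilon_der !add0r mul0r add0r subr0 mul1r.
by rewrite gamma_int1_1; field; rewrite gt_eqF.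
Qed.

End limit_moments.

(** * The likelihood equations *)

Section likelihood.
Context {R : realType}.
Variables (k : nat) (z : k.-tuple (R * R)) (sigma : R).
Hypotheses (k_gt0 : (0 < k)%N) (sigma_gt0 : 0 < sigma).
Hypothesis z_gt0 : forall p, p \in (z : seq (R * R)) -> 0 < p.2 <= p.1.

Definition power_mean m (a : R) : R := emp_mean z sigma (fun p => p.2 `^ (- a) * ln p.2 ^+ m).
Definition log_mean : R := emp_mean z sigma (fun p => ln p.1) + emp_mean z sigma (fun p => ln p.2).

(** Derivative, up to the positive factor [k], of the log-likelihood maximized
    over the scale parameter. *)
Definition score (a : R) : R := 2 / a + 2 * power_mean 1 a / power_mean 0 a - log_mean.

Let k0 : 0 < k%:R :> R. Proof. by rewrite ltr0n. Qed.

Let y_gt0 p : p \in (z : seq (R * R)) -> 0 < p.2 / sigma.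
Proof. by move=> /z_gt0/andP[? _]; rewrite divr_gt0. Qed.

Lemma power_mean0_gt0 a : 0 < power_mean 0 a.
Proof.
rewrite /power_mean /emp_mean mulr_gt0 ?invr_gt0//.
case: k z k_gt0 z_gt0 => // k' z' _ z'_gt0.
case: (tupleP z') z'_gt0 => p t pos.
rewrite big_cons ltr_pwDl//.
  by rewrite expr0 mulr1 powR_gt0// divr_gt0//; have /andP[] := pos p (mem_head _ _).
by apply: sumr_ge0 => q _; rewrite expr0 mulr1 powR_ge0.
Qed.

Lemma is_derive_power_mean m (a : R) :
  is_derive a 1 (power_mean m) (- power_mean m.+1 a).
Proof.
pose g (s : seq (R * R)) (m : nat) b := \sum_(p <- s) ((p.2 / sigma) `^ (- b) * ln (p.2 / sigma) ^+ m).
have dg (s : seq (R * R)) : {subset s <= (z : seq (R * R))} -> is_derive a 1 (g s m) (- g s m.+1 a).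
  elim: s => [_|p s IHs sz].
    rewrite /g; under eq_fun do rewrite big_nil; rewrite big_nil oppr0; exact: dcst.
  have p0 : 0 < p.2 / sigma by apply: y_gt0; apply: sz; exact: mem_head.
  have {}IHs : is_derive a 1 (g s m) (- g s m.+1 a) by apply: IHs => q qs; apply: sz; rewrite in_cons qs orbT.
  have d1 := @dcomp _ (fun u => (p.2 / sigma) `^ u) -%R a _ _ (dpowR_exponent _ p0) (dN (did a)).
  have d2 := dD (dM d1 (dcst a (ln (p.2 / sigma) ^+ m))) IHs.
  have e (b : R) : (p.2 / sigma) `^ (- b) * ln (p.2 / sigma) ^+ m + g s m b = g (p :: s) m b.
    by rewrite /g big_cons.
  apply: (dE (dext e d2)); rewrite /g big_cons exprS; ring.
have d := dM (dcst a k%:R^-1) (dg z (fun _ h => h)).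
have e (b : R) : k%:R^-1 * g z m b = power_mean m b by [].
by apply: (dE (dext e d)); rewrite mul0r add0r mulrN.
Qed.

(** Nonnegativity of the weighted second moment of [ln y - l]. *)
Lemma power_mean_cauchy_schwarz a : power_mean 1 a ^+ 2 <= power_mean 2 a * power_mean 0 a.
Proof.
have A0 := power_mean0_gt0 a.
pose l := power_mean 1 a / power_mean 0 a.
have : 0 <= power_mean 2 a - 2 * l * power_mean 1 a + l ^+ 2 * power_mean 0 a.
  have -> : power_mean 2 a - 2 * l * power_mean 1 a + l ^+ 2 * power_mean 0 a =
      k%:R^-1 * \sum_(p <- z) ((p.2 / sigma) `^ (- a) * (ln (p.2 / sigma) - l) ^+ 2).
    rewrite /power_mean /emp_mean !(mulrCA _ k%:R^-1) -mulrBr -mulrDr; congr (_ * _).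
    rewrite !mulr_sumr -sumrB -big_split/=; apply: eq_bigr => p _; ring.
  by rewrite mulr_ge0 ?invr_ge0// sumr_ge0// => p _; rewrite mulr_ge0 ?powR_ge0 ?sqr_ge0.
move=> h; rewrite -subr_ge0; have := mulr_ge0 h (ltW A0); congr (0 <= _).
by rewrite /l; field; rewrite gt_eqF.
Qed.

(** The ratio of power means in the score has minus the variance of the logarithms,
    for the weights [y `^ (- a)], as derivative; it can only add to the drop of
    [2 / a]. *)
Lemma score_drop (a b : R) : 0 < a -> a < b -> 2 / a - 2 / b <= score a - score b.
Proof.
move=> a0 ab.
pose q (x : R) := power_mean 1 x / power_mean 0 x.
pose dq (x : R) := - ((power_mean 2 x * power_mean 0 x - power_mean 1 x ^+ 2) / power_mean 0 x ^+ 2).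
have dF (x : R) : 0 < x -> is_derive x 1 q (dq x).
  move=> _; have A0 : power_mean 0 x != 0 by rewrite gt_eqF// power_mean0_gt0.
  have d := dM (is_derive_power_mean 1 x) (dV (is_derive_power_mean 0 x) A0).
  by apply: (dE d); rewrite /dq; field.
have [c _ qab] := MVT_gt0 dF a0 ab.
have : q b <= q a.
  rewrite -subr_le0 qab mulr_le0_ge0 ?subr_ge0 ?(ltW ab)// /dq oppr_le0.
  by rewrite divr_ge0 ?sqr_ge0// subr_ge0 power_mean_cauchy_schwarz.
have e x : score x = 2 / x + 2 * q x - log_mean by rewrite /score /q mulrA.
rewrite !e; move: (2 / a) (2 / b) (q a) (q b) => *; lra.
Qed.

Lemma score_decreasing (a b : R) : 0 < a -> a < b -> score b < score a.
Proof.
move=> a0 ab; rewrite -subr_gt0 (lt_le_trans _ (score_drop a0 ab))//.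
by rewrite subr_gt0 ltr_pM2l// ltf_pV2// posrE (lt_trans a0).
Qed.

Lemma loglikE a s : 0 < s -> loglik z a s =
  k%:R * (2 * ln a + 2 * a * ln (s / sigma) - (a + 1) * log_mean
          - (s / sigma) `^ a * power_mean 0 a) - 2 * k%:R * ln sigma.
Proof.
move=> s0; rewrite /loglik size_tuple /log_mean /power_mean /emp_mean.
rewrite -mulrDr -big_split/=.
have -> : \sum_(p <- z) ((a + 1) * ln (p.1 * p.2) + s `^ a * p.2 `^ (- a)) =
  (a + 1) * \sum_(p <- z) (ln (p.1 / sigma) + ln (p.2 / sigma)) + 2 * (a + 1) * k%:R * ln sigma
  + (s / sigma) `^ a * \sum_(p <- z) ((p.2 / sigma) `^ (- a) * ln (p.2 / sigma) ^+ 0).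
  have -> : 2 * (a + 1) * k%:R * ln sigma = \sum_(p <- z) (2 * (a + 1) * ln sigma).
    rewrite big_const_seq count_predT size_tuple iter_addr addr0 -mulr_natr; ring.
  rewrite !mulr_sumr -!big_split/=; apply: eq_big_seq => p pz.
  have /andP[y0 yx] := z_gt0 pz; have x0 := lt_le_trans y0 yx.
  rewrite expr0 mulr1 (@ln_div _ p.1) ?posrE// (@ln_div _ p.2) ?posrE// (@lnM _ p.1) ?posrE//.
  have -> : s `^ a * p.2 `^ (- a) = (s / sigma) `^ a * (p.2 / sigma) `^ (- a).
    have sn0 : sigma != 0 by rewrite gt_eqF.
    rewrite -{1}(divfK sn0 s) -{1}(divfK sn0 p.2) !powRM ?divr_ge0 ?ltW ?invr_gt0//.
    rewrite mulrACA -[RHS]mulr1; congr (_ * _).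
    by rewrite -powRD ?subrr ?powRr0// sn0 implybT.
  ring.
rewrite ln_div ?posrE//.
by field; rewrite gt_eqF.
Qed.

(** Value of the log-likelihood after maximization over the scale. *)
Let profile a := 2 * ln a - (a + 1) * log_mean - 2 * ln (power_mean 0 a).

Let is_derive_profile (a : R) : 0 < a -> is_derive a 1 profile (score a).
Proof.
move=> a0; have A0 := power_mean0_gt0 a.
have d1 := dM (dcst a 2) (is_derive1_ln a0).
have d2 := dM (dD (did a) (dcst a 1)) (dcst a log_mean).
have d3 := dM (dcst a 2) (@dcomp _ (@ln R) (power_mean 0) a _ _ (is_derive1_ln A0) (is_derive_power_mean 0 a)).
apply: (dE (dB (dB d1 d2) d3)); rewrite /score; field.
by rewrite !gt_eqF.
Qed.

(** [ln w - w] is largest at [w = 1]. *)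
Let scale_max a s : 0 < a -> 0 < s ->
  2 * ln a + 2 * a * ln (s / sigma) - (a + 1) * log_mean - (s / sigma) `^ a * power_mean 0 a
  <= profile a + 2 * ln 2 - 2 ?= iff ((s / sigma) `^ a * power_mean 0 a == 2).
Proof.
move=> a0 s0; have A0 := power_mean0_gt0 a.
have t0 : 0 < (s / sigma) `^ a by rewrite powR_gt0// divr_gt0.
set w := (s / sigma) `^ a * power_mean 0 a; have w0 : 0 < w by rewrite mulr_gt0.
have -> : 2 * a * ln (s / sigma) = 2 * ln w - 2 * ln (power_mean 0 a).
  by rewrite /w lnM ?posrE// ln_powR; ring.
have v0 : 0 < w / 2 by rewrite divr_gt0.
have lnw : ln w = ln (w / 2) + ln 2 by rewrite ln_div ?posrE// subrK.
rewrite lnw /profile; split.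
  have : -1 < w / 2 - 1 by lra.
  by move=> /le_ln1Dx; rewrite addrCA subrr addr0; lra.
apply/eqP/eqP => [h|->]; last by rewrite divff// ln1; ring.
apply/eqP/negPn/negP => w2.
have u0 : ln (w / 2) != 0.
  rewrite ln_eq0//; apply: contra w2 => /eqP e; apply/eqP; lra.
have := expR_gt1Dx u0; rewrite lnK ?posrE//; lra.
Qed.

Let profile_max a b : 0 < a -> 0 < b -> score a = 0 -> b != a -> profile b < profile a.
Proof.
move=> a0 b0 sa; case: (ltgtP b a) => // [ba|ab] _.
  have [c /andP[bc ca] e] := MVT_gt0 is_derive_profile b0 ba.
  have sc : 0 < score c by rewrite -sa; apply: score_decreasing => //; exact: lt_trans bc.
  by rewrite -subr_gt0 e mulr_gt0// subr_gt0.
have [c /andP[ac cb] e] := MVT_gt0 is_derive_profile a0 ab.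
have sc : score c < 0 by rewrite -sa; exact: score_decreasing.
by rewrite -subr_lt0 e nmulr_rlt0// subr_gt0.
Qed.

Definition scale_of (a : R) : R := sigma * (2 / power_mean 0 a) `^ a^-1.

Lemma scale_of_gt0 a : 0 < scale_of a.
Proof. by rewrite mulr_gt0// powR_gt0// divr_gt0// power_mean0_gt0. Qed.

Lemma scale_ofP a s : 0 < a -> 0 < s ->
  (s / sigma) `^ a * power_mean 0 a = 2 <-> s = scale_of a.
Proof.
move=> a0 s0; have A0 := power_mean0_gt0 a.
have an0 : a != 0 by rewrite gt_eqF.
have q0 : 0 < 2 / power_mean 0 a by rewrite divr_gt0.
split=> [h|->].
  rewrite /scale_of -{1}[2]h mulfK ?gt_eqF// -powRrM mulfV// powRr1 ?divr_ge0 ?ltW//.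
  by rewrite mulrC divfK// gt_eqF.
rewrite /scale_of mulrAC divff ?gt_eqF// mul1r -powRrM mulVf// powRr1 ?ltW//.
by rewrite divfK// gt_eqF.
Qed.

(** Maximizing first over the scale, then over the shape, identifies the maximizers
    with the zeros of the score; the maximum is global since the score changes sign
    only once. *)
Lemma loglik_argmaxP (t : R * R) : loglik_argmax z t <->
  [/\ 0 < t.1, score t.1 = 0 & t.2 = scale_of t.1].
Proof.
case: t => a s; rewrite /loglik_argmax/=; split=> [[a0 s0 amax]|[a0 sa ->]].
  have sM b : 0 < b -> profile b + 2 * ln 2 - 2 <= 2 * ln a + 2 * a * ln (s / sigma)
      - (a + 1) * log_mean - (s / sigma) `^ a * power_mean 0 a.
    move=> b0; have sb := scale_of_gt0 b.
    have := amax b (scale_of b) b0 sb.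
    rewrite !loglikE// lerD2r ler_pM2l//.
    have [_ e] := scale_max b0 sb; have w2 := (scale_ofP b0 sb).2 erefl.
    by rewrite w2 eqxx in e *; rewrite (eqP e).
  have [up iff2] := scale_max a0 s0.
  have eq2 : (s / sigma) `^ a * power_mean 0 a = 2.
    by apply/eqP; rewrite -iff2 eq_le up sM.
  split => //; last by apply/(scale_ofP a0 s0).
  have amax' b : 0 < b -> profile b <= profile a.
    by move=> b0; have := le_trans (sM b b0) up; rewrite !lerD2r.
  have a2 : a / 2 < a by rewrite ltr_pdivrMr// ltr_pMr// ltr1n.
  have a3 : a < 2 * a by rewrite ltr_pMl// ltr1n.
  have d := @derive1_at_max R profile (a / 2) (2 * a) a (ltW (lt_trans a2 a3)).
  have := is_derive_profile a0 => d'.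
  rewrite -(@derive_val _ _ _ _ _ _ _ d').
  have {}d := @derive_val _ _ _ _ _ _ _ (d _ _ _).
  apply: d.
  - by move=> t; rewrite in_itv/= => /andP[h _]; have [] := is_derive_profile (lt_trans (divr_gt0 a0 (ltr0Sn _ 1)) h).
  - by rewrite in_itv/= a2 a3.
  - by move=> t; rewrite in_itv/= => /andP[h _]; apply: amax'; rewrite (lt_trans _ h)// divr_gt0.
have s0 := scale_of_gt0 a; split => // b s' b0 s'0.
rewrite !loglikE// lerD2r ler_pM2l//.
have [up _] := scale_max b0 s'0; apply: (le_trans up).
have [_ e] := scale_max a0 s0; have w2 := (scale_ofP a0 s0).2 erefl.
rewrite w2 eqxx in e *; rewrite (eqP e).
rewrite !lerD2r; have [->//|ba] := eqVneq b a.
exact/ltW/profile_max.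
Qed.

Lemma score_unique a b : 0 < a -> 0 < b -> score a = 0 -> score b = 0 -> a = b.
Proof.
move=> a0 b0 sa sb; have [ab|ba|//] := ltgtP a b.
  by have := score_decreasing a0 ab; rewrite sa sb ltxx.
by have := score_decreasing b0 ba; rewrite sa sb ltxx.
Qed.

Lemma mle_root a : ~~ constant z -> 0 < a -> score a = 0 ->
  alpha_hat z = a%:E /\ sigma_hat z = scale_of a.
Proof.
move=> cz a0 sa; rewrite /alpha_hat /sigma_hat (negbTE cz).
have -> : get (loglik_argmax z) = (a, scale_of a) => //.
apply: get_unique; first by apply/loglik_argmaxP.
move=> [b s] /loglik_argmaxP/= [b0 sb ->].
by rewrite (score_unique b0 a0 sb sa).
Qed.

(** The default value of an empty choice is zero. *)
Lemma mle_noroot : ~~ constant z -> (forall a, 0 < a -> score a <> 0) ->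
  alpha_hat z = 0%:E /\ sigma_hat z = 0.
Proof.
move=> cz nr; rewrite /alpha_hat /sigma_hat (negbTE cz).
by rewrite getPN// => t /loglik_argmaxP[t0 st _]; exact: nr st.
Qed.

Lemma continuous_score (a : R) : 0 < a -> {for a, continuous score}.
Proof.
move=> a0; have A0 : power_mean 0 a != 0 by rewrite gt_eqF// power_mean0_gt0.
have an0 : a != 0 by rewrite gt_eqF.
have d1 := dM (dcst a 2) (dV (did a) an0).
have d2 := dM (dM (dcst a 2) (is_derive_power_mean 1 a)) (dV (is_derive_power_mean 0 a) A0).
exact: (dcont (dB (dD d1 d2) (dcst a log_mean))).
Qed.

Lemma score_root a b : 0 < a -> a <= b -> 0 <= score a -> score b <= 0 ->
  exists2 c, a <= c <= b & score c = 0.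
Proof.
move=> a0 ab sa sb.
have cs : {within `[a, b], continuous score}.
  apply: continuous_in_subspaceT => t /set_mem; rewrite /= in_itv/= => /andP[at_ _].
  exact: continuous_score (lt_le_trans a0 at_).
have [|c + sc] := IVT ab cs (v := 0).
  by rewrite ge_min le_max sa sb orbT.
by rewrite in_itv/= => ?; exists c.
Qed.

(** Near the origin the term [2 / a] dominates the score. *)
Lemma score_gt0 b : 0 < b -> exists2 a, 0 < a <= b & 0 < score a.
Proof.
move=> b0.
pose c := 2 / b + (`|score b| + 1).
have bc : 2 / b < c by rewrite /c ltrDl ltr_wpDl.
have c0 : 0 < c by rewrite (lt_trans _ bc)// divr_gt0.
have x0 : 0 < 2 / c by rewrite divr_gt0.
have xb : 2 / c < b by rewrite ltr_pdivrMr// mulrC -ltr_pdivrMr.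
exists (2 / c); first by rewrite x0 ltW.
have := score_drop x0 xb; rewrite invf_div mulrCA divff ?mulr1 ?pnatr_eq0// {1}/c.
have := lerNnormlW (lexx `|score b|); move: (2 / b) (score (2 / c)) `|score b| (score b).
by move=> *; lra.
Qed.

End likelihood.

(** * Measurability of the estimator *)

Lemma measurable_of_gt d (T : measurableType d) (R : realType) (f : T -> R) :
  (forall x, measurable [set w | x < f w]) -> measurable_fun [set: T] f.
Proof.
move=> mf; move=> mD; apply: (measurability _ (RGenOInfty.measurableE R)) => //.
move=> _ [_] [x] -> <-; rewrite setTI.
rewrite [X in measurable X](_ : _ = [set w | x < f w])//.
by apply/seteqP; split=> w /=; rewrite in_itv/= andbT.
Qed.

Lemma measurableT_ln d (T : measurableType d) (R : realType) (f : T -> R) :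
  measurable_fun setT f -> measurable_fun setT (fun w => ln (f w)).
Proof. by move=> mf; apply: (measurableT_comp (f := @ln R)). Qed.

Lemma measurableT_expR d (T : measurableType d) (R : realType) (f : T -> R) :
  measurable_fun setT f -> measurable_fun setT (fun w => expR (f w)).
Proof. by move=> mf; apply: (measurableT_comp (f := @expR R)). Qed.

Section measurable_mle.
Context {R : realType} d (T : measurableType d) (k : nat) (Z : 'I_k -> T -> R * R).
Variable sigma : R.
Hypotheses (k_gt0 : (0 < k)%N) (sigma_gt0 : 0 < sigma).
Hypothesis measurable_Z : forall i, measurable_fun setT (Z i).
Hypothesis Z_gt0 : forall i w, 0 < (Z i w).2 <= (Z i w).1.

Let Zt w : k.-tuple (R * R) := [tuple Z i w | i < k].

Let Zt_gt0 w p : p \in (Zt w : seq (R * R)) -> 0 < p.2 <= p.1.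
Proof. by move=> /mapP[i _ ->]. Qed.

Lemma emp_mean_sum (f : R * R -> R) w :
  emp_mean (Zt w) sigma f = k%:R^-1 * \sum_(i < k) f ((Z i w).1 / sigma, (Z i w).2 / sigma).
Proof.
rewrite /emp_mean big_tuple; congr (_ * _); apply: eq_bigr => i _.
by rewrite tnth_mktuple.
Qed.

Let mZ1 i : measurable_fun setT (fun w => (Z i w).1).
Proof. exact: measurableT_comp. Qed.

Let mZ2 i : measurable_fun setT (fun w => (Z i w).2).
Proof. exact: measurableT_comp. Qed.

Let mcst (x : R) : measurable_fun [set: T] (cst x). Proof. by []. Qed.

Lemma measurable_emp_mean (f : R * R -> R) :
  (forall i, measurable_fun setT (fun w => f ((Z i w).1 / sigma, (Z i w).2 / sigma))) ->
  measurable_fun setT (fun w => emp_mean (Zt w) sigma f).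
Proof.
move=> mf; under eq_fun do rewrite emp_mean_sum.
by apply: measurable_funM => //; exact: measurable_sum.
Qed.

Lemma measurable_emp_mean_ln1 : measurable_fun setT (fun w => emp_mean (Zt w) sigma (fun p => ln p.1)).
Proof. by apply: measurable_emp_mean => i; apply: measurableT_ln; exact: measurable_funM. Qed.

Lemma measurable_emp_mean_ln2 : measurable_fun setT (fun w => emp_mean (Zt w) sigma (fun p => ln p.2)).
Proof. by apply: measurable_emp_mean => i; apply: measurableT_ln; exact: measurable_funM. Qed.

Lemma measurable_log_mean : measurable_fun setT (fun w => log_mean (Zt w) sigma).
Proof.
apply: measurable_funD; [exact: measurable_emp_mean_ln1|exact: measurable_emp_mean_ln2].
Qed.

Lemma measurable_power_mean m (a : T -> R) : measurable_fun setT a ->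
  measurable_fun setT (fun w => power_mean (Zt w) sigma m (a w)).
Proof.
move=> ma; have e w : power_mean (Zt w) sigma m (a w) = k%:R^-1 * \sum_(i < k)
   (expR (- a w * ln ((Z i w).2 / sigma)) * ln ((Z i w).2 / sigma) ^+ m).
  rewrite /power_mean emp_mean_sum; congr (_ * _); apply: eq_bigr => i _ /=.
  have /andP[y0 _] := Z_gt0 i w.
  by rewrite /powR gt_eqF// divr_gt0.
under eq_fun do rewrite e.
have mL i : measurable_fun setT (fun w => ln ((Z i w).2 / sigma)).
  apply: measurableT_ln; exact: measurable_funM.
apply: measurable_funM => //; apply: measurable_sum => i.
apply: measurable_funM; last exact: measurable_funX.
apply: measurableT_expR; apply: measurable_funM => //.
exact: measurable_funN.
Qed.

Lemma measurable_score a : measurable_fun setT (fun w => score (Zt w) sigma a).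
Proof.
have e w : score (Zt w) sigma a = 2 / a + 2 * power_mean (Zt w) sigma 1 a *
    expR (- ln (power_mean (Zt w) sigma 0 a)) - log_mean (Zt w) sigma.
  by rewrite expRN lnK// posrE; exact/power_mean0_gt0/Zt_gt0.
under eq_fun do rewrite e.
apply: measurable_funB; last exact: measurable_log_mean.
apply: measurable_funD => //; apply: measurable_funM.
  by apply: measurable_funM => //; exact: measurable_power_mean.
apply: measurableT_expR; apply: measurable_funN.
by apply: measurableT_ln; exact: measurable_power_mean.
Qed.

Lemma constant_mktuple w : constant (Zt w) <-> forall i j, Z i w = Z j w.
Proof.
split=> [/constantP|e].
  move=> /(_ (0, 0)) [x zx] i j.
  have h i' : Z i' w = x.
    have : Z i' w \in (Zt w : seq _) by apply/mapP; exists i' => //; rewrite mem_enum.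
    by rewrite zx => /nseqP[].
  by rewrite !h.
apply/constantP; first exact: (0, 0).
exists (Z (Ordinal k_gt0) w); rewrite size_tuple; apply: (@eq_from_nth _ (0, 0)).
  by rewrite size_tuple size_nseq.
move=> i; rewrite size_tuple => ik.
rewrite nth_nseq ik -[i]/(nat_of_ord (Ordinal ik)) -tnth_nth tnth_mktuple; exact: e.
Qed.

Lemma measurable_constant : measurable [set w | constant (Zt w)].
Proof.
pose i0 := Ordinal k_gt0.
rewrite (_ : [set w | _] = \bigcap_(i in [set: 'I_k]) [set w | Z i w = Z i0 w]); last first.
  apply/seteqP; split=> w /=; first by move=> /constant_mktuple h i _; exact: h.
  by move=> h; apply/constant_mktuple => i j; rewrite (h i)// (h j).
apply: fin_bigcap_measurable => // i _.
have m1 := measurable_fun_eqr (mZ1 i) (mZ1 i0).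
have m2 := measurable_fun_eqr (mZ2 i) (mZ2 i0).
have := measurable_and m1 m2; move=> /(_ measurableT [set true] I); rewrite setTI.
congr measurable; apply/seteqP; split=> w /=.
  by move: (Z i w) (Z i0 w) => [? ?] [? ?]/= /andP[/eqP -> /eqP ->].
by move=> ->; rewrite !eqxx.
Qed.

(** As the score decreases, its zero exceeds [x] exactly when the score is positive
    at [x], and it exists exactly when the score is nonpositive at some positive
    integer. On the event without a zero the estimators take a constant value. *)
Lemma measurable_mle : exists A S : T -> R,
  [/\ measurable_fun setT A, measurable_fun setT S, forall w, sigma_hat (Zt w) = S w &
      forall w, alpha_hat (Zt w) = if constant (Zt w) then +oo%E else (A w)%:E].
Proof.
pose root := \bigcup_n [set w | score (Zt w) sigma n.+1%:R <= 0].
have mroot : measurable root.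
  apply: bigcupT_measurable => n.
  have := measurable_fun_ler (measurable_score n.+1%:R) (mcst 0).
  move=> /(_ measurableT [set true] I); rewrite setTI; congr measurable.
have mC := measurable_constant.
have rootP w : root w -> exists2 a, 0 < a & score (Zt w) sigma a = 0.
  move=> [n _ /= sn]; have [a /andP[a0 an] sa] := @score_gt0 _ k (Zt w) sigma k_gt0 sigma_gt0 (@Zt_gt0 w) n.+1%:R (ltr0Sn _ _).
  have [c /andP[ac _] sc] := score_root k_gt0 sigma_gt0 (@Zt_gt0 w) a0 an (ltW sa) sn.
  by exists c => //; exact: lt_le_trans ac.
have Nroot w : ~ root w -> forall a, 0 < a -> score (Zt w) sigma a <> 0.
  move=> nr a a0 sa; apply: nr; exists (Num.truncn a) => //=.
  have := score_decreasing k_gt0 sigma_gt0 (@Zt_gt0 w) a0 (truncnS_gt a).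
  by rewrite sa => /ltW.
pose A w := if constant (Zt w) then 0 else (get (loglik_argmax (Zt w))).1.
have Aroot w a : ~~ constant (Zt w) -> 0 < a -> score (Zt w) sigma a = 0 -> A w = a.
  move=> cz a0 sa; rewrite /A (negbTE cz).
  by have [+ _] := mle_root k_gt0 sigma_gt0 (@Zt_gt0 w) cz a0 sa; rewrite /alpha_hat (negbTE cz) => -[].
have Anoroot w : ~~ constant (Zt w) -> ~ root w -> A w = 0.
  move=> cz nr; rewrite /A (negbTE cz).
  by have [+ _] := mle_noroot k_gt0 sigma_gt0 (@Zt_gt0 w) cz (Nroot w nr); rewrite /alpha_hat (negbTE cz) => -[].
have mA : measurable_fun setT A.
  apply: measurable_of_gt => x; have [x0|x0] := ltP x 0.
    rewrite (_ : [set w | _] = setT)//; apply/seteqP; split=> w //= _.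
    apply: (lt_le_trans x0); rewrite /A; case: ifPn => // cz.
    have [/rootP[a a0 sa]|nr] := pselect (root w); last first.
      by have := Anoroot w cz nr; rewrite /A (negbTE cz) => ->.
    by have := Aroot w a cz a0 sa; rewrite /A (negbTE cz) => ->; exact: ltW.
  rewrite (_ : [set w | _] = ~` [set w | constant (Zt w)] `&` root `&`
      [set w | (x == 0) || (0 < score (Zt w) sigma x)]).
    apply: measurableI; first by apply: measurableI => //; exact: measurableC.
    have [_|xn0] /= := eqVneq x 0; first by rewrite (_ : [set w | _] = setT)//; apply/seteqP; split.
    have := measurable_fun_ltr (mcst 0) (measurable_score x).
    by move=> /(_ measurableT [set true] I); rewrite setTI; congr measurable.
  apply/seteqP; split=> w /=.
    move=> xA; have cz : ~~ constant (Zt w).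
      by apply: contraTN xA => cz; rewrite /A cz -leNgt.
    have rw : root w.
      by apply: contrapT => nr; move: xA; rewrite (Anoroot w)// ltNge x0.
    split; first by split=> //; exact/negP.
    move: rw xA => /rootP[a a0 sa]; rewrite (Aroot w a) => // xa.
    have [//|xn0] /= := eqVneq x 0.
    rewrite -sa; apply: (score_decreasing k_gt0 sigma_gt0 (@Zt_gt0 w)) => //.
    by rewrite lt_neqAle eq_sym xn0.
  move=> [[/negP cz /rootP[a a0 sa]]]; rewrite (Aroot w a)//.
  have [->//|xn0] /= := eqVneq x 0.
  have {xn0}x0 : 0 < x by rewrite lt_neqAle eq_sym xn0.
  rewrite -sa; apply: contraTT; rewrite -!leNgt le_eqVlt => /predU1P[->//|ax].
  exact/ltW/(score_decreasing k_gt0 sigma_gt0 (@Zt_gt0 w)).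
(* Inverses and powers are written with exponentials, which are measurable. *)
pose S w := if constant (Zt w) then (Z (Ordinal k_gt0) w).2 else
  if w \in root then sigma * expR ((ln 2 - ln (power_mean (Zt w) sigma 0 (A w))) * expR (- ln (A w)))
  else 0.
exists A, S; split => //.
- apply: measurable_fun_ifT => //.
    by apply: (measurable_fun_bool true); rewrite setTI.
  apply: measurable_fun_ifT => //.
    apply: (measurable_fun_bool true); rewrite setTI.
    by rewrite (_ : _ @^-1` _ = root)//; apply/seteqP; split=> w /=; [exact: set_mem|exact: mem_set].
  apply: measurable_funM => //; apply: measurableT_expR.
  apply: measurable_funM.
    apply: measurable_funB => //; apply: measurableT_ln.
    exact: measurable_power_mean.
  apply: measurableT_expR; apply: measurable_funN.
  exact: measurableT_ln.
- move=> w; rewrite /S; case: ifPn => cz.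
    rewrite /sigma_hat cz -nth0 -[0%N]/(nat_of_ord (Ordinal k_gt0)).
    by rewrite -tnth_nth tnth_mktuple.
  case: ifPn => [|nr].
    move=> /set_mem/rootP[a a0 sa].
    have [_ ->] := mle_root k_gt0 sigma_gt0 (@Zt_gt0 w) cz a0 sa.
    rewrite (Aroot w a)// /scale_of; congr (_ * _).
    have A0 := power_mean0_gt0 k_gt0 sigma_gt0 (@Zt_gt0 w) a.
    rewrite expRN lnK ?posrE// -ln_div ?posrE//.
    by rewrite /powR ifF ?gt_eqF ?divr_gt0// mulrC.
  by apply: (mle_noroot k_gt0 sigma_gt0 (@Zt_gt0 w) cz (Nroot w _)).2 => rw; move/negP: nr; apply; exact: mem_set.
- by move=> w; rewrite /alpha_hat /A; case: ifPn.
Qed.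

End measurable_mle.

(** An open subset of the plane is a countable union of squares with rational
    centres and radii. *)
Lemma measurable_continuous_pair d (T : measurableType d) (R : realType)
    (g : R * R -> R) (X Y : T -> R) : continuous g ->
  measurable_fun setT X -> measurable_fun setT Y ->
  measurable_fun setT (fun w => g (X w, Y w)).
Proof.
move=> cg mX mY; apply: measurable_of_gt => x.
pose r n : R := n.+1%:R^-1.
pose O := [set p | x < g p].
have oO : open O.
  have : open (g @^-1` `]x, +oo[%classic) by apply: open_comp => //; exact: interval_open.
  by congr open; apply/seteqP; split=> p /=; rewrite in_itv/= andbT.
pose F (p q : rat) n := if `[< ball (ratr p : R, ratr q : R) (r n) `<=` O >] then
   (X @^-1` ball (ratr p : R) (r n)) `&` (Y @^-1` ball (ratr q : R) (r n)) else set0.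
rewrite (_ : [set w | _] = \bigcup_p \bigcup_q \bigcup_n F p q n).
  do 2! (apply: bigcupT_measurable_rat => ?); apply: bigcupT_measurable => n.
  rewrite /F; case: ifP => // _; apply: measurableI.
    by rewrite -[X in measurable X]setTI; apply: mX => //; exact: measurable_ball.
  by rewrite -[X in measurable X]setTI; apply: mY => //; exact: measurable_ball.
apply/seteqP; split=> w /=; last first.
  move=> [p _] [q _] [n _]; rewrite /F; case: ifPn => // /asboolP sub [Xp Yq].
  by apply: sub.
move=> xg; have : nbhs (X w, Y w) O by exact: open_nbhs_nbhs.
move=> /nbhs_ballP[e /= e0 eO].
have e20 : 0 < e / 2 by rewrite divr_gt0.
have [n _ rn] : \forall n \near \oo, r n < e / 2.
  exact: near_infty_natSinv_lt (PosNum e20).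
have {}rn : r n < e / 2 by exact: rn (leqnn n).
have r0 : 0 < r n by rewrite invr_gt0.
have rats (a : R) : exists p : rat, `|a - ratr p| < r n.
  have ar : a < a + r n by rewrite ltrDl.
  have [p] := rat_in_itvoo ar.
  rewrite in_itv/= => /andP[ap pr].
  by exists p; rewrite distrC ger0_norm ?subr_ge0 ?(ltW ap)// ltrBlDr addrC.
have [p Xp] := rats (X w); have [q Yq] := rats (Y w).
exists p => //; exists q => //; exists n => //; rewrite /F; case: ifPn => [_|/asboolPn[]].
  by split; rewrite /= -ball_normE/= distrC.
have close (a b : R) : `|a - b| < r n -> forall c, ball (b : R) (r n) c -> ball (a : R) e c.
  move=> ab c; rewrite -!ball_normE/= => bc.
  by rewrite -(subrKA b) (le_lt_trans (ler_normD _ _))// [e]splitr ltrD// (lt_trans _ rn).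
move=> [a b] [/= pa qb]; apply: eO; split => /=; [exact: close pa|exact: close qb].
Qed.

(** * Taylor expansion of the estimator around the limit *)

Lemma MVT_between (R : realType) (f df : R -> R) (a b : R) :
  (forall x : R, 0 < x -> is_derive x 1 f (df x)) -> 0 < a -> 0 < b ->
  exists c, `|c - a| <= `|b - a| /\ f b - f a = df c * (b - a).
Proof.
move=> dF a0 b0; have [ab|ba|->] := ltgtP a b.
- have [c /andP[ac cb] e] := MVT_gt0 dF a0 ab; exists c; split=> //.
  by rewrite !ger0_norm ?subr_ge0 ?lerD2r ?ltW// (lt_trans ac).
- have [c /andP[bc ca] e] := MVT_gt0 dF b0 ba; exists c; split.
    by rewrite !ler0_norm ?subr_le0 ?lerN2 ?lerD2r ?ltW// (lt_trans bc).
  by rewrite -opprB e -mulrN opprB.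
- by exists b; rewrite !subrr mulr0.
Qed.

Section expansion.
Context {R : realType}.
Variables (k : nat) (z : k.-tuple (R * R)) (sigma : R).
Hypotheses (k_gt0 : (0 < k)%N) (sigma_gt0 : 0 < sigma).
Hypothesis z_gt0 : forall p, p \in (z : seq (R * R)) -> 0 < p.2 <= p.1.

Local Notation S := (power_mean z sigma).
Local Notation score := (score z sigma).

Let S_gt0 a : 0 < S 0 a. Proof. exact: power_mean0_gt0. Qed.

(** The term [2 / a] makes the score steep enough to cross zero close to any
    point where it is small. *)
Lemma score_root_near (a : R) : 0 < a -> `|score a| < a^-1 ->
  exists c, [/\ 0 < c, score c = 0 & `|c - a| <= a ^+ 2 * `|score a|].
Proof.
move=> a0 sa; have ha0 : 0 < a / 2 by rewrite divr_gt0.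
have ha : a / 2 < a by rewrite ltr_pdivrMr// ltr_pMr// ltr1n.
have da : a < 2 * a by rewrite ltr_pMl// ltr1n.
have := score_drop k_gt0 sigma_gt0 z_gt0 ha0 ha.
have := score_drop k_gt0 sigma_gt0 z_gt0 a0 da.
have -> : 2 / (a / 2) = 4 * a^-1 by field; rewrite gt_eqF.
have -> : 2 / (2 * a) = a^-1 by field; rewrite gt_eqF.
move=> h1 h2; have := sa; rewrite ltr_norml => /andP[sa1 sa2].
have ai : 0 < a^-1 by rewrite invr_gt0.
have [c /andP[ac cb] sc] : exists2 c, a / 2 <= c <= 2 * a & score c = 0.
  apply: (score_root k_gt0 sigma_gt0 z_gt0) => //; first by rewrite (le_trans (ltW ha)) ?ltW.
    by move: h2 sa1 ai; move: (score (a / 2)) (score a) (a^-1) => *; lra.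
  by move: h1 sa2 ai; move: (score (2 * a)) (score a) (a^-1) => *; lra.
have c0 : 0 < c by exact: lt_le_trans ac.
exists c; split => //.
have key : `|2 / c - 2 / a| <= `|score a|.
  have [cla|acl|->] := ltgtP c a; last by rewrite subrr normr0.
    have := score_drop k_gt0 sigma_gt0 z_gt0 c0 cla; rewrite sc sub0r => h.
    rewrite ger0_norm; last by rewrite subr_ge0 ler_pM2l// lef_pV2 ?posrE// ltW.
    by apply: (le_trans h); rewrite -normrN ler_norm.
  have := score_drop k_gt0 sigma_gt0 z_gt0 a0 acl; rewrite sc subr0 => h.
  rewrite distrC ger0_norm; first exact: le_trans h (ler_norm _).
  by rewrite subr_ge0 ler_pM2l// lef_pV2 ?posrE// ltW.
have -> : c - a = - (c * a / 2) * (2 / c - 2 / a) by field; rewrite !gt_eqF.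
have p0 : 0 <= c * a / 2 by rewrite divr_ge0 ?mulr_ge0 ?(ltW a0) ?(ltW c0).
rewrite normrM normrN (ger0_norm p0) ler_pM//.
by rewrite expr2 ler_pdivrMr// mulrAC ler_pM2r// mulrC.
Qed.

(** Logarithms cost an arbitrarily small power. *)
Lemma power_mean_bound m (d C : R) : 0 < d -> 0 < C ->
  (forall t, 0 < t -> `|ln t| ^+ m <= C * (t `^ d + t `^ (- d))) ->
  forall a x, `|x - a| <= d -> `|S m x| <= 2 * C * (S 0 (a - 2 * d) + S 0 (a + 2 * d)).
Proof.
move=> d0 C0 hC a x xa; have k0 : 0 < k%:R^-1 :> R by rewrite invr_gt0 ltr0n.
rewrite /power_mean /emp_mean -mulrDr (mulrCA _ k%:R^-1) normrM (gtr0_norm k0).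
rewrite ler_pM2l// -big_split/= mulr_sumr.
rewrite (le_trans (ler_norm_sum _ _ _))// big_seq [leRHS]big_seq ler_sum// => p pz.
have y0 : 0 < p.2 / sigma by have /andP[? _] := z_gt0 pz; rewrite divr_gt0.
move: (p.2 / sigma) y0 => y y0; rewrite !expr0 !mulr1 normrM normrX ger0_norm ?powR_ge0//.
rewrite (le_trans (ler_wpM2l (powR_ge0 _ _) (hC y y0)))// mulrCA (mulrC 2) -mulrA ler_pM2l//.
have yn0 : y != 0 by rewrite gt_eqF.
have powRDt r s : y `^ r * y `^ s = y `^ (r + s) by rewrite powRD// yn0 implybT.
rewrite mulrDr !powRDt.
have bnd r : `|r - a| <= 2 * d -> y `^ (- r) <= y `^ (- (a - 2 * d)) + y `^ (- (a + 2 * d)).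
  rewrite ler_norml => /andP[r1 r2]; have [y1|y1] := leP 1 y.
    by rewrite (le_trans (ler_powR y1 (_ : _ <= - (a - 2 * d)))) ?lerDl ?powR_ge0//; lra.
  rewrite (le_trans (_ : _ <= y `^ (- (a + 2 * d)))) ?lerDr ?powR_ge0//.
  by apply: ger_powR; rewrite ?y0 ?(ltW y1)//; lra.
rewrite mulr2n mulrDl mul1r; apply: lerD.
  have -> : - x + d = - (x - d) by ring.
  by apply: bnd; rewrite addrAC (le_trans (ler_normB _ _))// mulr2n mulrDl mul1r lerD// ger0_norm// ltW.
have -> : - x + - d = - (x + d) by ring.
by apply: bnd; rewrite addrAC (le_trans (ler_normD _ _))// mulr2n mulrDl mul1r lerD// ger0_norm// ltW.
Qed.

Definition dscore (x : R) : R :=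
  - (2 / x ^+ 2) - 2 * ((S 2 x * S 0 x - S 1 x ^+ 2) / S 0 x ^+ 2).

Lemma is_derive_score (x : R) : 0 < x -> is_derive x 1 score (dscore x).
Proof.
move=> x0; have A0 : S 0 x != 0 by rewrite gt_eqF.
have xn0 : x != 0 by rewrite gt_eqF.
have dS m : is_derive x 1 (S m) (- S m.+1 x) by exact: is_derive_power_mean.
have d1 := dM (dcst x 2) (dV (did x) xn0).
have d2 := dM (dM (dcst x 2) (dS 1)) (dV (dS 0) A0).
by apply: (dE (dB (dD d1 d2) (dcst x (log_mean z sigma)))); rewrite /dscore; field; rewrite xn0 A0.
Qed.

Lemma is_derive_root2 (a x : R) : 0 < x ->
  is_derive x 1 (fun s => (2 / s) `^ a^-1) (- ((2 / x) `^ a^-1 / (a * x))).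
Proof.
move=> x0; have q0 : 0 < 2 / x by rewrite divr_gt0.
have xn0 : x != 0 by rewrite gt_eqF.
have d := dM (dcst x 2) (dV (did x) xn0).
apply: (dE (@dcomp R (fun u => u `^ a^-1) (fun s => 2 / s) x _ _ (is_derive1_powR a^-1 q0) d)).
have -> : (2 / x) `^ a^-1 = (2 / x) `^ (a^-1 - 1) * (2 / x).
  rewrite -{3}(powRr1 (ltW q0)) -powRD ?subrK//.
  by rewrite (gt_eqF q0) implybT.
rewrite (invfM a x); move: (a^-1) ((2 / x) `^ (a^-1 - 1)) => b P. by field.
Qed.

(** Derivative of [scale_of] divided by [sigma]. *)
Definition dscale (x : R) : R :=
  (2 / S 0 x) `^ x^-1 * (S 1 x / (S 0 x * x) - ln (2 / S 0 x) / x ^+ 2).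

Lemma is_derive_scale (x : R) : 0 < x ->
  is_derive x 1 (fun a => (2 / S 0 a) `^ a^-1) (dscale x).
Proof.
move=> x0; have A0 := S_gt0 x; have An0 : S 0 x != 0 by rewrite gt_eqF.
have xn0 : x != 0 by rewrite gt_eqF.
have q0 a : 0 < 2 / S 0 a by rewrite divr_gt0.
apply: (@dext _ (fun a => expR (a^-1 * ln (2 / S 0 a)))) => [a|].
  by rewrite /powR ifF// gt_eqF.
have dS : is_derive x 1 (S 0) (- S 1 x) by exact: is_derive_power_mean.
have d1 := dM (dcst x 2) (dV dS An0).
have d2 := @dcomp R (@ln R) (fun a => 2 / S 0 a) x _ _ (is_derive1_ln (q0 x)) d1.
have d3 := dM (dV (did x) xn0) d2.
apply: (dE (@dcomp R (@expR R) _ x _ _ (is_derive_expR _) d3)).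
rewrite /dscale /powR (gt_eqF (q0 x)).
move: (expR (x^-1 * ln (2 / S 0 x))) => E; move: (ln _) => l; field.
by rewrite xn0 An0.
Qed.

(** The mean value theorem applied between [a] and the estimator, to the score and
    to the scale as a function of the shape. *)
Lemma mle_expansion (a : R) : ~~ constant z -> 0 < a -> `|score a| < a^-1 ->
  exists ah x1 x2, [/\ alpha_hat z = ah%:E,
    [/\ `|ah - a| <= a ^+ 2 * `|score a|, `|x1 - a| <= `|ah - a| & `|x2 - a| <= `|ah - a|],
    score a = - dscore x1 * (ah - a) &
    sigma_hat z / sigma = (2 / S 0 a) `^ a^-1 + dscale x2 * (ah - a)].
Proof.
move=> cz a0 sa; have [ah [ah0 sah ahn]] := score_root_near a0 sa.
have [ahE shE] := mle_root k_gt0 sigma_gt0 z_gt0 cz ah0 sah.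
have [x1 [x1n e1]] := MVT_between is_derive_score a0 ah0.
have [x2 [x2n e2]] := MVT_between is_derive_scale a0 ah0.
exists ah, x1, x2; split=> //.
  by rewrite mulNr -e1 sah sub0r opprK.
by rewrite -e2 addrC subrK shE /scale_of mulrAC divff ?gt_eqF// mul1r.
Qed.

End expansion.

(** * Convergence in probability along a triangular array *)

Section prob_filter.
Context {R : realType} {d : nat -> measure_display}
  {T : forall n, measurableType (d n)} (P : forall n, probability (T n) R).

(** Sets of outcomes, over all the spaces at once, that hold with probability tending
    to one. Convergence in probability is convergence along this filter, so the
    algebra of limits applies to variables living on different spaces. The inner
    measurable set [A] spares measurability conditions on [E]. *)
Definition prob_filter : set_system {n : nat & T n} :=
  [set E | forall eta : R, 0 < eta -> \forall n \near \oo, exists A : set (T n),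
    [/\ measurable A, forall w, A w -> E (existT _ n w) & (P n (~` A) <= eta%:E)%E]].

Global Instance prob_filter_filter : Filter prob_filter.
Proof.
split=> [eta eta0|E F PE PF eta eta0|E F EF PE eta eta0].
- by apply: nearW => n; exists setT; split=> //; rewrite setCT measure0 lee_fin ltW.
- have e0 : 0 < eta / 2 by rewrite divr_gt0.
  apply: filterS2 (PE _ e0) (PF _ e0) => n [A [mA AE PA]] [B [mB BF PB]].
  exists (A `&` B); split; [exact: measurableI| |].
    by move=> w [/AE ? /BF ?].
  rewrite setCI (splitr eta) EFinD (le_trans _ (leeD PA PB))//.
  by apply: measureU2; exact: measurableC.
- by apply: filterS (PE _ eta0) => n [A [mA AE PA]]; exists A; split=> // w /AE/EF.
Qed.

Global Instance prob_filter_proper : ProperFilter prob_filter.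
Proof.
apply: Build_ProperFilter => F0.
have h0 : 0 < 2^-1 :> R by rewrite invr_gt0.
have [n [A [mA A0 PA]]] := filter_ex (F0 _ h0).
move: PA; rewrite (_ : A = set0) ?setC0 ?probability_setT; last by apply/seteqP; split.
by rewrite lee_fin leNgt invf_lt1 ?ltr1n.
Qed.

Definition along (X : forall n, T n -> R) (s : {n : nat & T n}) : R := X (projT1 s) (projT2 s).

(** Events whose probability tends to zero eventually do not happen. *)
Lemma prob_filter_not (E : forall n, set (T n)) : (forall n, measurable (E n)) ->
  P n (E n) @[n --> \oo] --> 0%E -> \forall s \near prob_filter, ~ E (projT1 s) (projT2 s).
Proof.
move=> mE PE eta eta0.
move: PE => /fine_cvgP[_ /cvgrPdist_le/(_ _ eta0)].
apply: filterS => n /=; rewrite sub0r normrN ger0_norm ?fine_ge0// -lee_fin fineK ?fin_num_measure// => PEn; exists (~` E n); split=> //; first exact: measurableC.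
by rewrite setCK.
Qed.

Lemma prob_filter_prob0 (E : forall n, set (T n)) : (forall n, measurable (E n)) ->
  (\forall s \near prob_filter, ~ E (projT1 s) (projT2 s)) -> P n (E n) @[n --> \oo] --> 0%E.
Proof.
move=> mE NE; apply/fine_cvgP; split.
  by apply: nearW => n; rewrite fin_num_measure.
apply/cvgrPdist_le => e e0.
apply: filterS (NE e e0) => n [A [mA AE PA]].
rewrite sub0r normrN ger0_norm ?fine_ge0//= -lee_fin fineK ?fin_num_measure//.
apply: le_trans PA; apply: le_measure; rewrite ?inE//; first exact: measurableC.
by move=> w Ew /AE.
Qed.

Definition tight (Y : forall n, T n -> R) := forall eta : R, 0 < eta -> exists K : R,
  \forall n \near \oo, exists A : set (T n),
    [/\ measurable A, forall w, A w -> `|Y n w| <= K & (P n (~` A) <= eta%:E)%E].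

(** A vanishing factor times a bounded one, both in probability. *)
Lemma cvg0_tight (c : {n : nat & T n} -> R) (Y : forall n, T n -> R) :
  c @ prob_filter --> 0 -> tight Y -> (fun s => c s * along Y s) @ prob_filter --> 0.
Proof.
move=> c0 tY; apply/cvgrPdist_lt => e e0 eta eta0.
have h0 : 0 < eta / 2 by rewrite divr_gt0.
have [K YK] := tY _ h0.
have K0 : 0 < `|K| + 1 by rewrite ltr_wpDl.
have q0 : 0 < e / (`|K| + 1) by rewrite divr_gt0.
have /cvgrPdist_lt/(_ _ q0)/(_ _ h0) cK := c0.
apply: filterS2 YK cK => n [A [mA AY PA]] [B [mB Bc PB]].
exists (A `&` B); split; [exact: measurableI| |].
  move=> w [/AY Yw /Bc]; rewrite !sub0r !normrN => cw; rewrite normrM.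
  move: cw; rewrite ltr_pdivlMr//; apply: le_lt_trans.
  by rewrite ler_wpM2l// (le_trans Yw)// (le_trans (ler_norm K))// lerDl.
rewrite setCI (splitr eta) EFinD (le_trans _ (leeD PA PB))//.
by apply: measureU2; exact: measurableC.
Qed.

End prob_filter.

(** The truncations [ramp K e x], equal to [0] for [|x| <= K] and to [1] for
    [|x| >= K + e], turn weak convergence into bounds on tail probabilities. *)
Section ramp.
Context {R : realType}.

Definition ramp (K e x : R) : R := Num.min 1 (Num.max 0 ((`|x| - K) / e)).

Lemma ramp_ge0 K e x : 0 <= ramp K e x.
Proof. by rewrite /ramp le_min ler01 le_max lexx. Qed.

Lemma ramp_le1 K e x : ramp K e x <= 1.
Proof. by rewrite /ramp ge_min lexx. Qed.

Lemma ramp_eq0 K e x : 0 < e -> `|x| <= K -> ramp K e x = 0.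
Proof.
move=> e0 xK; rewrite /ramp (max_idPl _); first by rewrite (min_idPr _).
by rewrite pmulr_lle0 ?invr_gt0// subr_le0.
Qed.

Lemma ramp_eq1 K e x : 0 < e -> K + e <= `|x| -> ramp K e x = 1.
Proof.
move=> e0 xK; rewrite /ramp (min_idPl _)// le_max; apply/orP; right.
by rewrite ler_pdivlMr// mul1r lerBrDl.
Qed.

Lemma continuous_ramp K e : continuous (ramp K e).
Proof.
move=> x; rewrite /ramp.
apply: (@continuous_min _ _ (cst 1) (fun x => Num.max 0 ((`|x| - K) / e)) x); first exact: cvg_cst.
apply: (@continuous_max _ _ (cst 0) (fun x => (`|x| - K) / e) x); first exact: cvg_cst.
apply: cvgMl; apply: cvgB; last exact: cvg_cst.
exact: norm_continuous.
Qed.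

Lemma bounded_ramp (S : Type) K e (h : S -> R) : bounded_fun (ramp K e \o h).
Proof.
exists 1; split => // M M1 s _ /=.
by rewrite ger0_norm ?ramp_ge0// (le_trans (ramp_le1 _ _ _))// ltW.
Qed.

Lemma measurable_ramp d (T : measurableType d) K e (Y : T -> R) :
  measurable_fun setT Y -> measurable_fun setT (ramp K e \o Y).
Proof.
by move=> mY; apply: measurableT_comp => //; apply: continuous_measurable_fun; exact: continuous_ramp.
Qed.

Section tail.
Context d (T : measurableType d) (P : probability T R) (Y : T -> R).
Hypothesis mY : measurable_fun setT Y.

Let mnY : measurable_fun setT (fun w => `|Y w|).
Proof. exact: measurableT_comp. Qed.

Let mcst (x : R) : measurable_fun [set: T] (cst x). Proof. by []. Qed.

Lemma measurable_le_norm K : measurable [set w | K <= `|Y w|].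
Proof.
have := measurable_fun_ler (mcst K) mnY measurableT (Y := [set true]) I.
by rewrite setTI; congr measurable.
Qed.

Lemma measurable_lt_norm K : measurable [set w | K < `|Y w|].
Proof.
have := measurable_fun_ltr (mcst K) mnY measurableT (Y := [set true]) I.
by rewrite setTI; congr measurable.
Qed.

Lemma tail_le_ramp K e : 0 < e -> (P [set w | (K + e <= `|Y w|)%R] <= 'E_P[ramp K e \o Y])%E.
Proof.
move=> e0; have mA := measurable_le_norm (K + e).
rewrite -expectation_indic//; apply: expectation_le => //.
- exact: measurable_ramp.
- by move=> w; rewrite /= ramp_ge0.
- apply: aeW => w; rewrite indicE /=; case: (boolP (w \in _)) => [/set_mem/= h|_].
    by rewrite ramp_eq1.
  exact: ramp_ge0.
Qed.

Lemma ramp_le_tail K e : 0 < e -> ('E_P[ramp K e \o Y] <= P [set w | (K < `|Y w|)%R])%E.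
Proof.
move=> e0; have mA := measurable_lt_norm K.
rewrite -expectation_indic//; apply: expectation_le => //.
- exact: measurable_ramp.
- by move=> w; rewrite /= ramp_ge0.
- apply: aeW => w; rewrite indicE /=; case: (boolP (w \in _)) => [_|/negP h].
    exact: ramp_le1.
  by rewrite ramp_eq0// leNgt; apply/negP => Kw; apply: h; exact: mem_set.
Qed.

End tail.

End ramp.

Section weak_to_prob.
Context {R : realType} {d : nat -> measure_display}
  {T : forall n, measurableType (d n)} (P : forall n, probability (T n) R)
  d' (T' : measurableType d') (Q : probability T' R).

(** The indicator of [e <= `|X - c|] lies below a ramp that vanishes at [c]. *)
Lemma cvg_prob_of_weak (X : forall n, T n -> R) (c : R) :
  (forall n, measurable_fun setT (X n)) -> weak_cvg P X Q (cst c) ->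
  along X @ prob_filter P --> c.
Proof.
move=> mX XQ; apply/cvgrPdist_lt => e e0.
pose E n := [set w | e <= `|X n w - c|].
have mXc n : measurable_fun setT (fun w => X n w - c) by exact: measurable_funB.
have e20 : 0 < e / 2 by rewrite divr_gt0.
have NE : \forall s \near prob_filter P, ~ E (projT1 s) (projT2 s).
  apply: prob_filter_not => [n|]; first exact: measurable_le_norm.
  have cg : continuous (fun x => ramp (e / 2) (e / 2) (x - c)).
    move=> x; apply: (@continuous_comp _ _ _ (fun x => x - c)); last exact: continuous_ramp.
    by apply: cvgB => //; exact: cvg_cst.
  have bg : bounded_fun (fun x => ramp (e / 2) (e / 2) (x - c)) by exact: bounded_ramp.
  have := XQ _ cg bg.
  rewrite (_ : _ \o cst c = cst 0); last first.
    by apply/funext => w /=; rewrite subrr ramp_eq0// normr0 ltW.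
  rewrite expectation_cst => h.
  apply: (squeeze_cvge _ _ h); last exact: cvg_cst.
  apply: nearW => n; rewrite measure_ge0/=.
  have := tail_le_ramp (P n) (mXc n) (e / 2) e20.
  by rewrite -splitr.
near=> s; have : ~ E (projT1 s) (projT2 s) by near: s.
by move=> /negP; rewrite -ltNge distrC.
Unshelve. all: by end_near.
Qed.

(** A ramp that starts far enough has small expectation in the limit, hence
    eventually along the sequence. *)
Lemma tight_of_weak (S : topologicalType) (V : forall n, T n -> S) (V' : T' -> S) (h : S -> R) :
  continuous h -> (forall n, measurable_fun setT (h \o V n)) ->
  measurable_fun setT (h \o V') -> weak_cvg P V Q V' -> tight P (fun n => h \o V n).
Proof.
move=> ch mV mV' VQ eta eta0.
have h0 : 0 < eta / 2 by rewrite divr_gt0.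
pose F i := [set w | i%:R < `|h (V' w)|].
have mF i : measurable (F i) by exact: measurable_lt_norm.
have F0 : \bigcap_i F i = set0.
  apply/seteqP; split=> // w /= Fw; have := Fw (Num.truncn `|h (V' w)|).+1 I.
  by rewrite /F/= ltNge ltW// truncnS_gt.
have cF : Q \o F @ \oo --> Q (\bigcap_i F i).
  apply: nonincreasing_cvg_mu => //; first by rewrite (le_lt_trans (probability_le1 _ _))// ltry.
    by rewrite F0.
  move=> i j ij; rewrite subsetEset => w; rewrite /F/=; apply: le_lt_trans.
  by rewrite ler_nat.
move: cF; rewrite F0 measure0 => /fine_cvgP[_ /cvgrPdist_lt/(_ _ h0)].
case=> i _ /(_ i (leqnn i)); rewrite /= sub0r normrN ger0_norm ?fine_ge0// => Fi.
pose g := ramp i%:R 1 \o h.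
have cg : continuous g.
  by move=> x; apply: continuous_comp; [exact: ch|exact: continuous_ramp].
have bg : bounded_fun g by exact: bounded_ramp.
have Vg := VQ g cg bg.
have EQ : ('E_Q[g \o V'] < eta%:E)%E.
  have := ramp_le_tail Q mV' i%:R ltr01; rewrite -compA => /le_lt_trans; apply.
  have {}Fi : (Q (F i) < (eta / 2)%:E)%E by rewrite -[ltLHS]fineK ?fin_num_measure// lte_fin.
  apply: (lt_trans Fi); rewrite lte_fin.
  by rewrite ltr_pdivrMr// ltr_pMr// ltr1n.
exists (i%:R + 1).
have : \forall n \near \oo, ('E_(P n)[g \o V n] < eta%:E)%E by exact: Vg _ (open_ereal_lt' EQ).
apply: filterS => n /= En; exists (~` [set w | i%:R + 1 <= `|h (V n w)|]); split.
- by apply: measurableC; exact: (measurable_le_norm (mV n)).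
- by move=> w /= /negP; rewrite -ltNge => /ltW.
- rewrite setCK; apply: le_trans (ltW En).
  exact: (tail_le_ramp (P n) (mV n)).
Qed.

Lemma cvg_expectation_prob0 (D : forall n, T n -> R) (B : R) :
  (forall n, measurable_fun setT (D n)) -> (forall n w, `|D n w| <= B) ->
  along D @ prob_filter P --> 0 -> ('E_(P n)[D n] @[n --> \oo] --> 0)%E.
Proof.
move=> mD DB D0.
have E_le e n : 0 < e -> (`|'E_(P n)[D n]| <= e%:E + B%:E * P n [set w | (e <= `|D n w|)%R])%E.
  move=> e0; set A := [set w | _]; have mA : measurable A by exact: measurable_le_norm.
  have B0 : 0 <= B.
    have [w _] : exists w : T n, True.
      apply: contrapT => h; have := probability_setT (P n).
      rewrite (_ : setT = set0) ?measure0; last by apply/seteqP; split=> // w _; apply: h; exists w.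
      by move=> /eqP; rewrite eqe eq_sym oner_eq0.
    exact: le_trans (DB n w).
  rewrite unlock; apply: (le_trans (le_abse_integral _ _ _)) => //; first exact/measurable_EFinP.
  apply: (@le_trans _ _ (\int[P n]_w (e%:E + B%:E * (\1_A w)%:E))%E).
    apply: ge0_le_integral => //.
    - by apply/measurable_EFinP; exact: measurableT_comp.
    - apply: emeasurable_funD => //; apply: emeasurable_funM => //.
      exact/measurable_EFinP/measurable_indic.
    move=> w _; rewrite indicE /= -EFinM -EFinD lee_fin; case: (boolP (w \in A)) => [_|/negP h].
      by rewrite mulr1 (le_trans (DB n w))// lerDr ltW.
    by rewrite mulr0 addr0 leNgt; apply/negP => /ltW Kw; apply: h; exact: mem_set.
  rewrite ge0_integralD//=; last 3 first.
  - by move=> w _; rewrite lee_fin ltW.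
  - by move=> w _; rewrite mule_ge0 ?lee_fin.
  - by apply: emeasurable_funM => //; exact/measurable_EFinP/measurable_indic.
  rewrite integral_cst//= probability_setT mule1 ge0_integralZl//; last exact/measurable_EFinP/measurable_indic.
  by rewrite integral_indic// setIT.
have P0 e : 0 < e -> P n [set w | (e <= `|D n w|)%R] @[n --> \oo] --> 0%E.
  move=> e0; apply: prob_filter_prob0 => [n|]; first exact: measurable_le_norm.
  have /cvgrPdist_lt/(_ _ e0) De := D0; near=> s => /=; apply/negP; rewrite -ltNge.
  have : `|0 - along D s| < e by near: s.
  by rewrite sub0r normrN.
have mE e n : measurable [set w | e <= `|D n w|] by exact: measurable_le_norm.
have fE n : 'E_(P n)[D n]%E \is a fin_num.
  rewrite fin_num_abs (le_lt_trans (E_le 1 n ltr01))// -[P n _]fineK ?fin_num_measure//.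
  by rewrite -EFinM -EFinD ltry.
apply/fine_cvgP; split; first exact: nearW.
apply/cvgrPdist_le => e e0; have e20 : 0 < e / 2 by rewrite divr_gt0.
have B0 : 0 < `|B| + 1 by rewrite ltr_wpDl.
have q0 : 0 < e / 2 / (`|B| + 1) by rewrite divr_gt0.
have /fine_cvgP[_ /cvgrPdist_le/(_ _ q0)] := P0 _ e20.
apply: filterS => n /=; rewrite !sub0r !normrN ger0_norm ?fine_ge0// => pn.
have := E_le _ n e20; rewrite -[P n _]fineK ?fin_num_measure// -[X in (`|X|)%E]fineK//.
rewrite -EFinM -EFinD abse_EFin lee_fin => /le_trans; apply.
rewrite [leRHS](splitr e) lerD2l (@le_trans _ _ ((`|B| + 1) * fine (P n [set w | e / 2 <= `|D n w|])))//.
  by rewrite ler_wpM2r ?fine_ge0// (le_trans (ler_norm B))// lerDl.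
by rewrite mulrC -ler_pdivlMr.
Unshelve. all: by end_near.
Qed.

End weak_to_prob.

(** Heine's theorem, with the second point free to leave the square. *)
Lemma continuous_near_square (R : realType) (g : R * R -> R) (K e : R) :
  continuous g -> 0 < e -> exists2 dl, 0 < dl & forall x y : R * R,
    `|y.1| <= K -> `|y.2| <= K -> `|x.1 - y.1| < dl -> `|x.2 - y.2| < dl -> `|g x - g y| < e.
Proof.
move=> cg e0; pose box : set (R * R) := `[- K, K]%classic `*` `[- K, K]%classic.
pose close dl (y : R * R) := forall x : R * R,
  `|x.1 - y.1| < dl -> `|x.2 - y.2| < dl -> `|g x - g y| < e.
have /compact_near_coveringP cbox : compact box by apply: compact_setX; exact: segment_compact.
have : \forall dl \near 0^'+, box `<=` close dl.
  apply: cbox => y _; have e20 : 0 < e / 2 by rewrite divr_gt0.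
  have /cvgrPdist_lt/(_ _ e20)/nbhs_ballP[r /= r0 yr] := cg y.
  have r20 : 0 < r / 2 by rewrite divr_gt0.
  exists (ball y (r / 2), [set dl | dl < r / 2]); first split => /=.
  - exact: nbhsx_ballx.
  - exact: nbhs_right_lt.
  move=> [y' dl] [/= yy' dlr] x x1 x2.
  have near1 : ball y r y' by apply: le_ball yy'; rewrite ler_pdivrMr// ler_pMr// ler1n.
  have near2 : ball y r x.
    rewrite (splitr r); apply: ball_triangle yy' _.
    split; rewrite /= -ball_normE/= distrC; exact: lt_trans dlr.
  rewrite (splitr e) -(subrKA (g y)) (le_lt_trans (ler_normD _ _))// ltrD//.
    by rewrite distrC; exact: yr near2.
  exact: yr near1.
move=> h; have [dl [dl0 hdl]] : exists dl, 0 < dl /\ box `<=` close dl.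
  apply: (@filter_ex _ (0^'+ : set_system R)); near=> dl; split; near: dl => //.
  exact: nbhs_right_gt.
exists dl => // x y y1 y2; apply: hdl.
by split; rewrite /= in_itv/= -ler_norml.
Unshelve. all: by end_near.
Qed.

Section slutsky.
Context {R : realType} {d : nat -> measure_display}
  {T : forall n, measurableType (d n)} (P : forall n, probability (T n) R).

Lemma cvg_prob_continuous (g : R * R -> R) (X1 X2 : {n : nat & T n} -> R)
    (Y1 Y2 : forall n, T n -> R) :
  continuous g -> tight P Y1 -> tight P Y2 ->
  (fun s => X1 s - along Y1 s) @ prob_filter P --> 0 ->
  (fun s => X2 s - along Y2 s) @ prob_filter P --> 0 ->
  (fun s => g (X1 s, X2 s) - g (along Y1 s, along Y2 s)) @ prob_filter P --> 0.
Proof.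
move=> cg t1 t2 c1 c2; apply/cvgrPdist_lt => e e0 eta eta0.
have h0 : 0 < eta / 2 by rewrite divr_gt0.
have h20 : 0 < eta / 2 / 2 by rewrite divr_gt0.
have [K1 K1P] := t1 _ h20; have [K2 K2P] := t2 _ h20.
have [dl dl0 gdl] := continuous_near_square (Num.max K1 K2) cg e0.
have /cvgrPdist_lt/(_ _ dl0) D1 := c1.
have /cvgrPdist_lt/(_ _ dl0) D2 := c2.
have D12 := @filterI _ _ (prob_filter_filter P) _ _ D1 D2; have {}D12 := D12 _ h0.
apply: filterS3 K1P K2P D12 => n [A [mA A1 PA]] [B [mB B1 PB]] [C [mC C1 PC]].
have mAB : measurable (A `&` B) by exact: measurableI.
exists (A `&` B `&` C); split; [exact: measurableI| |].
  move=> w [[/A1 w1 /B1 w2] /C1[]]; rewrite !sub0r !normrN => w3 w4.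
  by apply: gdl => //=; rewrite le_max ?w1 ?w2 ?orbT.
rewrite !setCI (splitr eta) EFinD (le_trans (measureU2 _ _ _))//; try exact: measurableC.
  by rewrite -setCI; exact: measurableC.
rewrite leeD// (splitr (eta / 2)) EFinD (le_trans (measureU2 _ _ _))//; try exact: measurableC.
by rewrite leeD.
Qed.

Lemma continuous_to_pair (S U V : topologicalType) (f : S -> U) (g : S -> V) :
  continuous f -> continuous g -> continuous (fun x => (f x, g x)).
Proof. by move=> cf cg x; apply: (cvg_pair (G := nbhs (f x)) (H := nbhs (g x))); [exact: cf|exact: cg]. Qed.

Lemma continuous_EFin_pair (g : \bar R * R -> R) :
  continuous g -> continuous (fun x : R * R => g (x.1%:E, x.2)).
Proof.
have cEFin : continuous (@EFin R) by move=> x; apply: cvg_EFin => //; exact: nearW.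
move=> cg x; apply: (@continuous_comp _ _ _ (fun x : R * R => (x.1%:E, x.2))); last exact: cg.
apply: continuous_to_pair => {}x; last exact: cvg_snd.
by apply: (@continuous_comp _ _ _ fst (@EFin R)); [exact: cvg_fst|exact: cEFin].
Qed.

Lemma Lfun1_bounded d' (T' : measurableType d') (Q : probability T' R) (f : T' -> R) (B : R) :
  measurable_fun setT f -> (forall w, `|f w| <= B) -> f \in Lfun Q 1.
Proof.
move=> mf fB; apply/Lfun1_integrable; apply: measurable_bounded_integrable => //.
  by rewrite (le_lt_trans (probability_le1 _ _))// ltry.
by exists B; split => [|M BM w _ /=]; rewrite ?num_real// (le_trans (fB w))// ltW.
Qed.

(** A perturbation of a weakly convergent sequence that vanishes in probability
    does not change the limit; the perturbed variable may take infinite values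
    with vanishing probability. *)
Lemma weak_cvg_slutsky d' (T' : measurableType d') (Q : probability T' R)
    (S : topologicalType) (V : forall n, T n -> S) (V' : T' -> S) (h1 h2 : S -> R)
    (U : forall n, T n -> \bar R * R) (X1 X2 : {n : nat & T n} -> R) :
  continuous h1 -> continuous h2 ->
  (forall n, measurable_fun setT (h1 \o V n)) -> (forall n, measurable_fun setT (h2 \o V n)) ->
  measurable_fun setT (h1 \o V') -> measurable_fun setT (h2 \o V') ->
  (forall n (g : \bar R * R -> R), continuous g -> measurable_fun setT (g \o U n)) ->
  (\forall s \near prob_filter P, U (projT1 s) (projT2 s) = ((X1 s)%:E, X2 s)) ->
  (fun s => X1 s - along (fun n => h1 \o V n) s) @ prob_filter P --> 0 ->
  (fun s => X2 s - along (fun n => h2 \o V n) s) @ prob_filter P --> 0 ->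
  weak_cvg P V Q V' -> weak_cvg P U Q (fun w => ((h1 (V' w))%:E, h2 (V' w))).
Proof.
move=> ch1 ch2 mh1 mh2 mh1' mh2' mU near_U X1h X2h VQ g cg [B [_ gB]].
have {}gB x : `|g x| <= B + 1 by apply: gB => //; rewrite ltrDl.
pose g' (x : R * R) := g (x.1%:E, x.2).
have cg' : continuous g' by exact: continuous_EFin_pair.
pose G u := g' (h1 u, h2 u).
have cG : continuous G.
  move=> u; apply: (@continuous_comp _ _ _ (fun u => (h1 u, h2 u))); last exact: cg'.
  exact: continuous_to_pair.
have bG : bounded_fun G by exists (B + 1); split => [|M BM u _]; [exact: num_real|apply: (le_trans (gB _)); exact: ltW].
have mG n : measurable_fun setT (G \o V n) by exact: measurable_continuous_pair.
pose D n w := g (U n w) - G (V n w).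
have mD n : measurable_fun setT (D n) by apply: measurable_funB; [exact: mU|exact: mG].
have ED n : ('E_(P n)[g \o U n] = 'E_(P n)[D n] + 'E_(P n)[G \o V n])%E.
  rewrite -expectationD; last 2 first.
  - apply: (@Lfun1_bounded _ _ _ _ (B + 1 + (B + 1))) => // w.
    by apply: (le_trans (ler_normB _ _)); apply: lerD; exact: gB.
  - by apply: (@Lfun1_bounded _ _ _ _ (B + 1)) => // w; exact: gB.
  by congr ('E_(P n)[_])%E; apply/funext => w /=; rewrite subrK.
under eq_fun do rewrite ED.
rewrite (_ : ('E_Q[_])%E = (0 + 'E_Q[G \o V'])%E); last by rewrite add0e.
apply: cvgeD.
- by rewrite fin_num_adde_defr.
- apply: (@cvg_expectation_prob0 _ _ _ P D (B + 1 + (B + 1))) => //.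
    by move=> n w; apply: (le_trans (ler_normB _ _)); apply: lerD; exact: gB.
  have := cvg_prob_continuous cg' (tight_of_weak ch1 mh1 mh1' VQ) (tight_of_weak ch2 mh2 mh2' VQ) X1h X2h.
  apply: cvg_trans; apply: near_eq_cvg; near=> s.
  rewrite /along/D/= (_ : U _ _ = ((X1 s)%:E, X2 s))//; by near: s.
- exact: VQ.
Unshelve. all: by end_near.
Qed.

End slutsky.

(** * Linearization of the estimator *)

Section linearization.
Context {R : realType} (I : Type) (F : set_system I) {FF : ProperFilter F}.
Variables (k : I -> nat) (z : forall i, (k i).-tuple (R * R)) (sigma : I -> R).
Hypotheses (k_gt0 : forall i, (0 < k i)%N) (sigma_gt0 : forall i, 0 < sigma i).
Hypothesis z_gt0 : forall i p, p \in (z i : seq (R * R)) -> 0 < p.2 <= p.1.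
Variables (a l dl llo lhi : R) (s : nat -> R).
Hypotheses (a_gt0 : 0 < a) (s0_gt0 : 0 < s 0) (dl_gt0 : 0 < dl).

Local Notation S m x i := (power_mean (z i) (sigma i) m x).

Hypothesis cvg_S : forall m, (m <= 2)%N -> S m a i @[i --> F] --> s m.
Hypothesis cvg_lo : S 0 (a - 2 * dl) i @[i --> F] --> llo.
Hypothesis cvg_hi : S 0 (a + 2 * dl) i @[i --> F] --> lhi.
Hypothesis cvg_L : log_mean (z i) (sigma i) @[i --> F] --> l.
Hypothesis root_limit : 2 / a + 2 * s 1 / s 0 = l.
Hypothesis near_nonconstant : \forall i \near F, ~~ constant (z i).

(** Locally uniform convergence, from a bound on the next derivative. *)
Lemma cvg_power_mean m (x : I -> R) : (m <= 2)%N -> x i @[i --> F] --> a ->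
  S m (x i) i @[i --> F] --> s m.
Proof.
move=> m2 xa.
have [C C0 hC] : exists2 C : R, 0 < C & forall i y, `|y - a| <= dl ->
    `|S m.+1 y i| <= C * (S 0 (a - 2 * dl) i + S 0 (a + 2 * dl) i).
  have [C C0 hC] := @normr_ln_powR_le R m.+1 dl dl_gt0.
  exists (2 * C) => [|i y]; first by rewrite mulr_gt0.
  exact: (power_mean_bound (k_gt0 i) (sigma_gt0 i) (z_gt0 (i := i))).
have near_x : \forall i \near F, 0 < x i /\ `|x i - a| <= dl.
  have h1 : \forall i \near F, 0 < x i by exact: (cvgr_gt a xa).
  have h2 : \forall i \near F, `|a - x i| <= dl by move/cvgrPdist_le: xa => /(_ _ dl_gt0).
  by apply: filterS2 h1 h2 => i; rewrite distrC.
have bound : \forall i \near F, `|S m (x i) i - S m a i| <=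
    C * (S 0 (a - 2 * dl) i + S 0 (a + 2 * dl) i) * `|x i - a|.
  near=> i; have [x0 xdl] : 0 < x i /\ `|x i - a| <= dl by near: i.
  have dS (y : R) : 0 < y -> is_derive y 1 (fun t => S m t i) (- S m.+1 y i).
    by move=> _; exact: is_derive_power_mean (z_gt0 (i := i)) _ _.
  have [c [cx ->]] := MVT_between dS a_gt0 x0.
  by rewrite normrM normrN ler_wpM2r// hC// (le_trans cx).
have b0 : C * (S 0 (a - 2 * dl) i + S 0 (a + 2 * dl) i) * `|x i - a| @[i --> F] --> 0.
  rewrite -[X in _ --> X](_ : C * (llo + lhi) * `|a - a| = 0); last by rewrite subrr normr0 mulr0.
  apply: cvgM; first by apply: cvgMr; apply: cvgD.
  by apply: cvg_norm; apply: cvgB => //; exact: cvg_cst.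
have d0 : S m (x i) i - S m a i @[i --> F] --> 0.
  apply: norm_cvg0; apply: (squeeze_cvgr _ (cvg_cst 0) b0).
  by near=> i; rewrite normr_ge0/=; near: i.
rewrite -[X in _ --> X](add0r (s m)) (_ : (fun i => S m (x i) i) =
  (fun i => (S m (x i) i - S m a i) + S m a i)).
  by apply: cvgD => //; exact: cvg_S.
by apply/funext => i; rewrite subrK.
Unshelve. all: by end_near.
Qed.

Definition dscore_limit : R := - (2 / a ^+ 2) - 2 * ((s 2 * s 0 - s 1 ^+ 2) / s 0 ^+ 2).
Definition dscale_limit : R := (2 / s 0) `^ a^-1 * (s 1 / (s 0 * a) - ln (2 / s 0) / a ^+ 2).
(** Derivative of [x |-> (2 / x) `^ a^-1] at [s 0]. *)
Definition level_slope : R := - ((2 / s 0) `^ a^-1 / (a * s 0)).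

Lemma cvg_dscore (x : I -> R) : x i @[i --> F] --> a ->
  dscore (z i) (sigma i) (x i) @[i --> F] --> dscore_limit.
Proof.
move=> xa; have cS m (m2 : (m <= 2)%N) := cvg_power_mean m2 xa.
rewrite /dscore.
apply: cvgB.
  apply: cvgN; apply: cvgM; first exact: cvg_cst.
  apply: cvgV; first by rewrite expf_neq0// gt_eqF.
  by rewrite expr2; under eq_fun do rewrite expr2; exact: cvgM.
apply: cvgM; first exact: cvg_cst.
apply: cvgM.
  apply: cvgB; first by apply: cvgM; exact: cS.
  by rewrite expr2; under eq_fun do rewrite expr2; apply: cvgM; exact: cS.
apply: cvgV; first by rewrite expf_neq0// gt_eqF.
by rewrite expr2; under eq_fun do rewrite expr2; apply: cvgM; exact: cS.
Qed.

(** The bound [- 2 / x ^ 2] on the derivative of the score passes to the limit. *)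
Lemma dscore_limit_lt0 : dscore_limit < 0.
Proof.
apply: (@le_lt_trans _ _ (- (2 / a ^+ 2))); last first.
  by rewrite oppr_lt0 divr_gt0// exprn_gt0.
rewrite leNgt; apply/negP => aD.
have [i] := filter_ex (cvgr_gt _ (cvg_dscore (cvg_cst a)) _ aD).
apply/negP; rewrite -leNgt /dscore gerDl oppr_le0 mulr_ge0// divr_ge0 ?sqr_ge0//.
rewrite subr_ge0; exact: (power_mean_cauchy_schwarz (k_gt0 i) (sigma_gt0 i) (z_gt0 (i := i))).
Qed.

Lemma cvg_dscale (x : I -> R) : x i @[i --> F] --> a ->
  dscale (z i) (sigma i) (x i) @[i --> F] --> dscale_limit.
Proof.
move=> xa; have cS m (m2 : (m <= 2)%N) := cvg_power_mean m2 xa.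
have an0 : a != 0 by rewrite gt_eqF.
have sn0 : s 0 != 0 by rewrite gt_eqF.
have cq : 2 / S 0 (x i) i @[i --> F] --> 2 / s 0.
  by apply: cvgM; [exact: cvg_cst|apply: cvgV => //; exact: cS].
have cl : ln (2 / S 0 (x i) i) @[i --> F] --> ln (2 / s 0).
  by apply: (cvg_comp _ _ cq); apply: continuous_ln; rewrite divr_gt0.
have ci : (x i)^-1 @[i --> F] --> a^-1 by exact: cvgV.
rewrite /dscale /dscale_limit; apply: cvgM.
  have powE u w : 0 < u -> u `^ w = expR (w * ln u) by move=> u0; rewrite /powR gt_eqF.
  rewrite powE ?divr_gt0// (_ : (fun i => (2 / S 0 (x i) i) `^ (x i)^-1) =
      (fun i => expR ((x i)^-1 * ln (2 / S 0 (x i) i)))); last first.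
    apply/funext => i; rewrite powE// divr_gt0//.
    exact: (power_mean0_gt0 (k_gt0 i) (sigma_gt0 i) (z_gt0 (i := i))).
  have cil : (x i)^-1 * ln (2 / S 0 (x i) i) @[i --> F] --> a^-1 * ln (2 / s 0) by exact: cvgM.
  by apply: (cvg_comp _ _ cil); exact: continuous_expR.
apply: cvgB; apply: cvgM => //; first exact: cS.
  by apply: cvgV; [rewrite mulf_neq0|apply: cvgM => //; exact: cS].
apply: cvgV; first by rewrite expf_neq0.
by rewrite expr2; under eq_fun do rewrite expr2; exact: cvgM.
Qed.

(** The three deviations enter exactly, with random coefficients: solving the
    expanded score equation for [ah - a] and inserting the result in the expansion
    of the scale leaves no remainder term. *)
Lemma mle_linearization : exists ah q0 q1 q2 r0 r1 r2 : I -> R,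
  [/\ \forall i \near F, [/\ alpha_hat (z i) = (ah i)%:E,
      ah i - a = q0 i * (S 1 a i - s 1) + q1 i * (S 0 a i - s 0)
                 + q2 i * (log_mean (z i) (sigma i) - l) &
      sigma_hat (z i) / sigma i - (2 / s 0) `^ a^-1 =
        r0 i * (S 1 a i - s 1) + r1 i * (S 0 a i - s 0)
                 + r2 i * (log_mean (z i) (sigma i) - l)],
   [/\ q0 @ F --> - 2 / (s 0 * dscore_limit), q1 @ F --> 2 * s 1 / (s 0 ^+ 2 * dscore_limit) &
       q2 @ F --> dscore_limit^-1] &
   [/\ r0 @ F --> dscale_limit * (- 2 / (s 0 * dscore_limit)),
       r1 @ F --> dscale_limit * (2 * s 1 / (s 0 ^+ 2 * dscore_limit)) + level_slope &
       r2 @ F --> dscale_limit * dscore_limit^-1]].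
Proof.
have S0_gt0 i x : 0 < S 0 x i by exact: (power_mean0_gt0 (k_gt0 i) (sigma_gt0 i) (z_gt0 (i := i))).
have sn0 : s 0 != 0 by rewrite gt_eqF.
have Dn0 : dscore_limit != 0 by rewrite lt_eqF// dscore_limit_lt0.
have cS m (m2 : (m <= 2)%N) := cvg_S m2.
have c_score : score (z i) (sigma i) a @[i --> F] --> 0.
  rewrite -[X in _ --> X](_ : 2 / a + 2 * s 1 / s 0 - l = 0); last by rewrite root_limit subrr.
  apply: cvgB => //; apply: cvgD; first exact: cvg_cst.
  apply: cvgM; last by apply: cvgV => //; exact: cS.
  by apply: cvgM; [exact: cvg_cst|exact: cS].
pose good i := ~~ constant (z i) /\ `|score (z i) (sigma i) a| < a^-1.
have near_good : \forall i \near F, good i.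
  have ai : 0 < a^-1 by rewrite invr_gt0.
  have /cvgrPdist_lt/(_ _ ai) h := c_score.
  by apply: filterS2 near_nonconstant h => i nc; rewrite sub0r normrN.
have exp_ex i : exists t : R * R * R, good i ->
    [/\ alpha_hat (z i) = t.1.1%:E,
      [/\ `|t.1.1 - a| <= a ^+ 2 * `|score (z i) (sigma i) a|,
          `|t.1.2 - a| <= `|t.1.1 - a| & `|t.2 - a| <= `|t.1.1 - a|],
      score (z i) (sigma i) a = - dscore (z i) (sigma i) t.1.2 * (t.1.1 - a) &
      sigma_hat (z i) / sigma i = (2 / S 0 a i) `^ a^-1 +
        dscale (z i) (sigma i) t.2 * (t.1.1 - a)].
  have [[nc sa]|ng] := pselect (good i); last by exists (0, 0, 0) => /ng.
  have [t [x1 [x2 h]]] := mle_expansion (k_gt0 i) (sigma_gt0 i) (z_gt0 (i := i)) nc a_gt0 sa.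
  by exists (t, x1, x2).
have [f fP] := choice exp_ex.
have [h hP] := @choice I R (fun i c => `|c - s 0| <= `|S 0 a i - s 0| /\
    (2 / S 0 a i) `^ a^-1 - (2 / s 0) `^ a^-1 = - ((2 / c) `^ a^-1 / (a * c)) * (S 0 a i - s 0))
  (fun i => MVT_between (fun x => @is_derive_root2 R a x) s0_gt0 (S0_gt0 i a)).
have close (u w : I -> R) c : (\forall i \near F, `|u i - c| <= w i) -> w @ F --> 0 -> u @ F --> c.
  move=> uw w0; rewrite -[X in _ --> X](add0r c) (_ : u = (fun i => u i - c + c)).
    apply: cvgD; last exact: cvg_cst.
    apply: norm_cvg0; apply: (squeeze_cvgr _ (cvg_cst 0) w0).
    by apply: filterS uw => i ?; rewrite normr_ge0.
  by apply/funext => i; rewrite subrK.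
have c_bound : a ^+ 2 * `|score (z i) (sigma i) a| @[i --> F] --> 0.
  rewrite -[X in _ --> X](_ : a ^+ 2 * `|0 : R| = 0); last by rewrite normr0 mulr0.
  by apply: cvgM; [exact: cvg_cst|exact: cvg_norm].
pose ah i := (f i).1.1; pose x1 i := (f i).1.2; pose x2 i := (f i).2.
have c_x1 : x1 @ F --> a.
  apply: (close _ _ _ _ c_bound); apply: filterS near_good => i /fP[_ [h1 h2 _] _ _]; exact: le_trans h1.
have c_x2 : x2 @ F --> a.
  apply: (close _ _ _ _ c_bound); apply: filterS near_good => i /fP[_ [h1 _ h2] _ _]; exact: le_trans h1.
have c_h : h @ F --> s 0.
  apply: (close _ (fun i => `|S 0 a i - s 0|)); first by apply: nearW => i; have [] := hP i.
  rewrite -[X in _ --> X](_ : `|s 0 - s 0| = 0); last by rewrite subrr normr0.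
  by apply: cvg_norm; apply: cvgB; [exact: cS|exact: cvg_cst].
pose ds i := dscore (z i) (sigma i) (x1 i); pose dc i := dscale (z i) (sigma i) (x2 i).
have c_ds : ds @ F --> dscore_limit by exact: cvg_dscore.
have c_dc : dc @ F --> dscale_limit by exact: cvg_dscale.
pose sl i := - ((2 / h i) `^ a^-1 / (a * h i)).
have c_sl : sl @ F --> level_slope.
  apply: cvgN; apply: cvgM.
    apply: (cvg_comp (fun i => 2 / h i) (fun u => u `^ a^-1) (G := nbhs (2 / s 0))).
      by apply: cvgM; [exact: cvg_cst|exact: cvgV].
    by apply: continuous_powR_pos; rewrite divr_gt0.
  apply: cvgV; first by rewrite mulf_neq0// gt_eqF.
  by apply: cvgM => //; exact: cvg_cst.
pose q0 i := - 2 / (S 0 a i * ds i); pose q1 i := 2 * s 1 / (S 0 a i * s 0 * ds i).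
pose q2 i := (ds i)^-1.
have c_q0 : q0 @ F --> - 2 / (s 0 * dscore_limit).
  apply: cvgM; first exact: cvg_cst.
  by apply: cvgV; [rewrite mulf_neq0|apply: cvgM => //; exact: cS].
have c_q1 : q1 @ F --> 2 * s 1 / (s 0 ^+ 2 * dscore_limit).
  apply: cvgM; first exact: cvg_cst.
  apply: cvgV; first by rewrite mulf_neq0// expf_neq0.
  by rewrite expr2; apply: cvgM => //; apply: cvgM; [exact: cS|exact: cvg_cst].
have c_q2 : q2 @ F --> dscore_limit^-1 by exact: cvgV.
exists ah, q0, q1, q2, (fun i => dc i * q0 i), (fun i => dc i * q1 i + sl i), (fun i => dc i * q2 i).
split; last 2 first.
- by [].
- by split; [exact: cvgM|apply: cvgD => //; exact: cvgM|exact: cvgM].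
have near_ds : \forall i \near F, ds i < 0 by exact: (cvgr_lt _ c_ds _ dscore_limit_lt0).
apply: filterS2 near_good near_ds => i /fP[ahE _ e1 e2] ds0.
have dsn0 : ds i != 0 by rewrite lt_eqF.
have Sn0 : S 0 a i != 0 by rewrite gt_eqF.
have ahE' : ah i - a = q0 i * (S 1 a i - s 1) + q1 i * (S 0 a i - s 0)
                 + q2 i * (log_mean (z i) (sigma i) - l).
  have -> : ah i - a = - score (z i) (sigma i) a / ds i by rewrite e1 -/(x1 i) -/(ds i) -/(ah i); move: (ds i) (ah i) dsn0 => u w un0; field.
  rewrite /score -root_limit /q0 /q1 /q2.
  move: (S 0 a i) (S 1 a i) (ds i) (log_mean _ _) (s 0) (s 1) Sn0 dsn0 sn0 => S0 S1 ds' L s0 s1 Sn0' dsn0' sn0'.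
  by field; rewrite Sn0' dsn0' sn0' gt_eqF.
split=> //.
have [_ e3] := hP i.
rewrite e2 addrAC e3 -/(sl i) -/(dc i) -/(ah i) ahE'; ring.
Qed.

End linearization.

(** * Weak limit of the estimation error *)

Lemma sum_ord4 (V : nmodType) (G : 'I_4 -> V) : \sum_l G l = G 0 + G 1 + G 2 + G 3.
Proof.
rewrite !big_ord_recl big_ord0 addr0 !addrA.
by congr (_ + G _ + G _ + G _); apply/val_inj.
Qed.

Section limit_constants.
Context {R : realType}.
Variables (r alpha0 : R).
Hypotheses (r01 : 0 <= r <= 1) (alpha0_gt0 : 0 < alpha0) (varpi_gt0 : 0 < varpi r).

Let alpha1 := varpi r * alpha0.

(** Limits of the power means at [alpha1]. *)
Definition moment m : R := (- alpha0^-1) ^+ m * Upsilon_der m r (varpi r).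

Lemma moment0 : moment 0 = Upsilon r (varpi r).
Proof. by rewrite /moment expr0 mul1r UpsilonE. Qed.

Lemma moment0_gt0 : 0 < moment 0.
Proof. by rewrite moment0 UpsilonE Upsilon_gt0// ltW. Qed.

(** [varpi r] is defined so that the limit of the score vanishes at [alpha1]. *)
Lemma score_limit_root : 2 / alpha1 + 2 * moment 1 / moment 0 =
  euler_gamma / alpha0 + (euler_gamma - r) / alpha0.
Proof.
have := Pi_varpi varpi_gt0; rewrite PiE//.
have U0 := moment0_gt0; rewrite /moment expr0 mul1r in U0.
rewrite /moment expr0 expr1 mul1r /alpha1.
move: (Upsilon_der 0 r _) (Upsilon_der 1 r _) U0 => U U' U0 h.
have vn0 : varpi r != 0 by rewrite gt_eqF.
have an0 : alpha0 != 0 by rewrite gt_eqF.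
have Un0 : U != 0 by rewrite gt_eqF.
have -> : euler_gamma = (varpi r)^-1 - U' / U + r / 2 :> R.
  by move: h; move: (U' / U) (varpi r)^-1 euler_gamma => *; lra.
by field; rewrite vn0 an0 Un0.
Qed.

Let D := dscore_limit alpha1 moment.
Let g := dscale_limit alpha1 moment.

(** The limits of the coefficients in [mle_linearization]; the two last columns agree
    because the means of [ln y] and [ln x] enter through their sum. *)
Lemma M_entries (j : 'I_2) (l : 'I_4) : M r alpha0 j l =
  (nth [::] [:: [:: - 2 / (moment 0 * D); 2 * moment 1 / (moment 0 ^+ 2 * D); D^-1; D^-1];
    [:: g * (- 2 / (moment 0 * D)); g * (2 * moment 1 / (moment 0 ^+ 2 * D)) + level_slope alpha1 moment;
        g * D^-1; g * D^-1]] j)`_l.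
Proof.
have U0 := moment0_gt0; rewrite /moment expr0 mul1r in U0.
rewrite /M mxE derive1_Upsilon ?(ltW varpi_gt0)// derive2_Upsilon// UpsilonE -/alpha1.
set z0 := _ / 2.
have z00 : 0 < z0 by rewrite divr_gt0.
have a10 : 0 < alpha1 by rewrite mulr_gt0.
have q0 : 2 / Upsilon_der 0 r (varpi r) = z0^-1 by rewrite /z0 invf_div.
have powz : z0 `^ (- alpha1^-1) = (z0^-1) `^ alpha1^-1.
  by rewrite -(powR_inv1 (ltW z00)) -powRrM mulN1r.
have powz1 : z0 `^ (- alpha1^-1 - 1) = (z0^-1) `^ alpha1^-1 / z0.
  by rewrite powRD ?(gt_eqF z00) ?implybT// powz (powR_inv1 (ltW z00)).
have lnz : ln z0 = - ln z0^-1 by rewrite lnV ?posrE// opprK.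
rewrite powz powz1 lnz /g /D /level_slope /dscale_limit /dscore_limit /moment !expr0 !mul1r q0.
have -> : z0 = Upsilon_der 0 r (varpi r) / 2 by [].
move: (ln _) (_ `^ _) => lz pz; clear z0 z00 q0 powz powz1 lnz.
have a1n0 : alpha1 != 0 by rewrite gt_eqF.
have a0n0 : alpha0 != 0 by rewrite gt_eqF.
have Un0 : Upsilon_der 0 r (varpi r) != 0 by rewrite gt_eqF.
clear D g a10 U0 r01; move: alpha1 (Upsilon_der 0 r _) (Upsilon_der 1 r _) (Upsilon_der 2 r _) a1n0 Un0.
move=> a U U' U'' an0 Un0; rewrite expr1.
set D := - (2 / a ^+ 2) - 2 * ((U'' * U - _) / _).
have -> : - (2 / a ^+ 2) - 2 * (((- alpha0^-1) ^+ 2 * U'' * U - (- alpha0^-1 * U') ^+ 2) / U ^+ 2) = D.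
  by rewrite /D; field; rewrite an0 Un0 a0n0.
rewrite !(invfM _ D); move: D^-1 => Di.
case: j => -[|[|//]] ? /=; case: l => -[|[|[|[|//]]]] ? //=; field; by rewrite ?an0 ?Un0 ?a0n0.
Qed.

End limit_constants.

Theorem theorem3p8 (R : realType)
    (d : nat -> measure_display) (T : forall n, measurableType (d n))
    (P : forall n, probability (T n) R)
    (k : nat -> nat) (Z : forall n, 'I_(k n) -> {RV (P n) >-> (R * R)%type})
    (rho : R -> R) (alpha0 alpha1 alpham alphap : R) (sigma v : nat -> R)
    (H : probability (R * R)%type R)
    (dW : measure_display) (TW : measurableType dW) (Q : probability TW R)
    (W : 'I_4 -> {RV Q >-> R}) :
  let Zn n (w : T n) : (k n).-tuple (R * R) := [tuple Z n i w | i < k n] in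
  let Wn n (w : T n) : 'cV[R]_4 :=
    \col_i emp_process (Zn n w) (sigma n) (v n) H (fvec alpha1 i) in
  let Wlim (w : TW) : 'cV[R]_4 := \col_i W i w in
  let s1 := (2 / Upsilon (rho 0) (varpi (rho 0))) `^ alpha1^-1 in
  let err n (w : T n) :=
    est_error (Zn n w) (sigma n) (v n) alpha1 s1 in
  (forall n, (2 <= k n)%N) ->
  k @ \oo --> \oo ->
  (forall n i w, 0 < (Z n i w).2 <= (Z n i w).1) ->
  P n [set w | forall i j, Z n i w = Z n j w] @[n --> \oo] --> 0%E ->
  class_C rho ->
  0 < alpha0 ->
  (forall n, 0 < sigma n) ->
  alpha1 = varpi (rho 0) * alpha0 ->
  0 < alpham -> alpham < alpha1 -> alpha1 < alphap ->
  is_FW H rho alpha0 1 ->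
  (forall f : R * R -> R, F2 alpham alphap f ->
     weak_cvg P (fun n w => emp_mean (Zn n w) (sigma n) f)
              Q (cst (\int[H]_(p in quadrant) f p))) ->
  (forall n, 0 < v n) ->
  v @ \oo --> +oo ->
  weak_cvg P Wn Q Wlim ->
  [/\ o_prob1 P (fun n w =>
        sub_pair (err n w) (ext_pair (M (rho 0) alpha0 *m Wn n w))),
      weak_cvg P err Q (fun w => ext_pair (M (rho 0) alpha0 *m Wlim w)) &
      rho 0 = 1 ->
        [/\ {in `[0, 1], forall eta, rho eta = 1 - eta},
            alpha1 = alpha0 & M 1 alpha0 = M1 alpha0]].
Proof.
move=> Zn Wn Wlim s1 err k2 k_oo Z_gt0 nonconst C alpha0_gt0 sigma_gt0 alpha1E
  alpham_gt0 alpham1 alphap1 HFW Z_lln v_gt0 v_oo W_cvg.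
set r := rho 0 in alpha1E s1 err *.
have alpha1_gt0 : 0 < alpha1 by exact: lt_trans alpham1.
have varpi_gt0 : 0 < varpi r by rewrite alpha1E pmulr_lgt0 in alpha1_gt0.
have r01 : 0 <= r <= 1 by exact: class_C_rho0.
have k_gt0 n : (0 < k n)%N by exact: leq_trans (k2 n).
have Zn_gt0 n w p : p \in (Zn n w : seq (R * R)) -> 0 < p.2 <= p.1.
  by move=> /mapP[i _ ->].
have mZ n i : measurable_fun setT (Z n i) by [].
pose F := prob_filter P.
pose z (s : {n : nat & T n}) := Zn (projT1 s) (projT2 s).
pose s_ := moment r alpha0.
have s0E : s_ 0 = Upsilon r (varpi r) by exact: moment0.
have s0_gt0 : 0 < s_ 0 by exact: moment0_gt0.
have an0 : alpha0 != 0 by rewrite gt_eqF.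
have mS n m a : measurable_fun setT (fun w => power_mean (Zn n w) (sigma n) m a).
  have ma : measurable_fun setT (cst a : T n -> R) by [].
  exact: (measurable_power_mean (sigma_gt0 n) (mZ n) (Z_gt0 n) m ma).
have S_lln m a : (m <= 2)%N -> alpham < a < alphap ->
    along (fun n w => power_mean (Zn n w) (sigma n) m a) @ F -->
      \int[H]_(p in quadrant) (p.2 `^ (- a) * ln p.2 ^+ m).
  move=> m2 aI; apply: (cvg_prob_of_weak (Q := Q)) => [n|]; first exact: mS.
  by apply: Z_lln; constructor 4; exists m, a; split.
have cvg_S m : (m <= 2)%N -> along (fun n w => power_mean (Zn n w) (sigma n) m alpha1) @ F --> s_ m.
  move=> m2; have := S_lln m alpha1 m2; rewrite alpham1 alphap1 => /(_ isT).
  by rewrite {2}alpha1E mulrC (FW_moment_snd C alpha0_gt0 HFW) ?ltW.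
have mln1 n : measurable_fun setT (fun w => emp_mean (Zn n w) (sigma n) (fun p => ln p.1)).
  exact: (measurable_emp_mean_ln1 (sigma n) (mZ n)).
have mln2 n : measurable_fun setT (fun w => emp_mean (Zn n w) (sigma n) (fun p => ln p.2)).
  exact: (measurable_emp_mean_ln2 (sigma n) (mZ n)).
have ln1_lln : along (fun n w => emp_mean (Zn n w) (sigma n) (fun p => ln p.1)) @ F --> euler_gamma / alpha0.
  rewrite -(FW_log_fst alpha0_gt0 HFW); apply: (cvg_prob_of_weak (Q := Q)) => //.
  by apply: Z_lln; constructor 1.
have ln2_lln : along (fun n w => emp_mean (Zn n w) (sigma n) (fun p => ln p.2)) @ F -->
    (euler_gamma - r) / alpha0.
  rewrite -(FW_log_snd C alpha0_gt0 HFW); apply: (cvg_prob_of_weak (Q := Q)) => //.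
  by apply: Z_lln; constructor 2.
have cvg_L : along (fun n w => log_mean (Zn n w) (sigma n)) @ F -->
    euler_gamma / alpha0 + (euler_gamma - r) / alpha0 by exact: cvgD.
have mconst n : measurable [set w | constant (Zn n w)].
  exact: (measurable_constant (k_gt0 n) (mZ n)).
have near_nonconst : \forall s \near F, ~~ constant (z s).
  have c0 : P n [set w | constant (Zn n w)] @[n --> \oo] --> 0%E.
    have e n : [set w | constant (Zn n w)] = [set w | forall i j, Z n i w = Z n j w].
      by apply/seteqP; split=> w /= /(constant_mktuple (Z n) (k_gt0 n) w).
    by under eq_fun do rewrite e.
  have nc := prob_filter_not mconst c0.
  by near=> s; apply/negP; near: s.
(* The factor 4 leaves room for the exponents [alpha1 - 2 * dl] and [alpha1 + 2 * dl]. *)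
pose dl := Num.min (alpha1 - alpham) (alphap - alpha1) / 4.
have dl_gt0 : 0 < dl by rewrite divr_gt0// lt_min !subr_gt0 alpham1.
have [dl1 dl2] : 4 * dl <= alpha1 - alpham /\ 4 * dl <= alphap - alpha1.
  by rewrite /dl mulrC divfK// !ge_min !lexx ?orbT.
have lo_lln := S_lln 0 (alpha1 - 2 * dl) isT.
have hi_lln := S_lln 0 (alpha1 + 2 * dl) isT.
have cvg_lo := lo_lln ltac:(apply/andP; split; lra).
have cvg_hi := hi_lln ltac:(apply/andP; split; lra).
have root : 2 / alpha1 + 2 * s_ 1 / s_ 0 = euler_gamma / alpha0 + (euler_gamma - r) / alpha0.
  rewrite alpha1E; exact: score_limit_root.
have [ah [q0 [q1 [q2 [r0 [r1 [r2 [near_lin [cq0 cq1 cq2] [cr0 cr1 cr2]]]]]]]]] :=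
  @mle_linearization _ _ F (prob_filter_proper P) (fun s => k (projT1 s)) z (fun s => sigma (projT1 s))
    (fun s => k_gt0 (projT1 s)) (fun s => sigma_gt0 (projT1 s)) (fun s => @Zn_gt0 _ _)
    alpha1 _ dl _ _ s_ alpha1_gt0 s0_gt0 dl_gt0 cvg_S cvg_lo cvg_hi cvg_L root near_nonconst.
(* The deviations in the linear expansion are the empirical process over [v n]. *)
pose Wf (l : 'I_4) := along (fun n w => Wn n w l 0).
have WE0 s : Wf 0 s = v (projT1 s) * (power_mean (z s) (sigma (projT1 s)) 1 alpha1 - s_ 1).
  rewrite /Wf /along /Wn mxE /emp_process; congr (_ * (_ - _)).
  by rewrite /s_ /moment -(FW_moment_snd C alpha0_gt0 HFW) ?ltW// mulrC -alpha1E.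
have WE1 s : Wf 1 s = v (projT1 s) * (power_mean (z s) (sigma (projT1 s)) 0 alpha1 - s_ 0).
  have fE : fvec alpha1 1 = (fun p : R * R => p.2 `^ (- alpha1) * ln p.2 ^+ 0).
    by apply/funext => p; rewrite /= expr0 mulr1.
  rewrite /Wf /along /Wn mxE /emp_process fE; congr (_ * (_ - _)).
  by rewrite /s_ /moment -(FW_moment_snd C alpha0_gt0 HFW) ?ltW// mulrC -alpha1E.
have WE2 s : Wf 2 s + Wf 3 s = v (projT1 s) * (log_mean (z s) (sigma (projT1 s)) -
    (euler_gamma / alpha0 + (euler_gamma - r) / alpha0)).
  rewrite /Wf /along /Wn !mxE /emp_process.
  rewrite (FW_log_snd C alpha0_gt0 HFW) (FW_log_fst alpha0_gt0 HFW) /log_mean -/r.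
  rewrite -mulrDr; congr (_ * _); rewrite /z.
  move: (emp_mean _ _ _) (emp_mean _ _ _) (euler_gamma / alpha0) => E1 E2 E3; ring.
pose c (j : 'I_2) (l : 'I_4) : {n : nat & T n} -> R :=
  nth (fun=> 0) (nth [::] [:: [:: q0; q1; q2; q2]; [:: r0; r1; r2; r2]] j) l.
have c_cvg j l : c j l @ F --> M r alpha0 j l.
  rewrite M_entries// -alpha1E /c.
  by case: j => -[|[|//]] ? /=; case: l => -[|[|[|[|//]]]] ? /=.
pose X1 s := v (projT1 s) * (ah s - alpha1).
pose X2 s := v (projT1 s) * (sigma_hat (z s) / sigma (projT1 s) - s1).
have near_X : \forall s \near F, [/\ alpha_hat (z s) = (ah s)%:E,
    X1 s = \sum_l c 0 l s * Wf l s & X2 s = \sum_l c 1 l s * Wf l s].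
  apply: (@filterS _ F (prob_filter_filter P) _ _ _ near_lin) => s [ahE e1 e2].
  have lin (x0 x1 x2 : R) : v (projT1 s) * (x0 * (power_mean (z s) (sigma (projT1 s)) 1 alpha1 - s_ 1) +
      x1 * (power_mean (z s) (sigma (projT1 s)) 0 alpha1 - s_ 0) +
      x2 * (log_mean (z s) (sigma (projT1 s)) - (euler_gamma / alpha0 + (euler_gamma - r) / alpha0)))
      = x0 * Wf 0 s + x1 * Wf 1 s + x2 * Wf 2 s + x2 * Wf 3 s.
    rewrite -[RHS]addrA -(mulrDr x2) WE0 WE1 WE2.
    move: (_ - s_ 1) (_ - s_ 0) (_ - (_ + _)) => y0 y1 y2; ring.
  split; rewrite // sum_ord4 -lin; congr (_ * _); first exact: e1.
  by rewrite /s1 -s0E.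
have err_near : \forall s \near F, err (projT1 s) (projT2 s) = ((X1 s)%:E, X2 s).
  apply: (@filterS _ F (prob_filter_filter P) _ _ _ near_X) => s [ahE _ _].
  by rewrite /err /est_error ahE -EFinB -EFinM.
have mWn n l : measurable_fun setT (fun w => Wn n w l 0).
  under eq_fun do rewrite mxE /emp_process.
  apply: measurable_funM => //; apply: measurable_funB => //.
  case: l => -[|[|[|[|//]]]] i; rewrite /fvec /=.
  - exact: (mS n 1).
  - have -> : (fun p : R * R => p.2 `^ (- alpha1)) = (fun p => p.2 `^ (- alpha1) * ln p.2 ^+ 0).
      by apply/funext => p; rewrite expr0 mulr1.
    exact: (mS n 0).
  - exact: mln2.
  - exact: mln1.
pose h (j : 'I_2) (u : 'cV[R]_4) := (M r alpha0 *m u) j 0.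
have hE j u : h j u = \sum_l M r alpha0 j l * u l 0 by rewrite /h mxE.
have coord_cont l : continuous (fun u : 'cV[R]_4 => u l 0) by exact: coord_continuous.
have h_cont j : continuous (h j).
  have -> : h j = (fun u => \sum_l M r alpha0 j l * u l 0) by apply/funext => u; exact: hE.
  under eq_fun do rewrite sum_ord4.
  have term l : continuous (fun u : 'cV[R]_4 => M r alpha0 j l * u l 0).
    by move=> u; exact: (cvgMl_tmp (coord_cont l u)).
  have cD (f1 f2 : 'cV[R]_4 -> R) : continuous f1 -> continuous f2 ->
      continuous (fun u => f1 u + f2 u) by move=> cf1 cf2 u; exact: (cvgD (cf1 u) (cf2 u)).
  by apply: (cD _ _ (cD _ _ (cD _ _ (term 0) (term 1)) (term 2)) (term 3)).
have mh n j : measurable_fun setT (h j \o Wn n).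
  rewrite (_ : _ \o _ = (fun w => \sum_l M r alpha0 j l * Wn n w l 0)); last first.
    by apply/funext => w; exact: hE.
  by apply: measurable_sum => l; apply: measurable_funM => //; exact: mWn.
have mWlim l : measurable_fun setT (fun w => Wlim w l 0).
  by rewrite (_ : (fun w => _) = W l)//; apply/funext => w; rewrite /Wlim mxE.
have mhlim j : measurable_fun setT (h j \o Wlim).
  rewrite (_ : _ \o _ = (fun w => \sum_l M r alpha0 j l * Wlim w l 0)); last first.
    by apply/funext => w; exact: hE.
  by apply: measurable_sum => l; apply: measurable_funM => //; exact: mWlim.
have W_tight l : tight P (fun n w => Wn n w l 0).
  exact: (tight_of_weak (coord_cont l) (fun n => mWn n l) (mWlim l) W_cvg).
have rem_cvg (X : {n : nat & T n} -> R) j : (\forall s \near F, X s = \sum_l c j l s * Wf l s) ->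
    (fun s => X s - along (fun n => h j \o Wn n) s) @ F --> 0.
  move=> XE.
  have t0 : \sum_l (c j l s - M r alpha0 j l) * Wf l s @[s --> F] --> 0.
    have term l : (c j l s - M r alpha0 j l) * Wf l s @[s --> F] --> 0.
      apply: cvg0_tight => //.
      by rewrite -(subrr (M r alpha0 j l)); apply: cvgB; [exact: c_cvg|exact: cvg_cst].
    have -> : (fun s => \sum_l (c j l s - M r alpha0 j l) * Wf l s) =
        (fun s => (c j 0 s - M r alpha0 j 0) * Wf 0 s + (c j 1 s - M r alpha0 j 1) * Wf 1 s
          + (c j 2 s - M r alpha0 j 2) * Wf 2 s + (c j 3 s - M r alpha0 j 3) * Wf 3 s).
      by apply/funext => s; rewrite sum_ord4.
    rewrite (_ : (0 : R) = 0 + 0 + 0 + 0); last by rewrite !addr0.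
    exact: (cvgD (cvgD (cvgD (term 0) (term 1)) (term 2)) (term 3)).
  apply: cvg_trans t0; apply: near_eq_cvg.
  apply: (@filterS _ F (prob_filter_filter P) _ _ _ XE) => s ->.
  rewrite /along /= hE -sumrB; apply: eq_bigr => l _; exact: mulrBl.
have X1_rem : (fun s => X1 s - along (fun n => h 0 \o Wn n) s) @ F --> 0.
  apply: rem_cvg; by apply: (@filterS _ F (prob_filter_filter P) _ _ _ near_X) => s [].
have X2_rem : (fun s => X2 s - along (fun n => h 1 \o Wn n) s) @ F --> 0.
  apply: rem_cvg; by apply: (@filterS _ F (prob_filter_filter P) _ _ _ near_X) => s [].
have err_real n : exists A S : T n -> R, [/\ measurable_fun setT A, measurable_fun setT S &
    forall w, err n w = (if constant (Zn n w) then +oo%E else (A w)%:E, S w)].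
  have [A [S [mA mS' SE AE]]] := measurable_mle (k_gt0 n) (sigma_gt0 n) (mZ n) (Z_gt0 n).
  exists (fun w => v n * (A w - alpha1)), (fun w => v n * (S w / sigma n - s1)); split.
  - by apply: measurable_funM => //; exact: measurable_funB.
  - by apply: measurable_funM => //; apply: measurable_funB => //; exact: measurable_funM.
  - move=> w; rewrite /err /est_error SE AE; case: ifP => _ //.
    by rewrite gt0_muley// lte_fin.
clearbody err.
have mbconst n : measurable_fun setT (fun w => constant (Zn n w)).
  by apply: (measurable_fun_bool true); rewrite setTI.
have merr n (g : \bar R * R -> R) : continuous g -> measurable_fun setT (g \o err n).
  move=> cg; have [A [S [mA mS' AE]]] := err_real n.
  rewrite (_ : _ \o _ = (fun w => if constant (Zn n w) then g (+oo%E, S w) else g ((A w)%:E, S w))).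
    apply: measurable_fun_ifT => //.
      apply: (measurableT_comp (f := fun y => g (+oo%E, y))) => //.
      apply: continuous_measurable_fun => y.
      apply: (@continuous_comp _ _ _ (fun y : R => (+oo%E : \bar R, y))); last exact: cg.
      by apply: continuous_to_pair => {}y; [exact: cvg_cst|exact: cvg_id].
    exact: (measurable_continuous_pair (continuous_EFin_pair cg) mA mS').
  by apply/funext => w /=; rewrite AE; case: ifP.
split.
- move=> eps eps0; apply: prob_filter_prob0 => [n|].
    have [A [S [mA mS' AE]]] := err_real n.
    pose B w := Num.max `|A w - h 0 (Wn n w)| `|S w - h 1 (Wn n w)|.
    have mB : measurable_fun setT B.
      by apply: measurable_maxr; apply: measurableT_comp => //; apply: measurable_funB => //; exact: mh.
    have meps : measurable_fun [set: T n] (cst eps) by [].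
    have mE : measurable [set w | eps < B w].
      by have := measurable_fun_ltr meps mB measurableT (Y := [set true]) I; rewrite setTI; congr measurable.
    rewrite (_ : [set w | _] = [set w | constant (Zn n w)] `|` [set w | eps < B w]).
      exact: measurableU.
    apply/seteqP; split=> w /=; rewrite AE /sub_pair /ext_pair /=; case: ifP => cw.
    - by left.
    - by move=> b; right; move: b; rewrite -EFinB !abse_EFin -EFin_max lte_fin.
    - by move=> _; rewrite addye//= lt_max ltry.
    - by case=> //; rewrite -EFinB !abse_EFin -EFin_max lte_fin.
  have /cvgrPdist_lt/(_ _ eps0) near1 := X1_rem.
  have /cvgrPdist_lt/(_ _ eps0) near2 := X2_rem.
  apply: (@filterS3 _ F (prob_filter_filter P) _ _ _ _ _ near1 near2 err_near) => s.
  rewrite !sub0r !normrN => b1 b2 /= ->; rewrite /sub_pair /ext_pair /=.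
  by rewrite -EFin_max lte_fin; apply/negP; rewrite -leNgt ge_max !ltW.
- exact: (weak_cvg_slutsky (h_cont 0) (h_cont 1) (fun n => mh n 0) (fun n => mh n 1)
    (mhlim 0) (mhlim 1) merr err_near X1_rem X2_rem W_cvg).
- move=> rho01; split; [exact: class_C_independence| |exact: M_independence].
  by rewrite alpha1E rho01 varpi1 mul1r.
Unshelve. all: by end_near.
Qed.
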